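(* Let $\mathbb{F}$ be an arbitrary field with $\mathrm{char}(\mathbb{F})\neq 2$, let $V$ be a strongly finitely generated vertex operator algebra over $\mathbb{F}$, and let $M=\bigoplus_{n\in\mathbb{Z}_+}M(n)$ be an irreducible admissible $V$-module. Then: (1) Every element of $\mathrm{End}_V(M)$ is algebraic over $\mathbb{F}$. Moreover, $\mathrm{End}_V(M)$ is finite-dimensional over $\mathbb{F}$. (2) If $\mathbb{F}$ is algebraically closed, then $\mathrm{End}_V(M)\cong\mathbb{F}$, and there exists $\lambda\in\mathbb{F}$ such that $L(0)|_{M(n)}=\lambda+n$ for all $n$. (3) $M$ is an absolutely irreducible $V$-module if and only if $\mathrm{End}_V(M)\cong\mathbb{F}$.
   Context: $\mathbb{Z}_+$ denotes the set of non-negative integers. A vertex algebra over $\mathbb{F}$ is an $\mathbb{F}$-vector space $V$ with a linear map $Y(-,z):V\to(\mathrm{End}\,V)[[z,z^{-1}]]$, $v\mapsto Y(v,z)=\sum_{n\in\mathbb{Z}}v_nz^{-n-1}$, and a vector $\mathbf{1}\in V$ such that for all $u,v\in V$: $u_nv=0$ for $n$ sufficiently large; $Y(\mathbf{1},z)=\mathrm{Id}_V$; $Y(v,z)\mathbf{1}\in V[[z]]$ with $\lim_{z\to0}Y(v,z)\mathbf{1}=v$; and the Jacobi identity $$z_0^{-1}\delta\left(\tfrac{z_1-z_2}{z_0}\right)Y(u,z_1)Y(v,z_2)-z_0^{-1}\delta\left(\tfrac{z_2-z_1}{-z_0}\right)Y(v,z_2)Y(u,z_1)=z_2^{-1}\delta\left(\tfrac{z_1-z_0}{z_2}\right)Y(Y(u,z_0)v,z_2)$$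 holds, where $\delta(z)=\sum_{n\in\mathbb{Z}}z^n$ and powers of binomials are expanded in non-negative powers of the second variable. A vertex operator algebra over $\mathbb{F}$ is a vertex algebra with a grading $V=\bigoplus_{n\in\mathbb{Z}_+}V_n$, $\dim V_n<\infty$, $\mathbf{1}\in V_0$, and a vector $\omega\in V_2$, such that $u_nv\in V_{s+t-n-1}$ for $u\in V_s$, $v\in V_t$, $n\in\mathbb{Z}$ (with $V_k=0$ for $k<0$), and, writing $L(m)=\omega_{m+1}$, $[L(m),L(n)]=(m-n)L(m+n)+\frac12\binom{m+1}{3}\delta_{m+n,0}c$ for some $c\in\mathbb{F}$, $\frac{d}{dz}Y(v,z)=Y(L(-1)v,z)$, and $L(0)|_{V_n}=n$. $V$ is strongly finitely generated if there is a finite-dimensional subspace $U\subset V$ such that $V$ is spanned by the elements $u^1_{-n_1}\cdots u^r_{-n_r}\mathbf{1}$ with $r\geq0$, $u^i\in U$, $n_i\geq1$. A weak $V$-module is a vector space $M$ with a linear map $Y_M(-,z):V\to(\mathrm{End}\,M)[[z,z^{-1}]]$, $v\mapsto\sum_nv_nz^{-n-1}$, such that $u_lw=0$ for $l\gg0$ ($u\in V$, $w\in M$), $Y_M(\mathbf{1},z)=\mathrm{Id}_M$, and the Jacobi identity holds with $Y_M(u,z_1)$, $Y_M(v,z_2)$, $Y_M(Y(u,z_0)v,z_2)$ in place of the corresponding operators. An admissible $V$-module is a weak $V$-module with a grading $M=\bigoplus_{n\in\mathbb{Z}_+}M(n)$ such that $u_nM(t)\subset M(s+t-n-1)$ for $u\in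 V_s$, $n\in\mathbb{Z}$, $t\in\mathbb{Z}_+$ (with $M(k)=0$ for $k<0$). It is irreducible if it is nonzero and has no admissible (graded) submodules other than $0$ and itself. On $M$, $L(0)$ denotes $\omega_1$. $\mathrm{End}_V(M)$ is the $\mathbb{F}$-algebra of linear maps $M\to M$ commuting with all $v_n$ ($v\in V$, $n\in\mathbb{Z}$). For a field extension $\mathbb{K}/\mathbb{F}$, $V^{\mathbb{K}}=\mathbb{K}\otimes_{\mathbb{F}}V$ is the vertex operator algebra over $\mathbb{K}$ with vacuum $1\otimes\mathbf{1}$, conformal vector $1\otimes\omega$, and $Y^{\mathbb{K}}(\lambda\otimes a,z)(\mu\otimes b)=\lambda\mu\otimes Y(a,z)b$; $M^{\mathbb{K}}=\mathbb{K}\otimes_{\mathbb{F}}M=\bigoplus_n\mathbb{K}\otimes_{\mathbb{F}}M(n)$ is the admissible $V^{\mathbb{K}}$-module with $Y_{M^{\mathbb{K}}}(\lambda\otimes a,z)(\mu\otimes w)=\lambda\mu\otimes Y_M(a,z)w$. An irreducible admissible $V$-module $M$ is absolutely irreducible if $M^{\mathbb{K}}$ is an irreducible admissible $V^{\mathbb{K}}$-module for every field extension $\mathbb{K}/\mathbb{F}$. *)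

(* Defs.v *)
From HB Require Import structures.
From mathcomp Require Import all_boot all_order all_algebra generic_quotient.
From mathcomp Require Import boolp classical_sets functions.
Set Implicit Arguments.
Unset Strict Implicit.
Unset Printing Implicit Defensive.
Import Order.TTheory GRing.Theory.
Local Open Scope classical_set_scope.
Local Open Scope quotient_scope.
Local Open Scope ring_scope.

Section LinearAlgebra.
Variables (F : fieldType) (V : lmodType F).
Implicit Types (S : set V) (gr : nat -> set V).

Definition subspace S := submod_closed [pred x | x \in S].

Definition span S : set V :=
  [set v | exists (n : nat) (c : 'I_n -> F) (x : 'I_n -> V),
     (forall i, S (x i)) /\ v = \sum_i c i *: x i].

Definition finite_dim S := exists s : seq V, S = span [set` s].

(* V is the internal direct sum of the subspaces gr 0, gr 1, ... *)
Record direct_sum gr : Prop := DirectSum {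
  ds_subspace : forall n, subspace (gr n);
  ds_span : forall v, exists (N : nat) (x : nat -> V),
    (forall n, gr n (x n)) /\ v = \sum_(n < N) x n;
  ds_indep : forall (N : nat) (x : nat -> V), (forall n, gr n (x n)) ->
    \sum_(n < N) x n = 0 -> forall n, (n < N)%N -> x n = 0 }.

Definition gr_int gr (k : int) : set V :=
  match k with Posz n => gr n | Negz _ => [set 0] end.

End LinearAlgebra.

(* k (k - 1) ... (k - i + 1) / i!, see binzE *)
Definition binz (k : int) (i : nat) : int :=
  match k with
  | Posz n => 'C(n, i)%:Z
  | Negz n => (-1) ^+ i * 'C(n + i, i)%:Z
  end.

Lemma binzE k i : binz k i * i`!%:Z = \prod_(j < i) (k - j%:Z).
Proof.
case: k => n /=.
  rewrite -PoszM bin_ffact.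
  have [lt_ni|le_in] := ltnP n i.
    rewrite ffact_small // (bigD1 (Ordinal lt_ni)) //=.
    by rewrite subrr mul0r.
  rewrite ffact_prod -[Posz _]natz natr_prod; apply: eq_bigr => j _.
  by rewrite natz subzn // (leq_trans (ltnW (ltn_ord j)) le_in).
elim: i => [|i IH]; first by rewrite big_ord0 addn0 bin0.
rewrite big_ord_recr [RHS]/= -{}IH.
have E : 'C(n + i.+1, i.+1)%:Z * i.+1`!%:Z
    = 'C(n + i, i)%:Z * i`!%:Z * (n + i.+1)%:Z.
  by rewrite -!PoszM !bin_ffact addnS ffactSS mulnC.
rewrite -[LHS]mulrA E exprS mulN1r mulNr -mulrN -!mulrA.
by rewrite -!mulrN; do 3!congr (_ * _); rewrite NegzE -opprD -PoszD addnS addSn.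
Qed.

(* The coefficient of x^(k - i) y^i in (x - y)^k. *)
Definition expand_coef (k : int) (i : nat) : int := (-1) ^+ i * binz k i.

(* In all structures below Y u n v stands for u_n v, the coefficient of
   z^(-n-1) in Y(u, z) v. *)
Section Structures.
Variables (F : fieldType) (V : lmodType F) (Y : V -> int -> V -> V).

(* The coefficient of z0^(-l-1) z1^(-m-1) z2^(-n-1) in the Jacobi identity,
   applied to w. By the truncation axiom only finitely many i contribute to
   each of the three series, so the identity is one between partial sums of
   any sufficiently large length. *)
Definition jacobi_identity (M : lmodType F) (YM : V -> int -> M -> M) : Prop :=
  forall (u v : V) (w : M) (l m n : int), exists N0 : nat,
  forall N : nat, (N0 <= N)%N ->
    \sum_(i < N) YM u (l + m - i%:Z) (YM v (n + i%:Z) w) *~ expand_coef l i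
    - \sum_(i < N) YM v (l + n - i%:Z) (YM u (m + i%:Z) w)
        *~ ((-1) ^+ `|l|%N * expand_coef l i)
    = \sum_(i < N) YM (Y u (l + i%:Z) v) (m + n - i%:Z) w
        *~ expand_coef (i%:Z - m - 1) i.

Record weak_module_axioms (one : V) (M : lmodType F)
    (YM : V -> int -> M -> M) : Prop := MkWeakModule {
  wm_linearl : forall n w, linear (fun u => YM u n w);
  wm_linearr : forall u n, linear (YM u n);
  wm_trunc : forall u w, exists n0 : int, forall n, n0 <= n -> YM u n w = 0;
  wm_vacuum : forall n w, YM one n w = if n == -1 then w else 0;
  wm_jacobi : jacobi_identity YM }.

Record vertex_algebra_axioms (one : V) : Prop := MkVertexAlgebra {
  va_weak_module : weak_module_axioms one Y;
  va_creation : forall (v : V) (n : nat), Y v n one = 0;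
  va_creationN1 : forall v : V, Y v (-1) one = v }.

Record voa_axioms (one omega : V) (gr : nat -> set V) : Prop := MkVOA {
  voa_va : vertex_algebra_axioms one;
  voa_direct : direct_sum gr;
  voa_finite : forall n, finite_dim (gr n);
  voa_one : gr 0%N one;
  voa_omega : gr 2%N omega;
  voa_weight : forall (s t : nat) (n : int) u v, gr s u -> gr t v ->
    gr_int gr (s%:Z + t%:Z - n - 1) (Y u n v);
  voa_virasoro : exists c : F, forall (m n : int) v,
    Y omega (m + 1) (Y omega (n + 1) v) - Y omega (n + 1) (Y omega (m + 1) v)
    = Y omega (m + n + 1) v *~ (m - n)
      + (if m + n == 0 then (2%:R^-1 * (binz (m + 1) 3%N)%:~R * c) *: v else 0);
  (* d/dz Y(v, z) = Y(L(-1) v, z), where L(-1) = omega_0 *)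
  voa_derivation : forall (v w : V) (n : int),
    Y (Y omega 0 v) n w = Y v (n - 1) w *~ (- n);
  voa_L0 : forall (n : nat) v, gr n v -> Y omega 1 v = v *+ n }.

Record admissible_axioms (one : V) (gr : nat -> set V) (M : lmodType F)
    (YM : V -> int -> M -> M) (grM : nat -> set M) : Prop :=
  MkAdmissible {
  adm_weak : weak_module_axioms one YM;
  adm_direct : direct_sum grM;
  adm_weight : forall (s t : nat) (n : int) u w, gr s u -> grM t w ->
    gr_int grM (s%:Z + t%:Z - n - 1) (YM u n w) }.

End Structures.

Record voa (F : fieldType) := VOA {
  voa_space :> lmodType F;
  voa_Y : voa_space -> int -> voa_space -> voa_space;
  voa_vac : voa_space;
  voa_conf : voa_space;
  voa_gr : nat -> set voa_space;
  voaP : voa_axioms voa_Y voa_vac voa_conf voa_gr }.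

Record admissible_module (F : fieldType) (V : voa F) := AdmissibleModule {
  adm_space :> lmodType F;
  adm_Y : V -> int -> adm_space -> adm_space;
  adm_gr : nat -> set adm_space;
  admP : admissible_axioms (@voa_Y F V) (voa_vac V) (@voa_gr F V) adm_Y adm_gr }.

Arguments voa_Y {F V} : rename.
Arguments voa_gr {F} V n : rename.
Arguments adm_Y {F V M} : rename.
Arguments adm_gr {F V} M n : rename.

Definition strongly_finitely_generated (F : fieldType) (V : voa F) : Prop :=
  exists U : set V, finite_dim U /\
    span [set v | exists s : seq (V * nat),
      (forall p, p \in s -> U p.1 /\ (0 < p.2)%N) /\
      v = foldr (fun p w => voa_Y p.1 (- p.2%:Z) w) (voa_vac V) s] = setT.

Section Modules.
Variables (F : fieldType) (V : voa F) (M : admissible_module V).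

Record admissible_submodule (N : set M) : Prop := AdmissibleSubmodule {
  sub_subspace : subspace N;
  sub_stable : forall (v : V) (n : int) (w : M), N w -> N (adm_Y v n w);
  (* N is the sum of its homogeneous components N `&` M(n) *)
  sub_graded : N `<=` span [set w | N w /\ exists n, adm_gr M n w] }.

Definition irreducible : Prop :=
  (exists w : M, w != 0) /\
  forall N : set M, admissible_submodule N -> N = [set 0] \/ N = setT.

(* End_V(M), with composition as product. It is only a pzRingType because the
   zero module is not excluded here. *)
Definition is_voa_end (f : M -> M) : Prop :=
  linear f /\ forall (v : V) (n : int) (w : M),
    f (adm_Y v n w) = adm_Y v n (f w).

Record voa_end := VOAEnd {
  voa_end_fun :> M -> M;
  voa_end_subproof : `[< is_voa_end voa_end_fun >] }.

HB.instance Definition _ := [isSub for voa_end_fun].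
HB.instance Definition _ := [Choice of voa_end by <:].

Lemma voa_endP (f : voa_end) : is_voa_end f.
Proof. exact/asboolP/voa_end_subproof. Qed.

Lemma voa_Y_linear (v : V) n : linear (@adm_Y F V M v n).
Proof. exact: (wm_linearr (adm_weak (admP M))). Qed.

Lemma voa_Y0 (v : V) n : adm_Y v n (0 : M) = 0.
Proof.
have := voa_Y_linear v n (-1) 0 0.
by rewrite !scaleN1r oppr0 addr0 addNr.
Qed.

Lemma voa_end_submod_closed :
  submod_closed (fun f : M -> M => `[< is_voa_end f >]).
Proof.
split=> [|a f g /asboolP[lf cf] /asboolP[lg cg]]; apply/asboolP; split.
- by move=> a u v; rewrite /= scaler0 addr0.
- by move=> v n w; rewrite voa_Y0.
- move=> b u v /=.
  change (a *: f (b *: u + v) + g (b *: u + v) =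
    b *: (a *: f u + g u) + (a *: f v + g v)).
  rewrite lf lg !scalerDr !scalerA mulrC -!addrA; congr (_ + _).
  by rewrite addrCA.
- move=> v n w /=.
  change (a *: f (adm_Y v n w) + g (adm_Y v n w) =
    adm_Y v n (a *: f w + g w)).
  by rewrite cf cg voa_Y_linear.
Qed.

HB.instance Definition _ := GRing.SubChoice_isSubLmodule.Build F (M -> M)
  (fun f : M -> M => `[< is_voa_end f >]) voa_end voa_end_submod_closed.

Lemma voa_end_one_subproof : `[< is_voa_end id >].
Proof. exact/asboolP. Qed.
Definition voa_end_one := VOAEnd voa_end_one_subproof.

Lemma voa_end_mul_subproof (f g : voa_end) : `[< is_voa_end (f \o g) >].
Proof.
have [[lf cf] [lg cg]] := (voa_endP f, voa_endP g).
by apply/asboolP; split=> [a u v|v n w] /=; rewrite ?lg ?lf ?cg ?cf.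
Qed.
Definition voa_end_mul f g := VOAEnd (voa_end_mul_subproof f g).

Lemma voa_end_ext (f g : voa_end) : f =1 g -> f = g.
Proof. by move=> fg; apply/val_inj/funext. Qed.

Lemma voa_end_mulA : associative voa_end_mul.
Proof. by move=> f g h; apply: voa_end_ext. Qed.
Lemma voa_end_mul1r : left_id voa_end_one voa_end_mul.
Proof. by move=> f; apply: voa_end_ext. Qed.
Lemma voa_end_mulr1 : right_id voa_end_one voa_end_mul.
Proof. by move=> f; apply: voa_end_ext. Qed.
Lemma voa_end_mulDl : left_distributive voa_end_mul +%R.
Proof. by move=> f g h; apply: voa_end_ext. Qed.
Lemma voa_end_mulDr : right_distributive voa_end_mul +%R.
Proof.
move=> f g h; apply: voa_end_ext => w; have [lf _] := voa_endP f.
change (f (g w + h w) = f (g w) + f (h w)).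
by have := lf 1 (g w) (h w); rewrite !scale1r.
Qed.

HB.instance Definition _ := GRing.Zmodule_isPzRing.Build voa_end
  voa_end_mulA voa_end_mul1r voa_end_mulr1 voa_end_mulDl voa_end_mulDr.

Definition algebraic_end (f : voa_end) : Prop :=
  exists2 p : {poly F}, p != 0 & \sum_(i < size p) p`_i *: f ^+ i = 0.

Definition end_iso_base : Prop :=
  exists phi : {lrmorphism F^o -> voa_end}, bijective phi.

End Modules.

(* K (x)_F V for a field extension iota : F -> K. A list [:: (k1, v1); ...]
   stands for the formal sum k1 (x) v1 + ...; tens_rel is the least congruence
   containing the bilinearity relations. *)
Section Tensor.
Variables (F K : fieldType) (iota : {rmorphism F -> K}) (V : lmodType F).
Implicit Types (s t : seq (K * V)) (a b k : K) (u v : V).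

Inductive tens_rel : seq (K * V) -> seq (K * V) -> Prop :=
| tens_refl s : tens_rel s s
| tens_sym s t : tens_rel s t -> tens_rel t s
| tens_trans s1 s2 s3 : tens_rel s1 s2 -> tens_rel s2 s3 -> tens_rel s1 s3
| tens_cat s s' t t' :
    tens_rel s s' -> tens_rel t t' -> tens_rel (s ++ t) (s' ++ t')
| tens_comm s t : tens_rel (s ++ t) (t ++ s)
| tens_zero v : tens_rel [:: (0, v)] [::]
| tens_addl a b v : tens_rel [:: (a + b, v)] [:: (a, v); (b, v)]
| tens_addr a u v : tens_rel [:: (a, u + v)] [:: (a, u); (a, v)]
| tens_scale a (c : F) v : tens_rel [:: (a, c *: v)] [:: (a * iota c, v)].

Definition tens_eqv s t : bool := `[< tens_rel s t >].

Lemma tens_eqv_refl : reflexive tens_eqv.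
Proof. by move=> s; apply/asboolP/tens_refl. Qed.
Lemma tens_eqv_sym : symmetric tens_eqv.
Proof. by move=> s t; apply/asboolP/asboolP; apply: tens_sym. Qed.
Lemma tens_eqv_trans : transitive tens_eqv.
Proof.
by move=> t s r /asboolP st /asboolP tr; apply/asboolP/(tens_trans st).
Qed.

Canonical tens_equiv :=
  EquivRel tens_eqv tens_eqv_refl tens_eqv_sym tens_eqv_trans.

Definition tens : Type := {eq_quot tens_equiv}.
HB.instance Definition _ := Choice.on tens.
HB.instance Definition _ := EqQuotient.on tens.

Definition tmk s : tens := \pi_tens s.

Lemma tmkP s t : tens_rel s t -> tmk s = tmk t.
Proof. by move=> st; apply/eqP; rewrite /tmk eqmodE; apply/asboolP. Qed.

Lemma tmk_rel s t : tmk s = tmk t -> tens_rel s t.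
Proof. by move/eqP; rewrite /tmk eqmodE => /asboolP. Qed.

Lemma tmk_repr (x : tens) : tmk (repr x) = x.
Proof. exact: reprK. Qed.

Lemma repr_tmk s : tens_rel (repr (tmk s)) s.
Proof. by apply: tmk_rel; rewrite tmk_repr. Qed.

Definition tscale_seq k s : seq (K * V) := [seq (k * p.1, p.2) | p <- s].

Lemma tscale_rel k s t :
  tens_rel s t -> tens_rel (tscale_seq k s) (tscale_seq k t).
Proof.
elim=> {s t} [s|s t _|s1 s2 s3 _ + _|s s' t t' _ + _|s t|v|a b v|a u v|a c v] /=.
- exact: tens_refl.
- exact: tens_sym.
- exact: tens_trans.
- by rewrite /tscale_seq !map_cat; apply: tens_cat.
- by rewrite /tscale_seq !map_cat; apply: tens_comm.
- by rewrite mulr0; apply: tens_zero.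
- by rewrite mulrDr; apply: tens_addl.
- exact: tens_addr.
- by rewrite mulrA; apply: tens_scale.
Qed.

Definition tzero : tens := tmk [::].
Definition tadd (x y : tens) : tens := tmk (repr x ++ repr y).
Definition tscale k (x : tens) : tens := tmk (tscale_seq k (repr x)).
Definition topp (x : tens) : tens := tscale (-1) x.

Lemma tadd_mk s t : tadd (tmk s) (tmk t) = tmk (s ++ t).
Proof. by apply/tmkP/tens_cat; apply: repr_tmk. Qed.

Lemma tscale_mk k s : tscale k (tmk s) = tmk (tscale_seq k s).
Proof. exact/tmkP/tscale_rel/repr_tmk. Qed.

Lemma tmk_ind (P : tens -> Prop) : (forall s, P (tmk s)) -> forall x, P x.
Proof. by move=> Pmk x; rewrite -(tmk_repr x). Qed.

Lemma tscale0_seq s : tens_rel (tscale_seq 0 s) [::].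
Proof.
elim: s => [|[a v] s IH]; first exact: tens_refl.
rewrite /= mul0r; exact: (tens_cat (tens_zero v) IH).
Qed.

Lemma tscaleDl_seq a b s :
  tens_rel (tscale_seq (a + b) s) (tscale_seq a s ++ tscale_seq b s).
Proof.
elim: s => [|[c v] s IH]; first exact: tens_refl.
rewrite /= mulrDl.
apply: (tens_trans (tens_cat (tens_addl (a * c) (b * c) v) IH)).
rewrite -cat1s -[X in tens_rel _ X]cat1s -catA.
apply: tens_cat; first exact: tens_refl.
rewrite -[X in tens_rel _ (_ ++ X)]cat1s !catA.
by apply: tens_cat; [apply: tens_comm | apply: tens_refl].
Qed.

Lemma tscale1_seq s : tscale_seq 1 s = s.
Proof. by rewrite -[RHS]map_id; apply: eq_map => -[a v] /=; rewrite mul1r. Qed.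

Lemma taddA : associative tadd.
Proof.
by do 3!elim/tmk_ind=> ?; rewrite !tadd_mk catA.
Qed.
Lemma taddC : commutative tadd.
Proof.
by elim/tmk_ind=> s; elim/tmk_ind=> t; rewrite !tadd_mk; apply/tmkP/tens_comm.
Qed.
Lemma tadd0 : left_id tzero tadd.
Proof. by elim/tmk_ind=> s; rewrite tadd_mk. Qed.
Lemma taddN : left_inverse tzero topp tadd.
Proof.
elim/tmk_ind=> s; rewrite /topp tscale_mk tadd_mk; apply: tmkP.
rewrite -{2}(tscale1_seq s); apply: (tens_trans (tens_sym (tscaleDl_seq _ _ _))).
by rewrite addNr; apply: tscale0_seq.
Qed.

HB.instance Definition _ := GRing.isZmodule.Build tens taddA taddC tadd0 taddN.

Lemma tscaleA a b (x : tens) : tscale a (tscale b x) = tscale (a * b) x.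
Proof.
elim/tmk_ind: x => s; rewrite !tscale_mk /tscale_seq -map_comp.
by congr tmk; apply: eq_map => p /=; rewrite mulrA.
Qed.
Lemma tscale1 : left_id 1 tscale.
Proof. by elim/tmk_ind=> s; rewrite tscale_mk tscale1_seq. Qed.
Lemma tscaleDr : right_distributive tscale +%R.
Proof.
move=> a; elim/tmk_ind=> s; elim/tmk_ind=> t.
change (tscale a (tadd (tmk s) (tmk t)) =
  tadd (tscale a (tmk s)) (tscale a (tmk t))).
by rewrite [in LHS]tadd_mk !tscale_mk tadd_mk /tscale_seq map_cat.
Qed.
Lemma tscaleDl (x : tens) : {morph tscale^~ x : a b / a + b}.
Proof.
elim/tmk_ind: x => s a b.
change (tscale (a + b) (tmk s) = tadd (tscale a (tmk s)) (tscale b (tmk s))).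
by rewrite !tscale_mk tadd_mk; apply/tmkP/tscaleDl_seq.
Qed.

HB.instance Definition _ := GRing.Zmodule_isLmodule.Build K tens
  tscaleA tscale1 tscaleDr tscaleDl.

Lemma tmkD s t : tmk s + tmk t = tmk (s ++ t).
Proof. exact: tadd_mk. Qed.
Lemma tmkZ k s : k *: tmk s = tmk (tscale_seq k s).
Proof. exact: tscale_mk. Qed.

Definition tpure k v : tens := tmk [:: (k, v)].

Lemma tpureDl a b v : tpure (a + b) v = tpure a v + tpure b v.
Proof. by rewrite tmkD; apply/tmkP/tens_addl. Qed.
Lemma tpureDr a u v : tpure a (u + v) = tpure a u + tpure a v.
Proof. by rewrite tmkD; apply/tmkP/tens_addr. Qed.
Lemma tpureZl a b v : a *: tpure b v = tpure (a * b) v.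
Proof. by rewrite tmkZ. Qed.
Lemma tpureZr a c v : tpure a (c *: v) = iota c *: tpure a v.
Proof. by rewrite tpureZl mulrC; apply/tmkP/tens_scale. Qed.
Lemma tpure1 a v : tpure a v = a *: tpure 1 v.
Proof. by rewrite tpureZl mulr1. Qed.

Lemma tmk_sum s : tmk s = \sum_(p <- s) tpure p.1 p.2.
Proof.
elim: s => [|[a v] s IH]; first by rewrite big_nil.
by rewrite big_cons -IH tmkD.
Qed.

Lemma tens_ind (P : tens -> Prop) :
  (forall k x y, P x -> P y -> P (k *: x + y)) -> P 0 ->
  (forall v, P (tpure 1 v)) -> forall x, P x.
Proof.
move=> PD P0 Pv x; rewrite -(tmk_repr x) tmk_sum.
by elim: (repr x) => [|[a v] s IH];
  rewrite ?big_nil // big_cons /= tpure1; apply: PD.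
Qed.

Section Lift.
Variables (W : lmodType K) (f : V -> W).
Hypothesis f_lin : forall (c : F) u v, f (c *: u + v) = iota c *: f u + f v.

Definition tlift (x : tens) : W := \sum_(p <- repr x) p.1 *: f p.2.

Lemma tlift_rel s t : tens_rel s t ->
  \sum_(p <- s) p.1 *: f p.2 = \sum_(p <- t) p.1 *: f p.2.
Proof.
have f0 : f 0 = 0.
  by have := f_lin (-1) 0 0; rewrite rmorphN1 !scaleN1r oppr0 addr0 addNr.
elim=> {s t} [//|s t _ //|s1 s2 s3 _ -> _ //|s s' t t' _ E1 _ E2|s t|v|a b v
  |a u v|a c v].
- by rewrite !big_cat E1 E2.
- by rewrite !big_cat; apply: addrC.
- by rewrite big_seq1 big_nil scale0r.
- by rewrite big_seq1 big_cons big_seq1 scalerDl.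
- rewrite big_seq1 big_cons big_seq1 /=.
  by have := f_lin 1 u v; rewrite rmorph1 !scale1r => ->; rewrite scalerDr.
- rewrite !big_seq1 /=.
  by have := f_lin c v 0; rewrite f0 !addr0 => ->; rewrite scalerA.
Qed.

Lemma tlift_mk s : tlift (tmk s) = \sum_(p <- s) p.1 *: f p.2.
Proof. exact/tlift_rel/repr_tmk. Qed.

Lemma tlift_pure k v : tlift (tpure k v) = k *: f v.
Proof. by rewrite tlift_mk big_seq1. Qed.

Lemma tlift_linear : linear tlift.
Proof.
move=> a; elim/tmk_ind=> s; elim/tmk_ind=> t.
have -> : a *: tmk s + tmk t = tmk (tscale_seq a s ++ t).
  by rewrite -tmkD -tmkZ.
rewrite !tlift_mk big_cat; congr (_ + _).
rewrite /tscale_seq big_map scaler_sumr.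
by apply: eq_bigr => p _; rewrite scalerA.
Qed.

End Lift.

End Tensor.

(* The bilinear extension of f : (a (x) u, b (x) w) |-> a b (x) f u w, see
   text2_pure. *)
Section Bilinear.
Variables (F K : fieldType) (iota : {rmorphism F -> K}).
Variables (V W X : lmodType F) (f : V -> W -> X).

Definition text2 (x : tens iota V) (y : tens iota W) : tens iota X :=
  \sum_(p <- repr x) \sum_(q <- repr y) tpure iota (p.1 * q.1) (f p.2 q.2).

Hypothesis f_linl : forall w, linear (f^~ w).
Hypothesis f_linr : forall u, linear (f u).

Let g u (y : tens iota W) := tlift (fun w => tpure iota 1 (f u w)) y.

Let g_semir u c w w' : tpure iota 1 (f u (c *: w + w')) =
  iota c *: tpure iota 1 (f u w) + tpure iota 1 (f u w').
Proof. by rewrite f_linr tpureDr tpureZr. Qed.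

Let g_semil y c u u' : g (c *: u + u') y = iota c *: g u y + g u' y.
Proof.
rewrite /g /tlift scaler_sumr -big_split; apply: eq_bigr => p _ /=.
by rewrite f_linl tpureDr tpureZr scalerDr !scalerA mulrC.
Qed.

Let text2E x y : text2 x y = tlift (g^~ y) x.
Proof.
apply: eq_bigr => p _; rewrite /g /tlift scaler_sumr; apply: eq_bigr => q _.
by rewrite scalerA -tpure1.
Qed.

Lemma text2_pure a b u w :
  text2 (tpure iota a u) (tpure iota b w) = tpure iota (a * b) (f u w).
Proof.
rewrite text2E tlift_pure; last exact: g_semil.
by rewrite /g tlift_pure // scalerA -tpure1.
Qed.

Lemma text2_linl (y : tens iota W) : linear (text2^~ y).
Proof. by move=> a x x'; rewrite !text2E (tlift_linear (g_semil y)). Qed.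

Lemma text2_linr (x : tens iota V) : linear (text2 x).
Proof.
move=> a y y'; rewrite !text2E /tlift scaler_sumr -big_split.
apply: eq_bigr => p _ /=.
by rewrite /g (tlift_linear (g_semir p.2)) scalerDr !scalerA mulrC.
Qed.

End Bilinear.

Section SpanTheory.
Variables (F : fieldType) (V : lmodType F).
Implicit Types S A : set V.

Lemma subspaceP S :
  subspace S <-> S 0 /\ forall a u v, S u -> S v -> S (a *: u + v).
Proof.
split=> [[S0 SD]|[S0 SD]]; split.
- by move: S0; rewrite !inE.
- move=> a u v Su Sv; have := SD a u v; rewrite !inE; exact.
- by rewrite !inE.
- by move=> a u v; rewrite !inE; apply: SD.
Qed.

Lemma subspace_sum S (n : nat) (c : 'I_n -> F) (x : 'I_n -> V) :
  subspace S -> (forall i, S (x i)) -> S (\sum_i c i *: x i).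
Proof.
by move=> /subspaceP[S0 SD] Sx; elim/big_rec: _ => // i u _; apply: SD.
Qed.

Lemma span_min S A : subspace A -> S `<=` A -> span S `<=` A.
Proof.
by move=> Asub SA _ [n [c [x [Sx ->]]]]; apply: subspace_sum => // i; apply: SA.
Qed.

Lemma sub_span S : S `<=` span S.
Proof.
move=> v Sv; exists 1%N, (fun=> 1), (fun=> v).
by rewrite big_ord1 scale1r.
Qed.

Lemma span_subspace S : subspace (span S).
Proof.
apply/subspaceP; split=> [|a u v].
  by exists 0%N, (fun=> 0), (fun=> 0); rewrite big_ord0; split=> // -[].
move=> [n1 [c1 [x1 [S1 ->]]]] [n2 [c2 [x2 [S2 ->]]]].
exists (n1 + n2)%N.
exists (fun i => match fintype.split i with inl i => a * c1 i | inr i => c2 i end).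
exists (fun i => match fintype.split i with inl i => x1 i | inr i => x2 i end).
split=> [i|]; first by case: fintype.split.
rewrite big_split_ord scaler_sumr; congr (_ + _); apply: eq_bigr => i _.
  by rewrite (unsplitK (inl i)) scalerA.
by rewrite (unsplitK (inr i)).
Qed.

Lemma span_ext S A : S `<=` span A -> A `<=` span S -> span S = span A.
Proof.
move=> SA AS; apply/seteqP.
by split; apply: span_min => //; apply: span_subspace.
Qed.

Lemma subspace_gr_int gr k :
  (forall n, subspace (gr n : set V)) -> subspace (gr_int gr k).
Proof.
case: k => n //= _; apply/subspaceP; split=> // a u v -> ->.
by rewrite scaler0 addr0.
Qed.

End SpanTheory.

Section DirectSumTheory.
Variables (F : fieldType) (V : lmodType F) (gr : nat -> set V).

Definition decomp (v : V) (N : nat) (x : nat -> V) : Prop :=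
  [/\ forall n, gr n (x n), forall n, (N <= n)%N -> x n = 0
    & v = \sum_(n < N) x n].

Lemma decomp_widen v N N' x : (N <= N')%N -> decomp v N x -> decomp v N' x.
Proof.
move=> leN [grx x0 ->]; split=> // [n le_n|]; first exact/x0/(leq_trans leN).
rewrite (big_ord_widen _ x leN) [RHS](bigID (fun i : 'I_N' => (i < N)%N)) /=.
by rewrite [X in _ + X]big1 ?addr0 // => i; rewrite -leqNgt => /x0.
Qed.

Lemma decompD a u v N N' x y : (forall n, subspace (gr n)) ->
  decomp u N x -> decomp v N' y ->
  decomp (a *: u + v) (maxn N N') (fun n => a *: x n + y n).
Proof.
move=> sub_gr /(decomp_widen (leq_maxl N N'))[grx x0 ->].
move=> /(decomp_widen (leq_maxr N N'))[gry y0 ->]; split=> [n|n le_n|].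
- by have /subspaceP[_] := sub_gr n; apply.
- by rewrite x0 ?y0 // scaler0 addr0.
- by rewrite scaler_sumr big_split.
Qed.

Hypothesis dgr : direct_sum gr.

Lemma decomp_ex v : exists N x, decomp v N x.
Proof.
have [N [x [grx ->]]] := ds_span dgr v.
exists N, (fun n => if (n < N)%N then x n else 0); split=> [n|n|].
- by case: ifP => // _; have /subspaceP[] := ds_subspace dgr n.
- by rewrite leqNgt => /negbTE->.
- by apply: eq_bigr => i _; rewrite ltn_ord.
Qed.

Lemma decomp_uniq v N N' x y : decomp v N x -> decomp v N' y -> x =1 y.
Proof.
move=> dx dy n; have := decompD (-1) (ds_subspace dgr) dx dy.
rewrite scaleN1r addNr => -[grz z0 /esym sz].
have : -1 *: x n + y n = 0.
  have [le_n|lt_n] := leqP (maxn N N') n; first exact: z0.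
  exact: (ds_indep dgr grz sz).
by rewrite scaleN1r addrC => /eqP; rewrite subr_eq0 => /eqP.
Qed.

Lemma projections_ex : exists pr : nat -> V -> V,
  [/\ forall n, linear (pr n), forall n v, gr n v -> pr n v = v
    & forall n m v, n != m -> gr m v -> pr n v = 0].
Proof.
have /choice[f fP] : forall v, exists x, exists N, decomp v N x.
  by move=> v; have [N [x dx]] := decomp_ex v; exists x, N.
exists (fun n v => f v n).
have gr0 n : gr n 0 by have /subspaceP[] := ds_subspace dgr n.
have homog m v : gr m v ->
  decomp v m.+1 (fun n => if n == m then v else 0).
  move=> grv; split=> [n|n|]; first by case: eqP => // ->.
  - by case: eqP => // ->; rewrite ltnn.
  - rewrite (bigD1 ord_max) //= eqxx big1 ?addr0 // => i.
    by rewrite -val_eqE /= => /negbTE->.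
split=> [n a u v|n v grv|n m v nm grv].
- have [N dN] := fP (a *: u + v); have [N1 d1] := fP u.
  have [N2 d2] := fP v.
  exact: (decomp_uniq dN (decompD a (ds_subspace dgr) d1 d2)).
- have [N dN] := fP v.
  by rewrite (decomp_uniq dN (homog _ _ grv)) eqxx.
- have [N dN] := fP v.
  by rewrite (decomp_uniq dN (homog _ _ grv)) (negbTE nm).
Qed.

End DirectSumTheory.

Section LinearFun.
Variables (R : pzRingType) (U W : lmodType R) (f : U -> W).
Hypothesis f_lin : linear f.

Lemma linear_fun0 : f 0 = 0.
Proof. by have := f_lin (-1) 0 0; rewrite !scaleN1r oppr0 addr0 addNr. Qed.
Lemma linear_funD u v : f (u + v) = f u + f v.
Proof. by have := f_lin 1 u v; rewrite !scale1r. Qed.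
Lemma linear_funZ a u : f (a *: u) = a *: f u.
Proof. by have := f_lin a u 0; rewrite linear_fun0 !addr0. Qed.
Lemma linear_funMn u n : f (u *+ n) = f u *+ n.
Proof. by rewrite -scaler_nat linear_funZ scaler_nat. Qed.
Lemma linear_funMz u z : f (u *~ z) = f u *~ z.
Proof. by rewrite -scaler_int linear_funZ scaler_int. Qed.

End LinearFun.

Section TensorTheory.
Variables (F K : fieldType) (iota : {rmorphism F -> K}).

Section Pure.
Variable V : lmodType F.

Definition tin (v : V) : tens iota V := tpure iota 1 v.

Lemma tin_is_zmod_morphism : zmod_morphism tin.
Proof.
move=> u v; rewrite /tin tpureDr -[- v]scaleN1r tpureZr rmorphN1.
by rewrite scaleN1r.
Qed.
HB.instance Definition _ :=
  GRing.isZmodMorphism.Build V (tens iota V) tin tin_is_zmod_morphism.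

Lemma tinZ c v : tin (c *: v) = iota c *: tin v.
Proof. exact: tpureZr. Qed.

(* The image of K (x) S in K (x) V *)
Definition tspan (S : set V) : set (tens iota V) :=
  span [set x | exists k v, S v /\ x = tpure iota k v].

Lemma tspan_sub (S : set V) (A : set (tens iota V)) : subspace A ->
  (forall v, S v -> A (tin v)) -> tspan S `<=` A.
Proof.
move=> subA SA; apply: span_min => // _ [k [v [Sv ->]]].
have /subspaceP[A0 AD] := subA.
by rewrite tpure1 -[_ *: _]addr0; apply: AD => //; apply: SA.
Qed.

Lemma tspan_tin (S : set V) v : S v -> tspan S (tin v).
Proof. by move=> Sv; apply: sub_span; exists 1, v. Qed.

Lemma tspan_subspace (S : set V) : subspace (tspan S).
Proof. exact: span_subspace. Qed.

Lemma tspan_finite (S : set V) : finite_dim S -> finite_dim (tspan S).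
Proof.
move=> [s ->]; exists (map tin s).
have subT := @span_subspace K (tens iota V) [set` map tin s].
apply: span_ext.
- move=> _ [k [v [sv ->]]]; rewrite tpure1.
  have /subspaceP[T0 TD] := subT; rewrite -[_ *: _]addr0; apply: (TD) => //.
  case: sv => n [c [x [sx ->]]].
  rewrite -/(tin _) raddf_sum /=; elim/big_rec: _ => // i y _ Ty.
  rewrite tinZ; apply: (TD) => //; apply: sub_span => /=; apply: map_f; exact: sx.
- move=> x /= /mapP[v sv ->]; apply: tspan_tin; exact: sub_span.
Qed.

Lemma tens_eq_lin (W : lmodType K) (f g : tens iota V -> W) :
  linear f -> linear g -> (forall v, f (tin v) = g (tin v)) -> f =1 g.
Proof.
move=> lf lg fg; elim/tens_ind=> [k x y IHx IHy||v]; last exact: fg.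
- by rewrite lf lg IHx IHy.
- by rewrite !linear_fun0.
Qed.

End Pure.

Lemma tspan_gr_int (V : lmodType F) (gr : nat -> set V) k v :
  gr_int gr k v -> gr_int (fun n => tspan (gr n)) k (tin v).
Proof.
case: k => n /=; first exact: tspan_tin.
by move=> ->; rewrite raddf0.
Qed.

Lemma tspan_direct (V : lmodType F) (gr : nat -> set V) :
  direct_sum gr -> direct_sum (fun n => tspan (gr n)).
Proof.
move=> dgr; have sub_gr n := @tspan_subspace V (gr n).
split=> [n||N x grx sx n lt_n]; first exact: sub_gr.
  suff dec y : exists N x, decomp (fun n => tspan (gr n)) y N x.
    by move=> y; have [N [x [grx _ ->]]] := dec y; exists N, x.
  elim/tens_ind: y => [k y z [N [x dx]] [N' [x' dx']]||v].
  - exists (maxn N N'), (fun n => k *: x n + x' n).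
    exact: (decompD k sub_gr dx dx').
  - exists 0%N, (fun=> 0); split=> // [n|]; last by rewrite big_ord0.
    by have /subspaceP[] := sub_gr n.
  - have [N [x [grx x0 ->]]] := decomp_ex dgr v.
    exists N, (fun n => tin (x n)); split=> [n|n le_n|].
    + exact: tspan_tin.
    + by rewrite x0 // raddf0.
    + by rewrite -/(tin _) raddf_sum.
have [pr [lpr prK pr0]] := projections_ex dgr.
pose P := @tlift F K iota V _ (fun v => tin (pr n v)).
have semi c u v : tin (pr n (c *: u + v)) =
    iota c *: tin (pr n u) + tin (pr n v).
  by rewrite lpr raddfD /= tinZ.
have lP : linear P by exact: tlift_linear.
have Ptin v : P (tin v) = tin (pr n v) by rewrite /P tlift_pure // scale1r.
have PK y : tspan (gr n) y -> P y = y.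
  apply: (@tspan_sub _ _ [set y | P y = y]) => [|v grv /=].
    by apply/subspaceP; split=> [|a u v /= Pu Pv];
      rewrite /= ?linear_fun0 // lP Pu Pv.
  by rewrite Ptin prK.
have P0 m y : n != m -> tspan (gr m) y -> P y = 0.
  move=> nm; apply: (@tspan_sub _ _ [set y | P y = 0]) => [|v grv /=].
    apply/subspaceP; split=> [|a u v /= Pu Pv]; rewrite /= ?linear_fun0 //.
    by rewrite lP Pu Pv scaler0 addr0.
  by rewrite Ptin (pr0 _ m) // raddf0.
have : P (\sum_(n < N) x n) = x n.
  rewrite (big_morph P (linear_funD lP) (linear_fun0 lP)).
  rewrite (bigD1 (Ordinal lt_n)) //= PK // big1 ?addr0 // => i ni.
  by apply: (P0 i) => //; rewrite eq_sym -val_eqE in ni *.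
by rewrite sx linear_fun0.
Qed.

End TensorTheory.

(* Stability under linear combinations of an identity between series of finite
   support, whose partial sums are those of T1, T2, T3. *)
Lemma eventual_linear (K : fieldType) (U W : lmodType K)
    (T1 T2 T3 : U -> nat -> W) :
  (forall i, linear (T1^~ i)) -> (forall i, linear (T2^~ i)) ->
  (forall i, linear (T3^~ i)) ->
  let P x := exists N0 : nat, forall N : nat, (N0 <= N)%N ->
    \sum_(i < N) T1 x i - \sum_(i < N) T2 x i = \sum_(i < N) T3 x i in
  P 0 /\ forall a x y, P x -> P y -> P (a *: x + y).
Proof.
move=> l1 l2 l3 P; split.
  exists 0%N => N _; rewrite !big1 ?subr0 // => i _.
  - exact: (linear_fun0 (l3 i)).
  - exact: (linear_fun0 (l2 i)).
  - exact: (linear_fun0 (l1 i)).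
move=> a x y [N1 P1] [N2 P2]; exists (maxn N1 N2) => N.
rewrite geq_max => /andP[le1 le2].
have S T : (forall i, linear (T^~ i)) -> \sum_(i < N) T (a *: x + y) i =
    a *: (\sum_(i < N) T x i) + \sum_(i < N) T y i :> W.
  by move=> lT; rewrite scaler_sumr -big_split; apply: eq_bigr => i _; apply: lT.
rewrite (S T1) // (S T2) // (S T3) // -P1 // -P2 // scalerBr opprD !addrA; congr (_ + _).
by rewrite addrAC.
Qed.

Arguments tspan {F K} iota {V} S.
Section BaseChange.
Variables (F K : fieldType) (iota : {rmorphism F -> K}).

(* (k (x) u)_n (k' (x) w) = k k' (x) u_n w, see base_change_op_pure *)
Definition base_change_op (V M : lmodType F) (Y : V -> int -> M -> M) :
    tens iota V -> int -> tens iota M -> tens iota M :=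
  fun x n y => text2 (fun u w => Y u n w) x y.

Section WeakModule.
Variables (V : lmodType F) (Y : V -> int -> V -> V) (one : V).
Variables (M : lmodType F) (YM : V -> int -> M -> M).
Hypothesis hV : weak_module_axioms Y one Y.
Hypothesis hM : weak_module_axioms Y one YM.
Local Notation YK := (base_change_op Y).
Local Notation YMK := (base_change_op YM).

Lemma base_change_op_pure a b u n w :
  YMK (tpure iota a u) n (tpure iota b w) = tpure iota (a * b) (YM u n w).
Proof.
by apply: text2_pure => [w'|u']; [apply: (wm_linearl hM)|apply: (wm_linearr hM)].
Qed.

Lemma base_change_op_tin u n w :
  YMK (tin iota u) n (tin iota w) = tin iota (YM u n w).
Proof. by rewrite base_change_op_pure mulr1. Qed.

Lemma base_change_op_linl n y : linear (fun x => YMK x n y).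
Proof.
by apply: text2_linl => w'; apply: (wm_linearl hM).
Qed.

Lemma base_change_op_linr x n : linear (YMK x n).
Proof.
by apply: text2_linr => u'; apply: (wm_linearr hM).
Qed.

End WeakModule.

Section Linear.
Variables (U W : lmodType K).
Lemma linear_mulrz (f : U -> W) z : linear f -> linear (fun x => f x *~ z).
Proof. by move=> lf a x y; rewrite lf mulrzDl scalerMzr. Qed.
End Linear.

Lemma weak_module_base_change (V : lmodType F) (Y : V -> int -> V -> V)
    (one : V) (M : lmodType F) (YM : V -> int -> M -> M) :
  weak_module_axioms Y one Y -> weak_module_axioms Y one YM ->
  weak_module_axioms (base_change_op Y) (tin iota one) (base_change_op YM).
Proof.
move=> hV hM.
have linl n y := base_change_op_linl hM n y.
have linr x n := base_change_op_linr hM x n.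
have Vlinl n y := base_change_op_linl hV n y.
have Vlinr x n := base_change_op_linr hV x n.
split=> //.
- move=> x y; elim/tens_ind: x => [k x x' [N HN] [N' HN']||u].
  + exists (Num.max N N') => n; rewrite ge_max => /andP[le1 le2].
    by rewrite linl HN // HN' // scaler0 addr0.
  + by exists 0 => n _; rewrite (linear_fun0 (linl n y)).
  elim/tens_ind: y => [k y y' [N HN] [N' HN']||w].
  + exists (Num.max N N') => n; rewrite ge_max => /andP[le1 le2].
    by rewrite linr HN // HN' // scaler0 addr0.
  + by exists 0 => n _; rewrite (linear_fun0 (linr _ n)).
  have [N HN] := wm_trunc hM u w; exists N => n le_n.
  by rewrite -/(tin _ _) (base_change_op_tin hM) HN // raddf0.
- move=> n; apply: tens_eq_lin => [||v].
  + exact: linr.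
  + by move=> a x y; case: eqP => // _; rewrite scaler0 addr0.
  + rewrite (base_change_op_tin hM) (wm_vacuum hM).
    by case: eqP; rewrite ?raddf0.
move=> u v w l m n; move: u.
pose YK := base_change_op Y; pose YMK := base_change_op YM.
have key (U : lmodType K) (T1 T2 T3 : U -> nat -> tens iota M) :=
  eventual_linear (T1 := T1) (T2 := T2) (T3 := T3).
have [K0 KD] := key _
  (fun u i => YMK u (l + m - i%:Z) (YMK v (n + i%:Z) w) *~ expand_coef l i)
  (fun u i => YMK v (l + n - i%:Z) (YMK u (m + i%:Z) w)
        *~ ((-1) ^+ `|l|%N * expand_coef l i))
  (fun u i => YMK (YK u (l + i%:Z) v) (m + n - i%:Z) w
        *~ expand_coef (i%:Z - m - 1) i)
  (fun i => linear_mulrz _ (linl _ _))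
  (fun i => linear_mulrz _ (fun a x y => etrans (congr1 _ (linl _ _ a x y))
     (linr _ _ a _ _)))
  (fun i => linear_mulrz _ (fun a x y =>
     etrans (congr1 (fun z => YMK z _ _) (Vlinl _ _ a x y)) (linl _ _ a _ _))).
elim/tens_ind; [by move=> k x y; apply: KD | exact: K0 |] => u.
clear K0 KD; move: v.
have [K0 KD] := key _
  (fun v i => YMK (tin iota u) (l + m - i%:Z) (YMK v (n + i%:Z) w)
        *~ expand_coef l i)
  (fun v i => YMK v (l + n - i%:Z) (YMK (tin iota u) (m + i%:Z) w)
        *~ ((-1) ^+ `|l|%N * expand_coef l i))
  (fun v i => YMK (YK (tin iota u) (l + i%:Z) v) (m + n - i%:Z) w
        *~ expand_coef (i%:Z - m - 1) i)
  (fun i => linear_mulrz _ (fun a x y => etrans (congr1 _ (linl _ _ a x y))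
     (linr _ _ a _ _)))
  (fun i => linear_mulrz _ (linl _ _))
  (fun i => linear_mulrz _ (fun a x y =>
     etrans (congr1 (fun z => YMK z _ _) (Vlinr _ _ a x y)) (linl _ _ a _ _))).
elim/tens_ind; [by move=> k x y; apply: KD | exact: K0 |] => v.
clear K0 KD; move: w.
have [K0 KD] := key _
  (fun w i => YMK (tin iota u) (l + m - i%:Z) (YMK (tin iota v) (n + i%:Z) w)
        *~ expand_coef l i)
  (fun w i => YMK (tin iota v) (l + n - i%:Z) (YMK (tin iota u) (m + i%:Z) w)
        *~ ((-1) ^+ `|l|%N * expand_coef l i))
  (fun w i => YMK (YK (tin iota u) (l + i%:Z) (tin iota v)) (m + n - i%:Z) w
        *~ expand_coef (i%:Z - m - 1) i)
  (fun i => linear_mulrz _ (fun a x y => etrans (congr1 _ (linr _ _ a x y))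
     (linr _ _ a _ _)))
  (fun i => linear_mulrz _ (fun a x y => etrans (congr1 _ (linr _ _ a x y))
     (linr _ _ a _ _)))
  (fun i => linear_mulrz _ (linr _ _)).
elim/tens_ind; [by move=> k x y; apply: KD | exact: K0 |] => w.
clear K0 KD key; have [N0 HN] := wm_jacobi hM u v w l m n.
exists N0 => N /HN/(congr1 (@tin F K iota M)).
rewrite raddfB /= !raddf_sum /= => E.
apply: etrans (etrans _ E) _; first congr (_ + _); last 1 first.
- by apply: eq_bigr => i _;
    rewrite !(base_change_op_tin hV, base_change_op_tin hM) raddfMz.
- by apply: eq_bigr => i _; rewrite !(base_change_op_tin hM) raddfMz.
- apply: eq_bigr => i _; congr (- _).
  by rewrite !(base_change_op_tin hM) raddfMz.
Qed.

Lemma weight_base_change (V M : lmodType F) (Y : V -> int -> V -> V) (one : V)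
    (YM : V -> int -> M -> M) (gr : nat -> set V) (grM : nat -> set M) :
  weak_module_axioms Y one Y -> weak_module_axioms Y one YM ->
  (forall (s t : nat) (n : int) u w, gr s u -> grM t w ->
    gr_int grM (s%:Z + t%:Z - n - 1) (YM u n w)) ->
  forall (s t : nat) (n : int) x y,
    tspan iota (gr s) x -> tspan iota (grM t) y ->
    gr_int (fun n => tspan iota (grM n)) (s%:Z + t%:Z - n - 1)
      (base_change_op YM x n y).
Proof.
move=> hV hM wt s t n x y sx ty.
have /subspaceP[G0 GD] := subspace_gr_int (s%:Z + t%:Z - n - 1)
  (fun n => @tspan_subspace F K iota M (grM n)).
have linl k z := base_change_op_linl hM k z.
have linr z k := base_change_op_linr hM z k.
set G := gr_int _ _ in G0 GD *.
apply: (@tspan_sub _ _ iota _ (gr s) [set x | G (base_change_op YM x n y)])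
  (sx) => [|u su /=].
  apply/subspaceP; split=> /= [|a x1 x2 G1 G2].
    by rewrite (linear_fun0 (linl n y)).
  by rewrite linl; apply: GD.
apply: (@tspan_sub _ _ iota _ (grM t)
  [set y | G (base_change_op YM (tin iota u) n y)]) (ty) => [|w tw /=].
  apply/subspaceP; split=> /= [|a y1 y2 G1 G2].
    by rewrite (linear_fun0 (linr _ n)).
  by rewrite linr; apply: GD.
by rewrite (base_change_op_tin hM); apply: tspan_gr_int; apply: wt.
Qed.

Lemma voa_base_change_axioms (V : lmodType F) (Y : V -> int -> V -> V)
    (one omega : V) (gr : nat -> set V) :
  voa_axioms Y one omega gr ->
  voa_axioms (base_change_op Y) (tin iota one) (tin iota omega)
    (fun n => tspan iota (gr n)).
Proof.
move=> hV; have hA := voa_va hV; have hW := va_weak_module hA.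
have linl k z := base_change_op_linl hW k z.
have linr z k := base_change_op_linr hW z k.
have lin0 (U : lmodType K) : linear (fun _ : U => 0 : tens iota V).
  by move=> a x y; rewrite scaler0 addr0.
split.
- split; first exact: weak_module_base_change.
  + move=> x n; move: x; apply: tens_eq_lin => [||v]; [exact: linl|exact: lin0|].
    by rewrite /= (base_change_op_tin hW) (va_creation hA) raddf0.
  + apply: tens_eq_lin => // v.
    by rewrite /= (base_change_op_tin hW) (va_creationN1 hA).
- exact/tspan_direct/(voa_direct hV).
- by move=> n; apply/tspan_finite/(voa_finite hV).
- exact/tspan_tin/(voa_one hV).
- exact/tspan_tin/(voa_omega hV).
- exact/(weight_base_change hW hW)/(voa_weight hV).
- have [c vir] := voa_virasoro hV; exists (iota c) => m n.
  apply: tens_eq_lin => [a x y|a x y|v].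
  + by rewrite !linr scalerBr opprD !addrA; congr (_ + _); rewrite addrAC.
  + rewrite !linr mulrzDl scalerMzr [in RHS]scalerDr [RHS]addrACA.
    congr (_ + _); case: eqP => _; last by rewrite scaler0 addr0.
    by rewrite scalerDr !scalerA mulrC.
  + rewrite /= !(base_change_op_tin hW) -raddfB /= vir raddfD /= raddfMz.
    congr (_ + _); case: eqP => _; last by rewrite raddf0.
    by rewrite tinZ !rmorphM fmorphV rmorph_nat rmorph_int.
- move=> x y n; move: x; apply: tens_eq_lin => [a x x'|a x x'|v].
  + by rewrite linr linl.
  + by rewrite linl mulrzDl scalerMzr.
  move: y; apply: tens_eq_lin => [a y y'|a y y'|w].
  + by rewrite linr.
  + by rewrite linr mulrzDl scalerMzr.
  + by rewrite /= !(base_change_op_tin hW) (voa_derivation hV) raddfMz.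
- move=> n; apply: (@tspan_sub _ _ _ _ _ [set v | _ = _]) => [|v gv /=].
    apply/subspaceP; split=> /= [|a x y Hx Hy].
      by rewrite (linear_fun0 (linr _ _)) mul0rn.
    by rewrite linr Hx Hy mulrnDl scalerMnr.
  by rewrite /= (base_change_op_tin hW) (voa_L0 hV gv) raddfMn.
Qed.

Definition voa_base_change (V : voa F) : voa K :=
  VOA (voa_base_change_axioms (voaP V)).

Lemma admissible_base_change_axioms (V : voa F) (M : admissible_module V) :
  admissible_axioms (@voa_Y K (voa_base_change V))
    (voa_vac (voa_base_change V)) (@voa_gr K (voa_base_change V))
    (base_change_op (@adm_Y F V M)) (fun n => tspan iota (adm_gr M n)).
Proof.
have hW := va_weak_module (voa_va (voaP V)).
have [hM dM wM] := admP M; split.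
- exact: weak_module_base_change.
- exact: tspan_direct.
- exact: weight_base_change hW hM wM.
Qed.

Definition module_base_change (V : voa F) (M : admissible_module V) :
    admissible_module (voa_base_change V) :=
  AdmissibleModule (admissible_base_change_axioms M).

End BaseChange.

Definition absolutely_irreducible (F : fieldType) (V : voa F)
    (M : admissible_module V) : Prop :=
  irreducible M /\
  forall (K : fieldType) (iota : {rmorphism F -> K}),
    irreducible (module_base_change iota M).

(* Main.v *)
(* Let [M] be irreducible, [n0] its lowest degree and [D = End_V(M)]. Elements of
   [D] preserve degrees, so [D] is a division ring acting on [M(n0)]. By the
   formulas of Zhu, [M(n0)] is spanned by the ordered monomials, applied to any
   nonzero [w], in the zero modes of finitely many generators of [V], and reordering a
   product of zero modes only creates terms of lower weight. A Groebner basis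
   argument then shows that a commutative division subring [K] of [D] is finitely
   generated as an [F]-algebra, hence finite over [F] by Zariski's lemma. Taking [K]
   maximal, so that [K] is its own centralizer, Artin's argument bounds the
   dimension of [D] over [K]. Part (2) follows because [L(0) - n] on [M(n)] lies in
   [D]. For part (3), if [M^K] is irreducible then the kernel of the action map
   [K (x) M -> M] vanishes, which forces [K = F]; conversely, if [D = F], a tensor of
   minimal length in a nonzero submodule of [M^K] is pure. *)
From HB Require Import structures.
Require Import Defs.
From mathcomp Require Import all_boot all_order all_algebra.
From mathcomp Require Import boolp classical_sets functions.
From mathcomp Require Import mpoly zify.
Import Defs. (* so that [span] is not the one of [vector] *)
Set Implicit Arguments.
Unset Strict Implicit.
Unset Printing Implicit Defensive.
Import Order.TTheory GRing.Theory Num.Theory.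
Local Open Scope classical_set_scope.
Local Open Scope ring_scope.

(** * Linear algebra over fields and division rings *)

(** The spaces [M(n)] may be infinite-dimensional and [F] may be countable, so neither eigenvalues
    on [M(n0)] nor a cardinality count makes endomorphisms algebraic. The substitute is in the
    spirit of Quillen's lemma: the zero modes commute up to lower weight, so finitely many relations
    over [K] control all others. What ties [K] back to [F] is that [k w] stays in [M(n0)], which the
    monomials at [w] already span over [F]. Zariski's lemma needs a commutative ring, and [D] need
    not be one; hence the detour through [K]. The same maximal [K] is the extension field tested in
    part (3): once [K = F], all of [D] commutes with [K], so [D = F]. In the converse, the
    components of a minimal tensor generate a submodule of [M^r] that is the graph of endomorphisms
    over its first coordinate. *)

Lemma functional_ex (F : fieldType) (M : lmodType F) (w : M) : w != 0 ->
  exists psi : M -> F^o, linear psi /\ psi w = 1.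
Proof.
move=> w0.
(* The kernel will be a maximal subspace avoiding [w]. The empty chain has empty union, so [P]
   cannot ask for 0 in [H]; maximality gives it back in [A0]. *)
pose P := [set H : set M | (forall a u v, H u -> H v -> H (a *: u + v)) /\ ~ H w].
have [|A [[AD Aw] Amax]] := @Zorn_bigcup _ P.
  move=> C CP totC; split=> [a u v [X CX Xu] [Y CY Yv]|[X CX Xw]]; last first.
    by have [_] := CP _ CX; apply.
  have [XY|YX] := totC _ _ CX CY.
    by exists Y => //; have [+ _] := CP _ CY; apply => //; apply: XY.
  by exists X => //; have [+ _] := CP _ CX; apply => //; apply: YX.
have A0 : A 0.
  have [[u Au]|nA] := pselect (exists u, A u).
    by have := AD (-1) _ _ Au Au; rewrite scaleN1r addNr.
  have [] := Amax [set 0]; last first.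
    split=> [a u v -> ->|/eqP]; first by rewrite scaler0 addr0.
    by rewrite (negbTE w0).
  split=> [u Au|/(_ 0 erefl) Au]; first by case: nA; exists u.
  by case: nA; exists 0.
have AZ a u : A u -> A (a *: u) by move=> Au; rewrite -[_ *: _]addr0; apply: AD.
have dec v : exists c : F, A (v - c *: w).
  have [Av|Av] := pselect (A v); first by exists 0; rewrite scale0r subr0.
  pose B := [set x | exists a c, A a /\ x = a + c *: v].
  have Bw : B w.
    apply: contrapT => Bw; apply: (Amax B); split.
    - by move=> x Ax; exists x, 0; rewrite scale0r addr0.
    - by move=> /(_ v) Bv; apply/Av/Bv; exists 0, 1; rewrite scale1r add0r.
    - move=> c _ _ [a [d [Aa ->]]] [a' [d' [Aa' ->]]].
      exists (c *: a + a'), (c * d + d'); split; first exact: AD.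
      by rewrite scalerDr scalerDl scalerA addrACA.
    - by [].
  case: Bw => a [c [Aa def_w]].
  have c0 : c != 0.
    by apply: contra_notN Aw => /eqP c0; rewrite def_w c0 scale0r addr0.
  exists c^-1; rewrite [in X in _ - X]def_w scalerDr scalerA mulVf // scale1r.
  by rewrite opprD addrCA subrr addr0 -scaleNr; apply: AZ.
have /choice[psi psiP] := dec.
have uniq v c : A (v - c *: w) -> psi v = c.
  move=> Avc; apply/eqP; rewrite -subr_eq0; apply/negP => /negP nz; apply: Aw.
  have := AD (-1) _ _ (psiP v) Avc; rewrite scaleN1r opprB addrA subrK -scalerBl.
  by move/(AZ (psi v - c)^-1); rewrite scalerA mulVf // scale1r.
exists psi; split=> [a u v|]; apply: uniq; last by rewrite scale1r subrr.
rewrite (_ : _ - _ = a *: (u - psi u *: w) + (v - psi v *: w)); first exact: AD.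
by rewrite scalerDl -scalerA scalerBr opprD addrACA.
Qed.

Section DivisionRing.
Variable D : pzRingType.
Hypothesis divD : forall x : D, x != 0 -> exists y, y * x = 1 /\ x * y = 1.

(** Gaussian elimination with the coefficients kept to the left of the unknowns: a pivot in the last
    equation expresses one unknown through the others; without a pivot that equation is dropped
    together with one unknown. *)
Lemma underdetermined_system n (a : 'I_n.+1 -> 'I_n -> D) : (1 : D) != 0 ->
  exists y : 'I_n.+1 -> D,
    (exists j, y j != 0) /\ forall i, \sum_j a j i * y j = 0.
Proof.
move=> D1; elim: n a => [|n IHn] a.
  by exists (fun=> 1); split=> [|[]//]; exists ord0.
have [a0|] := pselect (forall j, a j ord_max = 0).
  have [y [[j0 yj0] ya]] := IHn (fun j i => a (lift ord_max j) (lift ord_max i)).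
  exists (fun j => if unlift ord_max j is Some k then y k else 0).
  split=> [|i]; first by exists (lift ord_max j0); rewrite liftK.
  have [k ->|->] := unliftP ord_max i; last first.
    by rewrite big1 // => j _; rewrite a0 mul0r.
  rewrite (bigD1_ord ord_max) //= unlift_none mulr0 add0r -[RHS](ya k).
  by apply: eq_bigr => j _; rewrite liftK.
move=> /existsNP[j0 /eqP/divD[b [_ ab]]].
pose c k := b * a (lift j0 k) ord_max.
have [y [[k0 yk0] ya]] := IHn (fun k i =>
  a (lift j0 k) (lift ord_max i) - a j0 (lift ord_max i) * c k).
pose y0 := - \sum_k c k * y k.
exists (fun j => if unlift j0 j is Some k then y k else y0).
split=> [|i]; first by exists (lift j0 k0); rewrite liftK.
rewrite (bigD1_ord j0) //= unlift_none.
have -> : \sum_k a (lift j0 k) i * (if unlift j0 (lift j0 k) is Some k' then y k'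
    else y0) = \sum_k a (lift j0 k) i * y k.
  by apply: eq_bigr => k _; rewrite liftK.
have [k ->|->] := unliftP ord_max i; last first.
  rewrite mulrN mulr_sumr addrC -sumrB big1 // => k _.
  by rewrite /c !mulrA ab mul1r subrr.
rewrite mulrN mulr_sumr addrC -sumrB -[RHS](ya k).
by apply: eq_bigr => k' _; rewrite mulrBl mulrA.
Qed.

(* Artin's argument: a solution [y] of [sum_j e_j l_i y_j = 0] with minimal
   support and an entry 1 has all entries in the centralizer of [L], since
   [l y - y l] is a solution with smaller support. *)
Lemma centralizer_dependent (L : set D) (Z : set D) (n : nat) (l : 'I_n -> D)
    (e : 'I_n.+1 -> D) : (1 : D) != 0 ->
  (forall x, (forall y, L y -> x * y = y * x) -> L x) ->
  (forall x y, L x -> L y -> L (x * y)) -> L 1 ->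
  (forall x z, Z z -> z * x = x * z) ->
  (forall x, L x -> exists2 c : 'I_n -> D, (forall i, Z (c i)) &
    x = \sum_i c i * l i) ->
  exists y : 'I_n.+1 -> D, [/\ exists j, y j != 0, forall j, L (y j)
    & \sum_j e j * y j = 0].
Proof.
move=> D1 CL LM L1 cZ spanL.
pose Sol (y : 'I_n.+1 -> D) := forall x, L x -> \sum_j e j * x * y j = 0.
have Sol_l x y : L x -> Sol y -> Sol (fun j => x * y j).
  move=> Lx Sy z Lz; rewrite -[RHS](Sy _ (LM _ _ Lz Lx)).
  by apply: eq_bigr => j _; rewrite !mulrA.
have Sol_r x y : Sol y -> Sol (fun j => y j * x).
  move=> Sy z Lz; under eq_bigr => j _ do rewrite mulrA.
  by rewrite -mulr_suml Sy // mul0r.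
pose supp (y : 'I_n.+1 -> D) := #|[set j | y j != 0]%SET|.
pose P k := `[< exists y, [/\ Sol y, exists j, y j != 0 & supp y = k] >].
(* [Z] is central and the [l i] span [L] over it, so the conditions of [Sol] for all [x] in [L]
   follow from the [n] equations with [x = l i], in [n + 1] unknowns. *)
have exP : exists k, P k.
  have [y [y0 Sy]] := underdetermined_system (fun j i => e j * l i) D1.
  exists (supp y); apply/asboolP; exists y; split=> // x /spanL[c Zc ->].
  under eq_bigr => j _ do rewrite mulr_sumr mulr_suml.
  rewrite exchange_big big1 //= => i _.
  transitivity (c i * \sum_j e j * l i * y j); last by rewrite Sy mulr0.
  rewrite mulr_sumr; apply: eq_bigr => j _.
  by rewrite !mulrA (cZ (e j) (c i)).
have [_ /asboolP[y [Sy [j0 yj0] <-]] ymin] := ex_minnP exP.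
have [b [_ yb]] := divD yj0.
have b0 j : (y j * b == 0) = (y j == 0).
  apply/eqP/eqP => [|->]; last by rewrite mul0r.
  have [->//|/divD[x [xy _]] /(congr1 ( *%R x))] := eqVneq (y j) 0.
  rewrite mulrA xy mul1r mulr0 => b0; move: yb; rewrite b0 mulr0 => /esym/eqP.
  by rewrite (negbTE D1).
exists (fun j => y j * b); split=> [|j|].
- by exists j0; rewrite b0.
- apply: CL => x Lx; apply/esym/eqP; rewrite -subr_eq0; apply/negP => /negP nz.
  pose y' j := x * (y j * b) - y j * b * x.
  have /ymin : P (supp y').
    apply/asboolP; exists y'; split=> //; last by exists j.
    move=> z Lz; under eq_bigr => i _ do rewrite mulrBr.
    by rewrite sumrB (Sol_l x) ?(Sol_r x) ?subr0 //; apply: Sol_r.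
  rewrite leqNgt => /negP[]; apply/proper_card/properP; split.
    apply/fintype.subsetP => i; rewrite !inE; apply: contraNN => /eqP yi.
    by rewrite /y' yi !mul0r mulr0 subrr.
  by exists j0; rewrite !inE // /y' yb mulr1 mul1r subrr eqxx.
- rewrite -[RHS](Sol_r b y Sy 1 L1); apply: eq_bigr => j _.
  by rewrite mulr1.
Qed.

End DivisionRing.

(** * Finite generation of division rings *)

(** Induction on the number [k] of coordinates that are compared. In the step, [t] serves all [a]
    whose new coordinate is at least the maximum [N] over [t]; the other [a] lie in the finitely
    many slices where this coordinate is a fixed [n < N]. *)
Lemma dickson m (P : set 'X_{1..m}) : exists s : seq 'X_{1..m},
  {in s, forall a, P a} /\ forall a, P a -> exists2 b, b \in s & (b <= a)%MM.
Proof.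
suff aux k (Q : set 'X_{1..m}) : exists s : seq 'X_{1..m},
    {in s, forall a, Q a} /\ forall a, Q a -> exists2 b, b \in s &
    forall i : 'I_m, (i < k)%N -> (b i <= a i)%N.
  have [s [sP sdom]] := aux m P; exists s; split=> // a /sdom[b bs leba].
  by exists b => //; apply/mnm_lepP => i; apply: leba.
elim: k Q => [|k IHk] Q.
  have [[a Qa]|nQ] := pselect (exists a, Q a).
    by exists [:: a]; split=> [b|b _]; rewrite ?inE; [move/eqP->|exists a; rewrite ?inE].
  by exists [::]; split=> // a Qa; case: nQ; exists a.
have [le_mk|lt_km] := leqP m k.
  have [s [sQ sdom]] := IHk Q; exists s; split=> // a /sdom[b bs leba].
  by exists b => // i _; apply/leba/(leq_trans _ le_mk).
pose j := Ordinal lt_km.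
have [t [tQ tdom]] := IHk Q; pose N := \max_(b <- t) b j.
have /choice[s sP] := fun n => IHk [set a | Q a /\ a j = n].
exists (t ++ flatten [seq s n | n <- iota 0 N]); split=> [a|a Qa].
  rewrite mem_cat => /orP[/tQ//|/flatten_mapP[n _]].
  by have [+ _] := sP n => /[apply] -[].
have [le_N|lt_N] := leqP N (a j).
  have [b bt leba] := tdom a Qa; exists b; first by rewrite mem_cat bt.
  move=> i; rewrite ltnS leq_eqVlt => /orP[/eqP ik|/leba//].
  have -> : i = j by apply: val_inj.
  by apply: leq_trans le_N; rewrite /N (big_rem b bt) /= leq_maxl.
have [+ /(_ a (conj Qa erefl))[b bs leba]] := sP (a j).
move=> /(_ b bs)[_ bj]; exists b.
  rewrite mem_cat; apply/orP; right; apply/flatten_mapP; exists (a j) => //.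
  by rewrite mem_iota.
move=> i; rewrite ltnS leq_eqVlt => /orP[/eqP ik|/leba//].
have -> : i = j by apply: val_inj.
by rewrite bj.
Qed.

(** Zero and opposites need no clause: the generating sets of interest contain [1] and [-1]. *)
Inductive ring_gen (D : pzRingType) (G : set D) : set D :=
| ring_gen_in x : G x -> ring_gen G x
| ring_genD x y : ring_gen G x -> ring_gen G y -> ring_gen G (x + y)
| ring_genM x y : ring_gen G x -> ring_gen G y -> ring_gen G (x * y).

Section Combinations.
Variables (D : pzRingType) (W : lmodType D).
Implicit Types (R : set D) (X : set W).

(** [R] is any set of scalars, so that the coefficients of a relation can be tracked: base scalars,
    a finite list, or the ring that these generate. *)
Inductive comb R X : set W :=
| comb0 : comb R X 0
| combD r x v : R r -> X x -> comb R X v -> comb R X (r *: x + v).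

Lemma comb_add R X u v : comb R X u -> comb R X v -> comb R X (u + v).
Proof.
by elim=> [|r x u' Rr Xx _ IH] /=; rewrite ?add0r // -addrA => /IH; apply: combD.
Qed.

Lemma comb1 R X r x : R r -> X x -> comb R X (r *: x).
Proof. by move=> Rr Xx; rewrite -[_ *: _]addr0; apply: combD => //; apply: comb0. Qed.

Lemma combZ R X a v : (forall r, R r -> R (a * r)) -> comb R X v ->
  comb R X (a *: v).
Proof.
move=> Ra; elim=> [|r x u Rr Xx _ IH]; first by rewrite scaler0; apply: comb0.
by rewrite scalerDr scalerA; apply: combD => //; apply: Ra.
Qed.

Lemma comb_sub R R' X X' : R `<=` R' -> X `<=` X' -> comb R X `<=` comb R' X'.
Proof.
move=> RR' XX' v; elim=> [|r x u Rr Xx _ IH]; first exact: comb0.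
by apply: combD => //; [apply: RR'|apply: XX'].
Qed.

Lemma comb_trans R X X' : (forall r s, R r -> R s -> R (r * s)) ->
  X `<=` comb R X' -> comb R X `<=` comb R X'.
Proof.
move=> RM XX' v; elim=> [|r x u Rr Xx _ IH]; first exact: comb0.
by apply: comb_add => //; apply: combZ => [s|]; [apply: RM|apply: XX'].
Qed.

Lemma comb_finite R X v : comb R X v -> exists l : seq D, comb [set` l] X v.
Proof.
elim=> [|r x u _ Xx _ [l IH]]; first by exists [::]; apply: comb0.
exists (r :: l); apply: combD => //=; first by rewrite inE eqxx.
by apply: comb_sub IH => // s /= sl; rewrite inE sl orbT.
Qed.

End Combinations.

(* Order the monomials by weight, then by degree and lexicographically. Call
   [a] standard if [T a w] is not a [D]-combination of [T b w] with [b < a].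
   The standard [T a w] are [D]-free, and by Dickson's lemma the finitely many
   coefficients of the relations for the minimal non-standard monomials
   generate a ring [R] over which they span. Comparing the coefficient of
   [T 0 w = w] in [k *: w] gives [k \in R]. *)
Lemma division_ring_fin_gen (D : pzRingType) (W : lmodType D) (C : set D)
    (m : nat) (T : 'X_{1..m} -> W -> W) (wt : 'X_{1..m} -> nat) (w : W) :
  (forall x : D, x != 0 -> exists y, y * x = 1 /\ x * y = 1) ->
  C 1 -> C (-1) -> w != 0 -> (forall a, linear (T a)) -> T 0%MM w = w ->
  (forall a b, wt (a + b)%MM = (wt a + wt b)%N) ->
  (forall c b, comb C [set v | exists2 e, (wt e < wt (c + b)%MM)%N & v = T e w]
     (T c (T b w) - T (c + b)%MM w)) ->
  (forall k, comb C (range (T^~ w)) (k *: w)) ->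
  exists l : seq D, forall k, ring_gen (C `|` [set` l]) k.
Proof.
move=> divD C1 CN1 w0 linT T0 wtD H Hspan.
pose mon a := T a w.
(* Weight comes first because the corrections in [H] are bounded by weight alone. Variables may have
   weight 0, so infinitely many monomials can share a weight; a well-founded monomial order breaks
   the ties. *)
pose lt (a b : 'X_{1..m}) := (wt a < wt b)%N || (wt a == wt b) && (a < b)%O.
have lt_wf : well_founded lt.
  move=> a; have [n] := ubnP (wt a); elim: n a => [a|n IHn a].
    by rewrite ltn0.
  have ltm_ind := @well_founded_ind _ _ (@ltom_wf m).
  move: a; apply: ltm_ind => a IHa le_n.
  apply: Acc_intro => b /orP[ltba|/andP[/eqP ba /IHa]].
    by apply: IHn; apply: leq_trans ltba _.
  by apply; rewrite ba.
have lt_ind := well_founded_ind lt_wf.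
have lt_trans a b c : lt a b -> lt b c -> lt a c.
  move=> /orP[ab|/andP[/eqP ab ab']] /orP[bc|/andP[/eqP bc bc']]; apply/orP.
  - by left; apply: ltn_trans bc.
  - by left; rewrite -bc.
  - by left; rewrite ab.
  - by right; rewrite ab bc eqxx; apply: lt_trans bc'.
have lt_total a b : [\/ a = b, lt a b | lt b a].
  rewrite /lt; case: (ltngtP (wt a) (wt b)) => _ /=.
  - by apply: Or32.
  - by apply: Or33.
  - by case: (ltgtP a b) => [_|_|->]; [apply: Or32|apply: Or33|apply: Or31].
have lt_add c a b : lt a b -> lt (c + a)%MM (c + b)%MM.
  rewrite /lt !wtD ltn_add2l eqn_add2l => /orP[->//|/andP[-> ab]].
  by rewrite ltmc_add2r ab orbT.
have lt_wt a b : (wt a < wt b)%N -> lt a b by rewrite /lt => ->.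
pose below R a := comb R [set v | exists2 b, lt b a & v = mon b].
pose std a := ~ below setT a (mon a).
have linT0 c : T c 0 = 0 by apply: linear_fun0.
(* [T c] is [D]-linear, so coefficients pass through it; replacing [T c (T b w)] by [mon (c + b)]
   adds only terms of lower weight with coefficients in [C]. *)
have shift R c a v : C `<=` R -> (forall r s, R r -> R s -> R (r * s)) ->
    below R a v -> below R (c + a)%MM (T c v).
  move=> CR RM; elim=> [|r _ u Rr [b ltba ->] _ IH].
    by rewrite linT0; apply: comb0.
  rewrite linT; apply: comb_add IH; apply: combZ => [s|]; first exact: RM.
  rewrite -(subrK (mon (c + b)%MM) (T c _)); apply: comb_add.
    apply: comb_sub (H c b) => // _ [e lte ->]; exists e => //.
    by apply: lt_trans (lt_add c _ _ ltba); apply: lt_wt.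
  rewrite -[mon _]scale1r; apply: comb1; first exact: CR.
  by exists (c + b)%MM => //; apply: lt_add.
have [s [sE sdom]] := dickson [set a | ~ std a].
have [l lP] : exists l : seq D, {in s, forall a, below [set` l] a (mon a)}.
  elim: (s) sE => [|a t IHt] tE; first by exists [::].
  have [|l lP] := IHt; first by move=> b bt; apply: tE; rewrite inE bt orbT.
  have [l' l'P] := comb_finite (contrapT (tE a (mem_head _ _))).
  exists (l' ++ l) => b; rewrite inE => /orP[/eqP->|/lP bP].
  - by apply: comb_sub l'P => // x /= xl; rewrite mem_cat xl.
  - by apply: comb_sub bP => // x /= xl; rewrite mem_cat xl orbT.
exists l; pose R := ring_gen (C `|` [set` l]).
have CR : C `<=` R by move=> x Cx; apply: ring_gen_in; left.
have RM x y : R x -> R y -> R (x * y) by apply: ring_genM.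
have R0 : R 0 by rewrite -(subrr 1); apply: ring_genD; apply: CR.
have RN x : R x -> R (- x) by rewrite -mulN1r; apply: RM; apply: CR.
pose stdset := [set v | exists2 a, std a & v = mon a].
(* A non-standard [a] is [c + b] with [b] in the Dickson list, so the relation of [b], multiplied by
   [T c] and corrected by [H], rewrites [mon a] with coefficients in [R]. *)
have reduce a : comb R stdset (mon a).
  move: a; apply: lt_ind => a IHa.
  have [sa|/[dup] nsa /sdom[b bs /submK ca]] := pselect (std a).
    by rewrite -[mon a]scale1r; apply: comb1; [apply: CR|exists a].
  set c := (a - b)%MM in ca.
  apply: (@comb_trans _ _ _ [set v | exists2 b, lt b a & v = mon b]) => //.
    by move=> _ [e lte ->]; apply: IHa.
  have -> : mon a = T c (mon b) + (-1) *: (T c (mon b) - mon a).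
    by rewrite scaleN1r opprB addrC subrK.
  apply: comb_add.
    rewrite (_ : [set v | _] = [set v | exists2 e, lt e (c + b)%MM & v = mon e]);
      last by rewrite ca.
    apply: shift => //.
    by apply: comb_sub (lP _ bs) => // x xl; apply: ring_gen_in; right.
  apply: combZ => [r|]; first by rewrite mulN1r; apply: RN.
  rewrite -ca; apply: comb_sub (H c b) => // _ [e lte ->]; exists e => //.
  exact: lt_wt.
have top (Q : set 'X_{1..m}) v :
    comb R [set v | exists2 a, std a /\ Q a & v = mon a] v -> v = 0 \/
    exists b r v', [/\ std b, Q b, R r, v = r *: mon b + v' &
      comb R [set v | exists2 a, std a /\ lt a b & v = mon a] v'].
  elim=> [|r _ u Rr [a [sa Qa] ->] _ [->|]]; [by left|right|].
    by exists a, r, 0; split=> //; apply: comb0.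
  move=> [b [r' [v' [sb Qb Rr' -> v'P]]]]; right.
  have [ab|ab|ba] := lt_total a b.
  - exists b, (r + r'), v'; split=> //; first exact: ring_genD.
    by rewrite ab scalerDl addrA.
  - exists b, r', (r *: mon a + v'); split=> //; first by rewrite addrCA.
    by apply: combD => //; exists a.
  - exists a, r, (r' *: mon b + v'); split=> //.
    apply: combD => //; first by exists b.
    apply: comb_sub v'P => // _ [e [se eb] ->]; exists e => //; split=> //.
    exact: lt_trans ba.
have tors k : k *: w = 0 -> k = 0.
  move=> kw; apply/eqP/negP => /negP/divD[y [yk _]]; move: w0.
  by rewrite -[w]scale1r -yk -scalerA kw scaler0 eqxx.
have mon0 : mon 0%MM = w by [].
have lt0 b : ~~ lt b 0%MM.
  have wt0 : wt 0%MM = 0%N.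
    have /eqP := wtD 0%MM 0%MM.
    by rewrite addm0 -{1}[wt _]addn0 eqn_add2l => /eqP.
  rewrite /lt wt0 ltn0 /= negb_and -leNgt; apply/orP; right.
  by apply/lem_leo/mnm_lepP => i; rewrite mnmE.
(* Descent on the leading monomial. If [b] is not 0, a nonzero [r] could be inverted and would
   express [mon b] through [w = mon 0] and [v], both from below [b]; so [r = 0] and the next leading
   term takes over. At [b = 0] nothing lies below, hence [v = 0] and [k = r]. *)
have uniq b : forall k r v, std b -> R r ->
    comb R [set v | exists2 a, std a /\ lt a b & v = mon a] v ->
    k *: w = r *: mon b + v -> R k.
  move: b; apply: lt_ind => b IHb k r v sb Rr vP kw.
  have [b0|b0] := eqVneq b 0%MM.
    suff v0 : v = 0.
      have /eqP := kw; rewrite v0 addr0 b0 mon0 -subr_eq0 -scalerBl.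
      by move=> /eqP/tors/eqP; rewrite subr_eq0 => /eqP->.
    case: v / vP {kw} => // r' x u _ [a [_ ltab] _] _.
    by move: ltab; rewrite b0 (negbTE (lt0 a)).
  have r0 : r = 0.
    apply/eqP/negP => /negP/divD[y [yr _]]; apply: sb.
    have -> : mon b = y *: (k *: w + (-1) *: v).
      by rewrite kw scaleN1r addrK scalerA yr scale1r.
    apply: combZ => //; apply: comb_add.
      apply: comb1 => //; exists 0%MM => //.
      by case: (lt_total b 0%MM) (lt0 b) => [/eqP|->//|//]; rewrite (negbTE b0).
    apply: combZ => //; apply: comb_sub vP => // _ [a [_ ltab] ->].
    by exists a.
  move: kw; rewrite r0 scale0r add0r => kw.
  have [v0|[b' [r' [v' [sb' ltb' Rr' def_v v'P]]]]] := top _ _ vP.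
    by rewrite (tors k) // kw.
  by apply: (IHb b' ltb' k r' v') => //; rewrite kw.
move=> k.
have /top[] : comb R [set v | exists2 a, std a /\ [set: 'X_{1..m}] a & v = mon a] (k *: w).
- have : comb R stdset (k *: w).
    apply: comb_trans (comb_sub CR (@subset_refl _ _) (Hspan k)) => //.
    by move=> _ [a _ <-]; apply: reduce.
  by apply: comb_sub => // _ [a sa ->]; exists a.
- by move/tors->.
- by move=> [b [r [v [sb _ Rr kw vP]]]]; apply: uniq kw.
Qed.

(** * Zariski's lemma *)

Lemma ring_gen_sub (D : pzRingType) (G G' : set D) :
  G `<=` ring_gen G' -> ring_gen G `<=` ring_gen G'.
Proof.
move=> GG' x; elim=> [y /GG'//|y z _ Gy _ Gz|y z _ Gy _ Gz].
  exact: ring_genD.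
exact: ring_genM.
Qed.

Section Zariski.
Variable K : fieldType.

Definition root_over (R : idomainType) (phi : R -> K) (y : K) :=
  exists2 p : {poly R}, p != 0 & root (map_poly phi p) y.

(** Multiplying [p(y) = 0] by [c^(n-1)] gives a monic equation for [c y] with coefficients
    [p_i c^(n-1-i)]; the top one would be [c / c] and is entered as 1. *)
Lemma integral_lead_coef (R : idomainType) (phi : {rmorphism R -> K})
    (p : {poly R}) (y : K) : injective phi -> p != 0 -> root (map_poly phi p) y ->
  integralOver phi (phi (lead_coef p) * y).
Proof.
move=> phi_inj p0 py; set c := lead_coef p; set n := (size p).-1.
have szp : size p = n.+1 by rewrite prednK // size_poly_gt0.
have phi0 x : phi x = 0 -> x = 0 by rewrite -(rmorph0 phi) => /phi_inj.
have n0 : (0 < n)%N.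
  rewrite lt0n; apply/eqP => n0; move: py p0.
  rewrite [p]size1_polyC ?szp ?n0 // map_polyC rootC => /eqP/phi0->.
  by rewrite polyC0 eqxx.
pose q := \poly_(i < n.+1) (if i == n then 1 else p`_i * c ^+ (n.-1 - i)).
have qn : q`_n = 1 by rewrite coef_poly ltnSn eqxx.
have szq : size q = n.+1.
  by rewrite /q size_poly_eq // eqxx oner_neq0.
exists q; first by rewrite monicE /lead_coef szq /= qn.
have pE : (map_poly phi p).[y] = \sum_(i < n.+1) phi p`_i * y ^+ i.
  rewrite horner_coef size_map_inj_poly ?rmorph0 // szp.
  by apply: eq_bigr => i _; rewrite coef_map.
have : \sum_(i < n.+1) phi p`_i * y ^+ i = 0 by rewrite -pE; apply/eqP.
rewrite /root horner_coef size_map_inj_poly ?rmorph0 // szq => pE0.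
apply/eqP; transitivity (phi c ^+ n.-1 * \sum_(i < n.+1) phi p`_i * y ^+ i);
  last by rewrite pE0 mulr0.
rewrite mulr_sumr.
apply: eq_bigr => i _.
rewrite coef_map coef_poly ltn_ord /= exprMn.
case: eqP => [->|/eqP ni].
  have -> : p`_n = c by rewrite /c /lead_coef szp.
  by rewrite rmorph1 mul1r mulrA -exprSr prednK.
have lt_in : (i <= n.-1)%N by rewrite -ltnS prednK // ltn_neqAle ni -ltnS /=.
rewrite rmorphM rmorphXn /= -(mulrA (phi p`_i)) (mulrA (phi c ^+ (n.-1 - i))) -exprD subnK //.
by rewrite mulrCA.
Qed.

(** Multiplying the monic equation of [g / p] by [p^N] leaves a factor [p] in every term but the
    leading one, [g^N]. *)
Lemma integral_fraction_dvd (R : idomainType) (phi : {rmorphism R -> K}) (g p : R)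
    (q : {poly R}) : injective phi -> phi p != 0 -> q \is monic ->
  root (map_poly phi q) (phi g / phi p) -> exists N a, g ^+ N = p * a.
Proof.
move=> phi_inj p0 q_mon qy; set N := (size q).-1.
have szq : size q = N.+1 by rewrite prednK // size_poly_gt0 monic_neq0.
exists N, (- \sum_(i < N) q`_i * g ^+ i * p ^+ (N.-1 - i)).
apply: (phi_inj); rewrite rmorphM rmorphN mulrN.
apply/eqP; rewrite -addr_eq0; apply/eqP.
have : phi p ^+ N * (map_poly phi q).[phi g / phi p] = 0.
  by rewrite (eqP qy) mulr0.
have szm : size (map_poly phi q) = N.+1.
  by rewrite size_map_inj_poly ?rmorph0.
rewrite horner_coef szm mulr_sumr => <-.
rewrite big_ord_recr /= [LHS]addrC; congr (_ + _).
  rewrite rmorph_sum mulr_sumr; apply: eq_bigr => i _ /=.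
  rewrite coef_map !rmorphM !rmorphXn /= exprMn exprVn.
  have -> : phi p ^+ N = phi p * phi p ^+ (N.-1 - i) * phi p ^+ i.
    rewrite -exprS -exprD; congr (_ ^+ _).
    by case: (N) i => [[]//|k i]; rewrite addSn subnK // -ltnS.
  rewrite -!mulrA (mulrCA (phi p ^+ i)) (mulrCA (phi p ^+ i) (phi g ^+ i)).
  rewrite mulfV ?expf_neq0 // mulr1; congr (_ * _).
  by rewrite [RHS]mulrCA (mulrC (phi g ^+ i)).
have -> : (map_poly phi q)`_N = 1.
  rewrite coef_map; move/monicP: q_mon; rewrite /lead_coef szq /= => ->.
  exact: rmorph1.
rewrite mul1r exprMn exprVn !rmorphXn /= mulrCA mulfV ?mulr1 //.
by rewrite expf_neq0.
Qed.

(** [s] collects the generators known to be algebraic, [t] those still to be examined. A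
    transcendental one is adjoined to [R] as a variable, hence the quantification over [R]; the
    induction hypothesis for [{poly R}] then gives one denominator [g] for the whole field, which is
    impossible. *)
Lemma algebra_fin_gen_integral (t : seq K) : forall (R : idomainType)
    (phi : {rmorphism R -> K}) (s : seq K), injective phi ->
  {in s, forall y, root_over phi y} ->
  (forall k, ring_gen (range phi `|` [set` s] `|` [set` t]) k) ->
  exists2 g, g != 0 & forall y, exists n, integralOver phi (phi g ^+ n * y).
Proof.
elim: t => [|x t IHt] R phi s phi_inj s_alg gen.
  have [g g0 gs] : exists2 g, g != 0 & {in s, forall y, integralOver phi (phi g * y)}.
    elim: s s_alg {gen} => [|y s IHs] s_alg.
      by exists 1; rewrite ?oner_neq0.
    have [|g g0 gs] := IHs; first by move=> z zs; apply: s_alg; rewrite inE zs orbT.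
    have [p p0 py] := s_alg y (mem_head _ _).
    exists (g * lead_coef p); first by rewrite mulf_neq0 // lead_coef_eq0.
    move=> z; rewrite inE rmorphM => /orP[/eqP->|/gs gz].
      rewrite -mulrA; apply: integral_mul; first exact: integral_id.
      exact: integral_lead_coef.
    by rewrite mulrAC; apply: integral_mul => //; apply: integral_id.
  have intX n : integralOver phi (phi g ^+ n).
    by rewrite -rmorphXn; apply: integral_id.
  exists g => // y; elim: (gen y) => {y} [y [[[r _ <-]|/= /gs ys]|//]
    |y z _ [n ny] _ [n' nz]|y z _ [n ny] _ [n' nz]].
  - by exists 0%N; rewrite mul1r; apply: integral_id.
  - by exists 1%N.
  - exists (n + n')%N; rewrite mulrDr {1}[(n + n')%N]addnC !exprD -!mulrA.
    by apply: integral_add; apply: integral_mul.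
  - by exists (n + n')%N; rewrite exprD mulrACA; apply: integral_mul.
have [x_alg|x_trans] := pselect (root_over phi x).
  apply: (IHt R phi (x :: s)) => // [y|k].
    by rewrite inE => /orP[/eqP->//|/s_alg].
  apply: ring_gen_sub (gen k) => y yG; apply: ring_gen_in.
  case: yG => [[yR|/= ys]|/=].
  - by left; left.
  - by left; right; rewrite /= inE ys orbT.
  rewrite inE => /orP[/eqP->|yt]; [left; right|by right].
  by rewrite /= inE eqxx.
have [ev [ev_inj evC evX]] : exists ev : {rmorphism {poly R} -> K},
    [/\ injective ev, forall r, ev r%:P = phi r & ev 'X = x].
  exists (horner_morph (fun r => mulrC x (phi r))); split=> [p q /eqP|r|].
  - rewrite -subr_eq0 -rmorphB => pq; apply/eqP; rewrite -subr_eq0.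
    by apply/negP => /negP pq0; apply: x_trans; exists (p - q).
  - exact: horner_morphC.
  - exact: horner_morphX.
have [||g g0 gP] := IHt _ ev s ev_inj.
- move=> y /s_alg[p p0 py]; exists (map_poly polyC p).
    by rewrite map_poly_eq0_id0 ?polyC_eq0 ?lead_coef_eq0.
  by rewrite -map_poly_comp (eq_map_poly (g := phi)).
- move=> k; apply: ring_gen_sub (gen k) => y yG; apply: ring_gen_in.
  case: yG => [[[r _ <-]|ys]|/=]; [by left; left; exists r%:P|by left; right|].
  rewrite inE => /orP[/eqP->|yt]; [left; left; by exists 'X|by right].
(* As in Euclid's proof [p] is prime to [g], and the factor ['X] makes it nonconstant even if [g] is
   constant. Yet some [g^n / p] is integral over [{poly R}], so [p] divides a power of [g]. *)
exfalso; pose p := 1 + 'X * g.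
have szp : (1 < size p)%N.
  have szXg : (1 < size ('X * g)%R)%N.
    by rewrite mulrC size_mulX // ltnS size_poly_gt0.
  by rewrite /p addrC size_polyDl // size_poly1.
have p0 : p != 0 by rewrite -size_poly_gt0 (ltn_trans _ szp).
have evp0 : ev p != 0.
  by apply: contra_neq p0 => pe; apply: ev_inj; rewrite pe rmorph0.
have [n [q q_mon]] := gP (ev p)^-1; rewrite -rmorphXn.
move=> /(integral_fraction_dvd ev_inj evp0 q_mon)[N [a gna]].
(* modulo [p] the class of ['X * g] is [-1], so [p] divides a power of [-1] *)
have [b pb] : exists b, 1 = p * b.
  rewrite -exprM in gna; move: (n * N)%N gna => {}N gna.
  have [b bE] : exists b, ('X * g) ^+ N = (-1) ^+ N + p * b.
    have -> : 'X * g = -1 + p by rewrite /p addrA addNr add0r.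
    elim: N {gna} => [|N [b IHb]]; first by exists 0; rewrite mulr0 addr0.
    exists ((-1) ^+ N + b * (-1 + p)); rewrite !exprSr IHb mulrDl.
    have -> : p * b * (-1 + p) = p * (b * (-1 + p)) by rewrite mulrA.
    by rewrite mulrDr -addrA [p * (_ + _)]mulrDr (mulrC p (_ ^+ N)).
  exists ((-1) ^+ N * ('X ^+ N * a - b)).
  rewrite mulrCA mulrBr mulrCA -gna -exprMn bE addrK -exprMn mulrN1 opprK.
  by rewrite expr1n.
have : size (p * b) = 1%N by rewrite -pb size_poly1.
have b0 : b != 0.
  by apply/eqP => b0; move: pb; rewrite b0 mulr0 => /eqP; rewrite oner_eq0.
rewrite size_mul // => sz.
have := size_poly_gt0 b; rewrite b0 => szb.
by have := leq_add szp szb; move: sz; case: (size p + size b)%N => [|[|[|?]]].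
Qed.

Lemma zariski (F : fieldType) (emb : {rmorphism F -> K}) (l : seq K) :
  (forall k, ring_gen (range emb `|` [set` l]) k) ->
  forall k, integralOver emb k.
Proof.
move=> gen k.
have [] := @algebra_fin_gen_integral l F emb [::] (fmorph_inj _) => // [k'|g g0 gP].
  apply: ring_gen_sub (gen k') => y [yF|yl]; apply: ring_gen_in.
    by left; left.
  by right.
have [n] := gP k.
move=> /(integral_mul (integral_id emb (g ^- n))).
by rewrite fmorphV rmorphXn mulrA mulVf ?mul1r // expf_neq0 // fmorph_eq0.
Qed.

(** It suffices to find a finite list whose span contains 1 and is stable under the generators,
    hence under every [k], as [k = k * 1]. A new generator [x] multiplies the list by its powers
    below the degree of its monic equation. *)
Lemma finite_of_integral (F : fieldType) (emb : {rmorphism F -> K}) (l : seq K) :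
  (forall k, ring_gen (range emb `|` [set` l]) k) ->
  exists s : seq K, forall k, exists c : 'I_(size s) -> F,
    k = \sum_i emb (c i) * s`_i.
Proof.
move=> gen; have int := zariski gen.
pose sp (s : seq K) := [set k | exists c : 'I_(size s) -> F,
  k = \sum_i emb (c i) * s`_i].
have sp0 s : sp s 0.
  by exists (fun=> 0); rewrite big1 // => i _; rewrite rmorph0 mul0r.
have spD s a b : sp s a -> sp s b -> sp s (a + b).
  move=> [c ->] [d ->]; exists (fun i => c i + d i).
  by rewrite -big_split; apply: eq_bigr => i _; rewrite rmorphD mulrDl.
have spZ s a r : sp s a -> sp s (emb r * a).
  move=> [c ->]; exists (fun i => r * c i).
  by rewrite mulr_sumr; apply: eq_bigr => i _; rewrite rmorphM mulrA.
have sp_in s a : a \in s -> sp s a.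
  move=> /[dup] sa; rewrite -index_mem => lt_a.
  exists (fun i => (i == Ordinal lt_a)%:R).
  rewrite (bigD1 (Ordinal lt_a)) //= eqxx rmorph1 mul1r nth_index //.
  rewrite big1 ?addr0 // => i /negbTE->.
  by rewrite rmorph0 mul0r.
have sp_min s (A : set K) : A 0 -> (forall a b, A a -> A b -> A (a + b)) ->
    (forall r a, A a -> A (emb r * a)) -> {in s, forall a, A a} -> sp s `<=` A.
  move=> A0 AD AZ As _ [c ->]; elim/big_rec: _ => // i a _.
  by apply: AD; apply/AZ/As/mem_nth.
suff [s [s1 sM]] : exists s, sp s 1 /\ {in l, forall y a, sp s a -> sp s (y * a)}.
  exists s => k; suff : forall a, sp s a -> sp s (k * a).
    by move/(_ 1 s1); rewrite mulr1.
  elim: (gen k) => {k} [k [[r _ <-]|/sM//]|k k' _ IH _ IH'|k k' _ IH _ IH'] a sa.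
  - exact: spZ.
  - by rewrite mulrDl; apply: spD; [apply: IH|apply: IH'].
  - by rewrite -mulrA; apply/IH/IH'.
elim: l {gen} => [|x l [s [s1 sM]]].
  by exists [:: 1]; split=> //; apply: sp_in; rewrite inE.
have [p p_mon px] := int x; set n := (size p).-1.
have szp : size p = n.+1 by rewrite prednK // size_poly_gt0 monic_neq0.
have n0 : (0 < n)%N.
  rewrite lt0n; apply/eqP => n0; move: px p_mon.
  rewrite [p]size1_polyC ?szp ?n0 // map_polyC rootC monicE lead_coefC.
  by rewrite fmorph_eq0 => /eqP-> /eqP/esym/eqP; rewrite oner_eq0.
pose s' := [seq a * x ^+ i | a <- s, i <- seq.iota 0 n].
have s'P i a : (i < n)%N -> sp s a -> sp s' (a * x ^+ i).
  move=> lt_in; apply: (@sp_min s [set a | sp s' (a * x ^+ i)]) => /=.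
  - by rewrite mul0r.
  - by move=> b c sb sc; rewrite mulrDl; apply: spD.
  - by move=> r b sb; rewrite -mulrA; apply: spZ.
  - by move=> b bs; apply/sp_in/allpairs_f => //; rewrite mem_iota.
exists s'; split; first by have := s'P 0%N 1 n0 s1; rewrite mulr1.
move=> y; rewrite inE => yl a; apply: (@sp_min s' [set a | sp s' (y * a)]) => /=.
- by rewrite mulr0.
- by move=> b c sb sc; rewrite mulrDr; apply: spD.
- by move=> r b sb; rewrite mulrCA; apply: spZ.
move=> _ /allpairsP[[b i] /= [bs + ->]]; rewrite mem_iota /= add0n => lt_in.
case/orP: yl => [/eqP->|yl]; last by rewrite mulrA; apply/s'P/sM/sp_in.
rewrite mulrCA -exprS.
move: lt_in; rewrite leq_eqVlt => /orP[/eqP->|lt_in]; last first.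
  by apply: s'P => //; apply: sp_in.
have -> : x ^+ n = - \sum_(j < n) emb p`_j * x ^+ j.
  have pn : (map_poly emb p)`_n = 1.
    by rewrite coef_map; move/monicP: p_mon; rewrite /lead_coef szp /= => ->; apply: rmorph1.
  apply/eqP; rewrite -addr_eq0; move: px; rewrite /root horner_coef size_map_poly szp.
  rewrite big_ord_recr /= pn mul1r => /eqP E; apply/eqP; apply: etrans E.
  rewrite [LHS]addrC; congr (_ + _).
  by apply: eq_bigr => j _; rewrite coef_map.
rewrite -sumrN mulr_sumr; elim/big_rec: _ => // j z _; apply: spD.
rewrite -mulNr -rmorphN mulrCA; apply/spZ/s'P => //; exact: sp_in.
Qed.

End Zariski.

(** * Modes and zero modes *)

Lemma expand_coefn0 k : expand_coef k 0 = 1.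
Proof. by case: k => n; rewrite /expand_coef /binz !expr0 ?mul1r bin0. Qed.

Lemma expand_coef0n i : (0 < i)%N -> expand_coef 0 i = 0.
Proof. by move=> i0; rewrite /expand_coef /= bin_small ?mulr0. Qed.

Lemma span_sub (F : fieldType) (V : lmodType F) (S A : set V) :
  S `<=` A -> span S `<=` span A.
Proof.
by move=> SA; apply: span_min; [apply: span_subspace|move=> x /SA; apply: sub_span].
Qed.

Section Subspace.
Variables (F : fieldType) (V : lmodType F) (A : set V).
Hypothesis subA : subspace A.

Lemma sub0 : A 0. Proof. by have /subspaceP[] := subA. Qed.
Lemma subD x y : A x -> A y -> A (x + y).
Proof.
by move=> Ax Ay; rewrite -[x]scale1r; have /subspaceP[_] := subA; apply.
Qed.
Lemma subZ a x : A x -> A (a *: x).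
Proof.
by move=> Ax; rewrite -[_ *: _]addr0; have /subspaceP[A0] := subA; apply.
Qed.
Lemma subMz x z : A x -> A (x *~ z).
Proof. by move=> Ax; rewrite -scaler_int; apply: subZ. Qed.
Lemma subN x : A x -> A (- x).
Proof. by rewrite -scaleN1r; apply: subZ. Qed.
Lemma subB x y : A x -> A y -> A (x - y).
Proof. by move=> Ax Ay; apply/subD/subN. Qed.
Lemma sub_sum (I : Type) (r : seq I) (P : pred I) (x : I -> V) :
  (forall i, P i -> A (x i)) -> A (\sum_(i <- r | P i) x i).
Proof.
move=> Ax; elim/big_rec: _ => [|i y Pi Ay]; first exact: sub0.
by apply: subD => //; apply: Ax.
Qed.
End Subspace.

Lemma projections_gr_int (F : fieldType) (V : lmodType F) (gr : nat -> set V)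
    (pr : nat -> V -> V) :
  [/\ forall n, linear (pr n), forall n v, gr n v -> pr n v = v
    & forall n m v, n != m -> gr m v -> pr n v = 0] ->
  forall k d x, gr_int gr d x -> pr k x = if d == k%:Z then x else 0.
Proof.
move=> [lpr prK pr0] k [d|d] x /= xd; last by rewrite xd linear_fun0.
have [dk|dk] := eqVneq d k; first by rewrite dk eqxx prK // -dk.
by rewrite [Posz d == _](negbTE dk) (pr0 _ d) // eq_sym.
Qed.

Section Modes.
Variables (F : fieldType) (V : voa F) (M : admissible_module V).
Notation grV := (voa_gr V).
Notation grM := (adm_gr M).
Notation "u '_[' n ] w" := (adm_Y u n (w : M)) (at level 30, right associativity,
  format "u '_[' n ]  w").

Let hM := adm_weak (admP M).
Let dM := adm_direct (admP M).
Let dV := voa_direct (voaP V).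

Lemma mode_linl n (w : M) : linear (fun u : V => u _[n] w).
Proof. exact: (wm_linearl hM). Qed.
Lemma mode_linr (u : V) n : linear (fun w : M => u _[n] w).
Proof. exact: (wm_linearr hM). Qed.
Lemma mode0l n (w : M) : (0 : V) _[n] w = 0.
Proof. exact: (linear_fun0 (mode_linl n w)). Qed.
Lemma mode_vac (w : M) : voa_vac V _[-1] w = w.
Proof. by rewrite (wm_vacuum hM). Qed.

Lemma grM_int d n (w : M) : gr_int grM d w -> d = n%:Z -> grM n w.
Proof. by move=> + dn; rewrite dn. Qed.

Definition homog_span (w : M) : set M := span [set x | exists s u n,
  grV s u /\ x = u _[n] w].

(** The Jacobi identity at [(l, m, n) = (p - a, a, q)] has no second sum, as the modes of [u] kill
    [w] from [a] on, and its first sum starts with [u_p v_q w]. The other terms there contain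
    [v_(q+i) w] with [i > 0], so descent on [b - q] ends where these vanish. *)
Lemma mode_assoc s t u v p q (w : M) : grV s u -> grV t v ->
  homog_span w (u _[p] v _[q] w).
Proof.
move=> su tv; have subH : subspace (homog_span w) := span_subspace _.
have [a ua] := wm_trunc hM u w; have [b vb] := wm_trunc hM v w.
have [k] := ubnP (absz (b - q)); case: (lerP b q) => [leb _|ltb].
  by rewrite vb // (linear_fun0 (mode_linr _ _)); apply: sub0 subH.
elim: k p q ltb => // k IHk p q ltb ltk.
have [N0 J] := wm_jacobi hM u v w (p - a) a q.
have {J} := J N0.+1 (leqnSn _); rewrite [X in _ - X]big1; last first.
  by move=> i _; rewrite ua ?lerDl // (linear_fun0 (mode_linr _ _)) mul0rz.
rewrite subr0 big_ord_recl expand_coefn0 mulr1z subr0 addr0 subrK => E.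
have -> : u _[p] v _[q] w = u _[p] v _[q] w + 0 by rewrite addr0.
rewrite -[X in _ + X](subrr (\sum_(i < N0) u _[p - (lift ord0 i)%:Z]
  v _[q + (lift ord0 i)%:Z] w *~ expand_coef (p - a) (lift ord0 i))) addrA E.
apply: (subB subH); apply: (sub_sum subH) => i _; apply: (subMz subH).
  have := voa_weight (voaP V) (p - a + i%:Z) su tv.
  case: (s%:Z + _ - _ - _) => r /= Yr.
    by apply: sub_span; exists r, (voa_Y u (p - a + i%:Z) v), (a + q - i%:Z).
  by rewrite Yr mode0l; apply: sub0 subH.
have [leb|ltb'] := lerP b (q + (lift ord0 i)%:Z).
  by rewrite vb // (linear_fun0 (mode_linr _ _)); apply: sub0 subH.
by apply: IHk => //; rewrite /= /bump /= in ltb' *; lia.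
Qed.

Lemma homog_decomp (u : V) : exists N (x : nat -> V), (forall n, grV n (x n)) /\
  u = \sum_(n < N) x n.
Proof. exact: (ds_span dV). Qed.

Lemma mode_sum (I : Type) (r : seq I) (x : I -> V) n (w : M) :
  (\sum_(i <- r) x i) _[n] w = \sum_(i <- r) x i _[n] w.
Proof.
exact: (big_morph (fun u : V => u _[n] w) (linear_funD (mode_linl n w)) (mode0l n w)).
Qed.

Lemma homog_span_submodule t (w : M) : grM t w ->
  admissible_submodule (homog_span w).
Proof.
move=> tw; have subH : subspace (homog_span w) := span_subspace _.
split=> // [v n x|].
  have [N [y [hy ->]]] := homog_decomp v.
  rewrite mode_sum => Hx; apply: (sub_sum subH) => i _.
  move: x Hx; apply: span_min => [|_ [s [u [m [su ->]]]] /=].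
    apply/subspaceP; split=> /= [|a x x' Hx Hx'].
      by rewrite (linear_fun0 (mode_linr _ _)); apply: sub0 subH.
    by rewrite mode_linr; apply: (subD subH) => //; apply: (subZ subH).
  exact: mode_assoc su.
apply: span_sub => _ [s [u [n [su ->]]]]; split.
  by apply: sub_span; exists s, u, n.
have := adm_weight (admP M) n su tw.
case: (_ - _) => r /= Yr; first by exists r.
by exists 0%N; rewrite Yr; have /subspaceP[] := ds_subspace dM 0%N.
Qed.

Hypothesis irrM : irreducible M.

Lemma homog_span_full t (w : M) : grM t w -> w != 0 -> homog_span w = setT.
Proof.
move=> tw w0; have [_ /(_ _ (homog_span_submodule tw))[H0|//]] := irrM.
have : homog_span w w.
  apply: sub_span; exists 0%N, (voa_vac V), (-1); split; last by rewrite mode_vac.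
  exact: (voa_one (voaP V)).
by rewrite H0 => /= /eqP; rewrite (negbTE w0).
Qed.

Lemma homog_generated t k (w x : M) : grM t w -> w != 0 -> grM k x ->
  span [set y | exists s u n, [/\ grV s u, s%:Z + t%:Z - n - 1 = k%:Z &
    y = u _[n] w]] x.
Proof.
move=> tw w0 kx; set S := [set y | _].
have [pr prP] := projections_ex dM.
have prI := projections_gr_int prP; have [lpr prK _] := prP.
suff : [set y | span S (pr k y)] x by rewrite /= prK.
have : homog_span w x by rewrite (homog_span_full tw w0).
move: x kx => x _; apply: span_min.
  apply/subspaceP; split=> /= [|a y y' Hy Hy'].
    by rewrite (linear_fun0 (lpr k)); apply: (sub0 (span_subspace _)).
  rewrite lpr; have subS := span_subspace S.
  by apply: (subD subS) => //; apply: (subZ subS).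
move=> _ [s [u [n [su ->]]]] /=.
rewrite (prI _ _ _ (adm_weight (admP M) n su tw)); case: eqP => [E|_].
  by apply: sub_span; exists s, u, n.
exact: (sub0 (span_subspace _)).
Qed.

Lemma bottom_ex : exists n0 (w : M), [/\ grM n0 w, w != 0 &
  forall k, (k < n0)%N -> forall x, grM k x -> x = 0].
Proof.
have [[w w0] _] := irrM.
have exP : exists n, `[< exists x, grM n x /\ x != 0 >].
  apply: contrapT => nP; have [N [x [grx def_w]]] := ds_span dM w.
  move: w0; rewrite def_w big1 ?eqxx // => i _; apply/eqP/negP => /negP xi0.
  by apply: nP; exists i; apply/asboolP; exists (x i).
have [n0 /asboolP[x [n0x x0]] n0min] := ex_minnP exP.
exists n0, x; split=> // k lt_k y ky; apply/eqP/negP => /negP y0.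
suff /n0min : `[< exists x, grM k x /\ x != 0 >] by rewrite leqNgt lt_k.
by apply/asboolP; exists y.
Qed.

(** * Zhu's formulas for zero modes on the lowest degree *)

Section Bottom.
Variable n0 : nat.
Hypothesis bot : forall k, (k < n0)%N -> forall x : M, grM k x -> x = 0.

(* spanned by the [o(u) w] for [u] of weight [< n], with [o(u) = u_(wt u - 1)] *)
Definition zmode (w : M) (n : nat) : set M := span [set x | exists s u,
  [/\ (s < n)%N, grV s u & x = u _[s%:Z - 1] w]].

Lemma zmode_subspace w n : subspace (zmode w n).
Proof. exact: span_subspace. Qed.

Lemma zmode_le w n n' : (n <= n')%N -> zmode w n `<=` zmode w n'.
Proof.
move=> le_n; apply: span_sub => _ [s [u [lts su ->]]]; exists s, u; split=> //.
exact: leq_trans le_n.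
Qed.

Lemma zmode_gr_int w n k u m : gr_int grV k u -> k < n%:Z -> m = k - 1 ->
  zmode w n (u _[m] w).
Proof.
case: k => [s|r] /= su ltk ->; last first.
  by rewrite su mode0l; apply: sub0 (zmode_subspace w n).
by apply: sub_span; exists s, u; rewrite -ltz_nat.
Qed.

Lemma mode_above s u m (w : M) : grV s u -> grM n0 w -> s%:Z <= m -> u _[m] w = 0.
Proof.
move=> su nw lem; have := adm_weight (admP M) m su nw.
case E: (s%:Z + _ - _ - _) => [r|r] //= rx.
by apply: (bot _ rx); lia.
Qed.

Lemma zero_mode_bottom s u (w : M) : grV s u -> grM n0 w ->
  grM n0 (u _[s%:Z - 1] w).
Proof.
move=> su nw; apply: (grM_int (adm_weight (admP M) (s%:Z - 1) su nw)); lia.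
Qed.

(** Take the Jacobi identity at [(l, m, n) = (-1, s, t - 1)]. Degree reasons kill the second sum and
    all but one term of the first. On the right [u_(i-1) v] has weight [s + t - i] and acts by its
    zero mode, so only [i = 0] does not drop the weight. *)
Lemma zhu_product s t u v (w : M) : grV s u -> grV t v -> grM n0 w ->
  zmode w (s + t) (u _[s%:Z - 1] v _[t%:Z - 1] w
                   - voa_Y u (-1) v _[(s + t)%N%:Z - 1] w).
Proof.
move=> su tv nw; have subZw := zmode_subspace w (s + t).
have [N0 J] := wm_jacobi hM u v w (-1) s (t%:Z - 1).
have {J} := J N0.+1 (leqnSn _); rewrite [X in _ - X]big1; last first.
  move=> i _; rewrite (mode_above su nw) ?lerDl //.
  by rewrite (linear_fun0 (mode_linr _ _)) mul0rz.
rewrite subr0 big_ord_recl big1 => [|i _]; last first.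
  rewrite (mode_above tv nw) ?(linear_fun0 (mode_linr _ _)) ?mul0rz //.
  by rewrite /= /bump; lia.
rewrite addr0 expand_coefn0 mulr1z.
rewrite (_ : -1 + s%:Z - _ = s%:Z - 1); last by rewrite /=; lia.
rewrite (_ : t%:Z - 1 + _ = t%:Z - 1); last by rewrite /=; lia.
move=> ->; rewrite big_ord_recl expand_coefn0 mulr1z.
rewrite (_ : s%:Z + (t%:Z - 1) - _ = (s + t)%N%:Z - 1); last by rewrite /=; lia.
rewrite (_ : -1 + (_ ord0)%:Z = -1); last by rewrite /=; lia.
rewrite addrC addrA addNr add0r; apply: (sub_sum subZw) => i _.
apply: (subMz subZw).
apply: zmode_gr_int (voa_weight (voaP V) _ su tv) _ _; rewrite /= /bump; lia.
Qed.

Lemma zero_mode_mul s u n (w x : M) : grV s u -> grM n0 w -> zmode w n x ->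
  zmode w (n + s) (u _[s%:Z - 1] x).
Proof.
move=> su nw; move: x; have subZw := zmode_subspace w (n + s).
apply: span_min => [|_ [t [v [ltn tv ->]]] /=].
  apply/subspaceP; split=> /= [|a x x' Hx Hx'].
    by rewrite (linear_fun0 (mode_linr _ _)); apply: sub0 subZw.
  by rewrite mode_linr; apply: (subD subZw) => //; apply: (subZ subZw).
rewrite -[_ _[_] _](subrK (voa_Y u (-1) v _[(s + t)%N%:Z - 1] w)).
apply: (subD subZw).
  by apply: zmode_le (zhu_product su tv nw); lia.
by apply: zmode_gr_int (voa_weight (voaP V) _ su tv) _ _; lia.
Qed.

(* Zhu's circle product acts as zero on the bottom level, so its leading term
   [u_(-k-2) v] is a combination of terms of lower weight there. *)
Lemma zhu_circle s t u v k (w : M) : grV s u -> grV t v -> grM n0 w ->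
  zmode w (s + t + k).+1 (voa_Y u (- k.+2%:Z) v _[(s + t + k)%N%:Z] w).
Proof.
move=> su tv nw; have subZw := zmode_subspace w (s + t + k).+1.
(* With [m = s] and [n = t + k] both sums on the left vanish for degree reasons, and every term on
   the right is again a zero mode. *)
have [N0 J] := wm_jacobi hM u v w (- k.+2%:Z) s (t%:Z + k%:Z).
have {J} := J N0.+1 (leqnSn _); rewrite [X in _ - X]big1; last first.
  move=> i _; rewrite (mode_above su nw) ?lerDl //.
  by rewrite (linear_fun0 (mode_linr _ _)) mul0rz.
rewrite subr0 big1 => [|i _]; last first.
  rewrite (mode_above tv nw) ?(linear_fun0 (mode_linr _ _)) ?mul0rz //.
  by lia.
rewrite big_ord_recl expand_coefn0 mulr1z.
rewrite (_ : s%:Z + (t%:Z + k%:Z) - _ = (s + t + k)%N%:Z); last by rewrite /=; lia.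
rewrite (_ : - k.+2%:Z + (_ ord0)%:Z = - k.+2%:Z); last by rewrite /=; lia.
move=> /esym/eqP; rewrite addr_eq0 => /eqP->.
apply: (subN subZw); apply: (sub_sum subZw) => i _; apply: (subMz subZw).
apply: zmode_gr_int (voa_weight (voaP V) _ su tv) _ _; rewrite /= /bump; lia.
Qed.

(** At [l = 0] the Jacobi identity is the commutator formula: only the [u_i v] with [i >= 0] occur,
    and their weight is at most [s + t - 1]. *)
Lemma zero_mode_comm s t u v (w : M) : grV s u -> grV t v -> grM n0 w ->
  zmode w (s + t) (u _[s%:Z - 1] v _[t%:Z - 1] w - v _[t%:Z - 1] u _[s%:Z - 1] w).
Proof.
move=> su tv nw; have subZw := zmode_subspace w (s + t).
have [N0 J] := wm_jacobi hM u v w 0 (s%:Z - 1) (t%:Z - 1).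
have {J} := J N0.+1 (leqnSn _).
rewrite big_ord_recl big1 => [|i _]; last by rewrite expand_coef0n ?mulr0z.
rewrite big_ord_recl big1 => [|i _]; last by rewrite expand_coef0n ?mulr0 ?mulr0z.
rewrite !expand_coefn0 !addr0 mulr1 expr0 !mulr1z !add0r.
move=> ->.
apply: (sub_sum subZw) => i _; apply: (subMz subZw).
apply: zmode_gr_int (voa_weight (voaP V) _ su tv) _ _; lia.
Qed.

Lemma zmode_full (w x : M) : grM n0 w -> w != 0 ->
  grM n0 x -> exists n, zmode w n x.
Proof.
move=> nw w0 nx; have := homog_generated nw w0 nx.
move: x nx => x _; apply: (@span_min _ _ _ [set x | exists n, zmode w n x]).
  apply/subspaceP; split=> /= [|a y y' [n Hy] [n' Hy']].
    by exists 0%N; apply: sub0 (zmode_subspace _ _).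
  exists (n + n')%N; have subZw := zmode_subspace w (n + n').
  apply: (subD subZw); last by apply: zmode_le Hy'; apply: leq_addl.
  by apply: (subZ subZw); apply: zmode_le Hy; apply: leq_addr.
move=> _ [s [u [n [su E ->]]]] /=; exists s.+1; apply: sub_span.
by exists s, u; split=> //; congr (_ _[_] _); lia.
Qed.

End Bottom.

End Modes.

(** * Endomorphisms and homogeneous generators *)

Section Endomorphisms.
Variables (F : fieldType) (V : voa F) (M : admissible_module V).
Notation grV := (voa_gr V).
Notation grM := (adm_gr M).
Notation "u '_[' n ] w" := (adm_Y u n (w : M)) (at level 30, right associativity,
  format "u '_[' n ]  w").
Implicit Types (f g : voa_end M).

Lemma end_lin f : linear f. Proof. by case: (voa_endP f). Qed.
Lemma end_mode f u n w : f (u _[n] w) = u _[n] f w.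
Proof. by case: (voa_endP f) => _; apply. Qed.

Lemma end_sum f (I : Type) (r : seq I) (x : I -> M) :
  f (\sum_(i <- r) x i) = \sum_(i <- r) f (x i).
Proof. exact: (big_morph f (linear_funD (end_lin f)) (linear_fun0 (end_lin f))). Qed.

Hypothesis irrM : irreducible M.

(* A component [y] of [f w] of degree [t > n0] is sent to a nonzero vector of
   degree [n0] by some mode, which annihilates [w] for degree reasons. *)
Lemma end_bottom n0 f (w : M) :
  (forall k, (k < n0)%N -> forall x : M, grM k x -> x = 0) ->
  grM n0 w -> grM n0 (f w).
Proof.
move=> bot nw; have dM := adm_direct (admP M).
have [w0|w0] := eqVneq w 0; first by rewrite w0 (linear_fun0 (end_lin f)) -w0.
have [N [y [gry fw]]] := ds_span dM (f w).
have [pr prP] := projections_ex dM.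
have prI := projections_gr_int prP; have [lpr prK _] := prP.
have y0 t : (t < N)%N -> t != n0 -> y t = 0.
  move=> ltN; rewrite neq_ltn => /orP[lt0|lt0]; first exact: bot lt0 _ (gry t).
  apply/eqP/negP => /negP yt0.
  have : span [set 0] w.
    move: (homog_generated irrM (gry t) yt0 nw); apply: span_sub.
    move=> _ [s [u [n [su E ->]]]] /=.
    have uw : u _[n] w = 0.
      have := adm_weight (admP M) n su nw.
      case Er: (s%:Z + n0%:Z - n - 1) => [r|r] //= rx.
      by apply: (bot r) rx; lia.
    have := congr1 (pr n0) (congr1 (adm_Y u n) fw).
    rewrite -end_mode uw (linear_fun0 (end_lin f)) (linear_fun0 (lpr n0)).
    rewrite (big_morph _ (linear_funD (mode_linr u n)) (linear_fun0 (mode_linr u n))).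
    rewrite (big_morph _ (linear_funD (lpr n0)) (linear_fun0 (lpr n0))).
    rewrite (bigD1 (Ordinal ltN)) //= big1 => [|i ni].
      rewrite addr0 => ->; rewrite (prI _ _ _ (adm_weight (admP M) n su (gry t))).
      by rewrite E eqxx.
    rewrite (prI _ _ _ (adm_weight (admP M) n su (gry i))); case: eqP => // Ei.
    by case/negP: ni; apply/eqP/val_inj => /=; lia.
  have sub0set : subspace [set 0 : M].
    by apply/subspaceP; split=> //= a u v -> ->; rewrite scaler0 addr0.
  move=> /(span_min sub0set (@subset_refl _ _)) /= /eqP.
  by rewrite (negbTE w0).
rewrite fw; have subn0 := ds_subspace dM n0.
apply: (sub_sum subn0) => i _; have [<-//|ni] := eqVneq (i : nat) n0.
by rewrite y0 //; apply: sub0 subn0.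
Qed.

(** [x] is a combination of modes applied to a bottom vector [w]; [f] only replaces [w] by [f w],
    which has the same degree by [end_bottom]. *)
Lemma end_homog f k (x : M) : grM k x -> grM k (f x).
Proof.
have [n0 [w [nw w0 bot]]] := bottom_ex irrM.
have fw := end_bottom f bot nw; have subk := ds_subspace (adm_direct (admP M)) k.
move=> kx; apply: (span_min (A := [set x | grM k (f x)])) (homog_generated irrM nw w0 kx).
  apply/subspaceP; split=> /= [|a y y' Hy Hy'].
    by rewrite (linear_fun0 (end_lin f)); apply: sub0 subk.
  by rewrite end_lin; apply: (subD subk) => //; apply: (subZ subk).
move=> _ [s [u [n [su E ->]]]] /=; rewrite end_mode.
exact: grM_int (adm_weight (admP M) n su fw) E.
Qed.

(** Irreducibility excludes only graded submodules, so Schur's argument needs a graded kernel;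
    [end_homog] provides it. *)
Lemma end_inj f : f != 0 -> injective f.
Proof.
move=> f0; suff ker0 x : f x = 0 -> x = 0.
  move=> x y fxy; apply/eqP; rewrite -subr_eq0; apply/eqP/ker0.
  by rewrite -scaleN1r addrC end_lin fxy scaleN1r addNr.
pose N := [set x | f x = 0].
have subN : admissible_submodule N.
  split=> [|u n y /= fy|y /= fy].
  - apply/subspaceP; split=> /= [|a y z fy fz]; first exact: linear_fun0 (end_lin f).
    by rewrite /N /= end_lin fy fz scaler0 addr0.
  - by rewrite /N /= end_mode fy (linear_fun0 (mode_linr u n)).
  have dM := adm_direct (admP M); have [m [z [grz def_y]]] := ds_span dM y.
  move: (fy : f y = 0); rewrite def_y end_sum.
  move=> /(ds_indep dM (x := fun n => f (z n)) (fun n => end_homog f (grz n))) fz.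
  apply: (sub_sum (span_subspace _)) => i _; apply: sub_span; split.
    exact: fz.
  by exists i.
have [_ /(_ _ subN)[N0|NT]] := irrM.
  by move=> fx; have : N x by []; rewrite N0.
case/eqP: f0; apply: voa_end_ext => y.
by have : N y by rewrite NT.
Qed.

Lemma end_surj f : f != 0 -> forall y, exists x, f x = y.
Proof.
move=> f0; pose N := range f.
have subN : admissible_submodule N.
  split=> [|u n _ [x _ <-]|_ [x _ <-]].
  - apply/subspaceP; split=> /= [|a _ _ [y _ <-] [z _ <-]].
      by exists 0 => //; apply: linear_fun0 (end_lin f).
    by exists (a *: y + z) => //; rewrite end_lin.
  - by exists (u _[n] x) => //; rewrite end_mode.
  have dM := adm_direct (admP M); have [m [z [grz ->]]] := ds_span dM x.
  rewrite end_sum.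
  apply: (sub_sum (span_subspace _)) => i _; apply: sub_span; split.
    by exists (z i).
  by exists i; apply/end_homog/grz.
have [[w w0] /(_ _ subN)[N0|NT]] := irrM; last first.
  by move=> y; have : N y; [rewrite NT|move=> [x _ <-]; exists x].
have : N (f w) by exists w.
rewrite N0 /= -(linear_fun0 (end_lin f)) => /(end_inj f0)/eqP.
by rewrite (negbTE w0).
Qed.

Lemma end_division f : f != 0 -> exists g, g * f = 1 /\ f * g = 1.
Proof.
move=> f0; have [h fh] := choice (end_surj f0).
have hf x : h (f x) = x by apply: (end_inj f0); rewrite fh.
have hP : `[< is_voa_end h >].
  apply/asboolP; split=> [a x y|u n x]; apply: (end_inj f0).
    by rewrite end_lin !fh.
  by rewrite end_mode !fh.
by exists (VOAEnd hP); split; apply: voa_end_ext => x; [apply: hf|apply: fh].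
Qed.

End Endomorphisms.

Section Words.
Variables (F : fieldType) (V : voa F) (M : admissible_module V).
Notation grV := (voa_gr V).
Notation grM := (adm_gr M).
Notation "u '_[' n ] w" := (adm_Y u n (w : M)) (at level 30, right associativity,
  format "u '_[' n ]  w").

Definition voa_word m (g : 'I_m -> V) (p : seq ('I_m * nat)) : V :=
  foldr (fun q y => voa_Y (g q.1) (- q.2.+1%:Z) y) (voa_vac V) p.

(** The homogeneous components of a finite spanning list of [U] generate as well, since modes are
    linear in both arguments. *)
Lemma homogeneous_generators : strongly_finitely_generated V ->
  exists m (g : 'I_m -> V) (d : 'I_m -> nat), (forall i, grV (d i) (g i)) /\
    span (range (voa_word g)) = setT.
Proof.
move=> [U [[s Us] Vs]]; have hV := va_weak_module (voa_va (voaP V)).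
have linl n y := wm_linearl hV n y; have linr u n := wm_linearr hV u n.
have /choice[c cP] := ds_span (voa_direct (voaP V)).
have /choice[x xP] := cP.
pose L := flatten [seq [seq (x u k, k) | k <- seq.iota 0 (c u)] | u <- s].
pose g (i : 'I_(size L)) := (tnth (in_tuple L) i).1.
exists (size L), g, (fun i => (tnth (in_tuple L) i).2).
split=> [i|].
  rewrite /g; have /flatten_mapP[u _ /mapP[k _ ->]] := mem_tnth i (in_tuple L).
  by have [+ _] := xP u; apply.
apply/seteqP; split=> // v _.
have subA := span_subspace (range (voa_word g)).
have key k u y : U u -> span (range (voa_word g)) y ->
    span (range (voa_word g)) (voa_Y u (- k.+1%:Z) y).
  rewrite Us => uU yA; move: u uU; apply: span_min => [|u /= us].
    apply/subspaceP; split=> /= [|a u u' Hu Hu'].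
      by rewrite (linear_fun0 (linl _ y)); apply: sub0 subA.
    by rewrite linl; apply: (subD subA) => //; apply: (subZ subA).
  have [xg ->] := xP u.
  rewrite (big_morph (fun u => voa_Y u (- k.+1%:Z) y)
    (linear_funD (linl _ y)) (linear_fun0 (linl _ y))).
  apply: (sub_sum subA) => i _.
  move: y yA; apply: span_min => [|_ [p _ <-]] /=.
    apply/subspaceP; split=> /= [|a y y' Hy Hy'].
      by rewrite (linear_fun0 (linr _ _)); apply: sub0 subA.
    by rewrite linr; apply: (subD subA) => //; apply: (subZ subA).
  have /tnthP[j jP] : (x u i, i : nat) \in in_tuple L.
    apply/flatten_mapP; exists u => //; apply/mapP; exists (i : nat) => //.
    by rewrite mem_iota ltn_ord.
  by apply: sub_span; exists ((j, k) :: p) => //=; rewrite /g -jP.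
have : span [set v | exists s : seq (V * nat),
      (forall p, p \in s -> U p.1 /\ (0 < p.2)%N) /\
      v = foldr (fun p w => voa_Y p.1 (- p.2%:Z) w) (voa_vac V) s] v by rewrite Vs.
move: v; apply: span_min => // _ [t [tP ->]].
elim: t tP => [_|[u n] t IHt tP] /=; first by apply: sub_span; exists [::].
have [/= uU] := tP _ (mem_head _ _); case: n tP => // n tP _.
by apply: key => //; apply: IHt => p pt; apply: tP; rewrite inE pt orbT.
Qed.

End Words.

(** * Monomials in zero modes *)

Section Monomials.
Variables (F : fieldType) (V : voa F) (M : admissible_module V).
Notation grV := (voa_gr V).
Notation grM := (adm_gr M).
Notation "u '_[' n ] w" := (adm_Y u n (w : M)) (at level 30, right associativity,
  format "u '_[' n ]  w").

Lemma modeB (u : V) n (x y : M) : u _[n] (x - y) = u _[n] x - u _[n] y.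
Proof.
by rewrite -[- y]scaleN1r addrC mode_linr scaleN1r addrC.
Qed.

Variable n0 : nat.
Hypothesis bot : forall k, (k < n0)%N -> forall x : M, grM k x -> x = 0.
Variables (m : nat) (g : 'I_m -> V) (d : 'I_m -> nat).
Hypothesis gd : forall i, grV (d i) (g i).
Hypothesis gspan : span (range (voa_word g)) = setT.

Definition zword (p : seq 'I_m) (x : M) : M :=
  foldr (fun i y => g i _[(d i)%:Z - 1] y) x p.
Definition word_wt (p : seq 'I_m) : nat := (\sum_(i <- p) d i)%N.

Lemma zword_cat p q x : zword (p ++ q) x = zword p (zword q x).
Proof. exact: foldr_cat. Qed.

Lemma word_wt_cons i p : word_wt (i :: p) = (d i + word_wt p)%N.
Proof. exact: big_cons. Qed.

Lemma word_wt_cat p q : word_wt (p ++ q) = (word_wt p + word_wt q)%N.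
Proof. exact: big_cat. Qed.

Lemma word_wt_perm p q : perm_eq p q -> word_wt p = word_wt q.
Proof. exact: perm_big. Qed.

Lemma zword_linear p : linear (zword p).
Proof.
elim: p => [|i p IHp] a x y //; rewrite /zword /= -!/(zword p _) IHp.
exact: mode_linr.
Qed.

Lemma zword_bottom p x : grM n0 x -> grM n0 (zword p x).
Proof. by move=> nx; elim: p => //= i p IHp; apply: zero_mode_bottom (gd i) IHp. Qed.

Lemma zword_zmode p x : grM n0 x -> zmode x (word_wt p).+1 (zword p x).
Proof.
move=> nx; elim: p => [|i p IHp].
  rewrite /= -[X in zmode _ _ X]mode_vac; apply: sub_span.
  exists 0%N, (voa_vac V); split=> //.
  exact: (voa_one (voaP V)).
rewrite word_wt_cons addnC -addSn; exact: (zero_mode_mul bot (gd i) nx IHp).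
Qed.

(** [y] uses weights at most [a] and the outer mode a weight below [b], so the total stays below
    [a + b]. This off-by-one keeps the errors of reordering strictly below the weight of the
    word. *)
Lemma zmode_trans x y a b : grM n0 x -> zmode x a.+1 y -> zmode y b `<=` zmode x (a + b).
Proof.
move=> nx xy; apply: span_min (zmode_subspace _ _) _ => _ [s [u [lts su ->]]].
by apply: zmode_le (zero_mode_mul bot su nx xy); lia.
Qed.

(** Swapping [i] with the first letter [j] costs a commutator at the vector [zword r x]; the rest of
    the move takes place under the zero mode of [j]. *)
Lemma zword_move i p q x : grM n0 x -> zmode x (word_wt (i :: p ++ q))
  (zword (i :: p ++ q) x - zword (p ++ i :: q) x).
Proof.
move=> nx; elim: p => [|j p IHp] /=.
  by rewrite subrr; apply: sub0 (zmode_subspace _ _).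
set r := p ++ q in IHp *; have subZ := zmode_subspace x (word_wt [:: i, j & r]).
rewrite -/(zword r x) -/(zword (p ++ i :: q) x).
rewrite -(subrK (g j _[(d j)%:Z - 1] zword (i :: r) x) (g i _[_] _)) -addrA.
apply: (subD subZ).
  rewrite !word_wt_cons addnA addnC.
  apply: (zmode_trans nx (zword_zmode r nx)).
  exact: (zero_mode_comm (gd i) (gd j) (zword_bottom r nx)).
have -> : word_wt [:: i, j & r] = (word_wt (i :: r) + d j)%N.
  by rewrite !word_wt_cons; lia.
rewrite -modeB; exact (zero_mode_mul bot (gd j) nx IHp).
Qed.

Lemma zword_perm p q x : grM n0 x -> perm_eq p q ->
  zmode x (word_wt p) (zword p x - zword q x).
Proof.
move=> nx; elim: p q => [|i p IHp] q pq.
  have /size0nil-> : size q = 0%N by rewrite -(perm_size pq).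
  by rewrite subrr; apply: sub0 (zmode_subspace _ _).
have iq : i \in q by rewrite -(perm_mem pq) mem_head.
case/splitPr: iq pq => q1 q2 pq.
have {}pq : perm_eq p (q1 ++ q2).
  by rewrite -(perm_cons i) (perm_trans pq) // -cat1s perm_catCA.
rewrite -(subrK (zword (i :: q1 ++ q2) x) (zword (i :: p) x)) -addrA.
apply: (subD (zmode_subspace _ _)); last first.
  by rewrite word_wt_cons (word_wt_perm pq) -word_wt_cons; apply: zword_move.
rewrite /= -!/(zword _ x) -modeB word_wt_cons addnC.
by apply: (zero_mode_mul bot (gd i) nx); apply: IHp.
Qed.

Definition voa_wt (p : seq ('I_m * nat)) : nat := (\sum_(q <- p) (d q.1 + q.2))%N.

Lemma voa_word_homog p : grV (voa_wt p) (voa_word g p).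
Proof.
elim: p => [|[i k] p IHp] /=.
  by rewrite /voa_wt big_nil; apply: (voa_one (voaP V)).
have := voa_weight (voaP V) (- k.+1%:Z) (gd i) IHp.
case E: (_ - _) => [r|r] /=; rewrite {1}/voa_wt big_cons -/(voa_wt p); last by lia.
by move=> /=; have -> : r = (d i + k + voa_wt p)%N by lia.
Qed.

(** Induction on the weight, then on the word in [V]. A first letter in mode -1 splits off as a zero
    mode by [zhu_product], up to lower weight; if its mode is below -1, the whole vector acts
    through lower weights by [zhu_circle]. *)
Lemma zmode_word n x : grM n0 x -> forall t, (t <= n)%N ->
  zmode x t `<=` span [set y | exists2 p, (word_wt p < t)%N & y = zword p x].
Proof.
move=> nx; elim: n => [|n IHn] t.
  rewrite leqn0 => /eqP->; apply: span_min (span_subspace _) _.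
  by move=> y [s [u [+ _ _]]]; rewrite ltn0.
move=> let_; apply: span_min (span_subspace _) _ => _ [s [u [lts su ->]]].
pose Y t := span [set y | exists2 p, (word_wt p < t)%N & y = zword p x].
have subY t' : subspace (Y t') by apply: span_subspace.
have Yle a b : (a <= b)%N -> Y a `<=` Y b.
  move=> le_ab; apply: span_sub => _ [p ltp ->]; exists p => //.
  exact: leq_trans le_ab.
have wordY p : (voa_wt p <= n)%N ->
    Y (voa_wt p).+1 (voa_word g p _[(voa_wt p)%:Z - 1] x).
  elim: p => [|[i k] p IHp] /=.
    move=> _; rewrite /voa_wt big_nil mode_vac; apply: sub_span.
    by exists [::] => //; rewrite /word_wt big_nil.
  have wt_cons : voa_wt ((i, k) :: p) = (d i + k + voa_wt p)%N by apply: big_cons.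
  rewrite wt_cons; case: k {wt_cons} => [|k] len; last first.
    have lt_ : ((d i + voa_wt p + k).+1 <= n)%N by lia.
    have := IHn _ lt_ _ (zhu_circle bot k (gd i) (voa_word_homog p) nx).
    rewrite (_ : (d i + voa_wt p + k)%:Z = (d i + k.+1 + voa_wt p)%N%:Z - 1); last by lia.
    by apply: Yle; lia.
  rewrite addn0 in len *.
  have Z := zhu_product bot (gd i) (voa_word_homog p) nx.
  rewrite -[X in Y _ X](subKr (g i _[(d i)%:Z - 1] voa_word g p _[(voa_wt p)%:Z - 1] x)).
  apply: (subB (subY _)).
    have : Y (voa_wt p).+1 (voa_word g p _[(voa_wt p)%:Z - 1] x) by apply: IHp; lia.
    move: (_ _[_] x); apply: span_min => [|_ [q ltq ->]] /=.
      apply/subspaceP; split=> /= [|a y y' Hy Hy'].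
        by rewrite (linear_fun0 (mode_linr _ _)); apply: (sub0 (subY _)).
      by rewrite mode_linr; apply: (subD (subY _)) => //; apply: (subZ (subY _)).
    apply: sub_span; exists (i :: q) => //; rewrite word_wt_cons; lia.
  apply: (Yle _ _ (leqnSn _)).
  exact: IHn Z.
(* A vector of weight [s] is a combination of words that may have other weights; projecting to
   weight [s] removes those. *)
have [pr prP] := projections_ex (voa_direct (voaP V)).
have [lpr prK pr0] := prP.
suff : [set v | Y s.+1 (pr s v _[s%:Z - 1] x)] u by rewrite /= prK //; apply: Yle.
have : span (range (voa_word g)) u by rewrite gspan.
move: {su} u; apply: span_min => [|_ [p _ <-]] /=.
  apply/subspaceP; split=> /= [|a y y' Hy Hy'].
    by rewrite (linear_fun0 (lpr s)) mode0l; apply: (sub0 (subY _)).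
  by rewrite lpr mode_linl; apply: (subD (subY _)) => //; apply: (subZ (subY _)).
have [sp|sp] := eqVneq s (voa_wt p).
  rewrite sp prK; last exact: voa_word_homog.
  by apply: wordY; lia.
by rewrite (pr0 _ _ _ sp (voa_word_homog p)) mode0l; apply: (sub0 (subY _)).
Qed.

Definition mono_word (a : 'X_{1..m}) : seq 'I_m :=
  flatten [seq nseq (a i) i | i <- enum 'I_m].
Definition mono (a : 'X_{1..m}) (x : M) : M := zword (mono_word a) x.
Definition mono_wt (a : 'X_{1..m}) : nat := word_wt (mono_word a).

Lemma count_mono_word a i : count_mem i (mono_word a) = a i.
Proof.
rewrite /mono_word count_flatten -map_comp sumnE big_map big_enum /=.
rewrite (bigD1 i) //= count_nseq /= eqxx mul1n big1 ?addn0 // => j ji.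
by rewrite count_nseq /= (negbTE ji).
Qed.

Lemma mono_word_perm p : perm_eq p (mono_word [multinom count_mem i p | i < m]).
Proof.
by rewrite /perm_eq; apply/allP => i _ /=; rewrite count_mono_word mnmE.
Qed.

Lemma mono_wordD a b : perm_eq (mono_word a ++ mono_word b) (mono_word (a + b)%MM).
Proof.
by rewrite /perm_eq; apply/allP => i _ /=; rewrite count_cat !count_mono_word mnmDE.
Qed.

Lemma mono0 x : mono 0%MM x = x.
Proof.
rewrite /mono (_ : mono_word _ = [::]) //; rewrite /mono_word.
by elim: (enum _) => //= i s ->; rewrite mnm0E.
Qed.

Lemma mono_wtD a b : mono_wt (a + b)%MM = (mono_wt a + mono_wt b)%N.
Proof. by rewrite /mono_wt -(word_wt_perm (mono_wordD a b)) word_wt_cat. Qed.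

(** Sorting a word costs only terms of lower weight ([zword_perm]), which the induction on the
    weight turns into ordered monomials. *)
Lemma zmode_mono n x : grM n0 x -> forall t, (t <= n)%N ->
  zmode x t `<=` span [set y | exists2 a, (mono_wt a < t)%N & y = mono a x].
Proof.
move=> nx; elim: n => [|n IHn] t let_ y /(zmode_word nx (leqnn t)); move: y.
  move: let_; rewrite leqn0 => /eqP t0.
  by apply: span_sub => z [p]; rewrite t0 ltn0.
apply: span_min (span_subspace _) _ => _ [p ltp ->].
set a := [multinom count_mem i p | i < m].
have wtp : mono_wt a = word_wt p by rewrite /mono_wt -(word_wt_perm (mono_word_perm p)).
rewrite -(subrK (mono a x) (zword p x)); apply: (subD (span_subspace _)); last first.
  by apply: sub_span; exists a; rewrite // wtp.
have le_ : (word_wt p <= n)%N by lia.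
have := IHn _ le_ _ (zword_perm nx (mono_word_perm p)).
by apply: span_sub => _ [b ltb ->]; exists b => //; lia.
Qed.

Lemma mono_mul a b x : grM n0 x ->
  span [set y | exists2 c, (mono_wt c < mono_wt (a + b)%MM)%N & y = mono c x]
    (mono a (mono b x) - mono (a + b)%MM x).
Proof.
move=> nx; apply: (zmode_mono nx (leqnn _)).
rewrite /mono -zword_cat /mono_wt -(word_wt_perm (mono_wordD a b)).
exact: zword_perm (mono_wordD a b).
Qed.

End Monomials.

(** * Commutative division subrings of the endomorphism ring *)

Section EndSubfield.
Variables (F : fieldType) (V : voa F) (M : admissible_module V).
Implicit Types (f g : voa_end M).

Lemma end_scaleE a f w : (a *: f) w = a *: f w. Proof. by []. Qed.
Lemma end_mulE f g w : (f * g) w = f (g w). Proof. by []. Qed.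

Lemma end_scaleAl a f g : a *: f * g = a *: (f * g).
Proof. exact: voa_end_ext. Qed.
Lemma end_scaleAr a f g : f * (a *: g) = a *: (f * g).
Proof.
by apply: voa_end_ext => w; rewrite end_mulE !end_scaleE (linear_funZ (end_lin f)).
Qed.

Record end_subfield := EndSubfield {
  es_set : set (voa_end M);
  es_one : es_set 1;
  es_sub : forall f g, es_set f -> es_set g -> es_set (f - g);
  es_mul : forall f g, es_set f -> es_set g -> es_set (f * g);
  es_scalar : forall a : F, es_set (a *: (1 : voa_end M));
  es_comm : forall f g, es_set f -> es_set g -> f * g = g * f;
  es_nonzero : 1 != 0 :> voa_end M;
  es_inv : forall f, es_set f -> f != 0 -> exists2 g, es_set g & g * f = 1 }.

Variable C : end_subfield.

Record es_type := EsElt { es_val : voa_end M; es_valP : `[< es_set C es_val >] }.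
HB.instance Definition _ := [isSub for es_val].
HB.instance Definition _ := [Choice of es_type by <:].

Lemma es_subring_closed : subring_closed (fun f : voa_end M => `[< es_set C f >]).
Proof.
split=> [|f g /asboolP Cf /asboolP Cg|f g /asboolP Cf /asboolP Cg]; apply/asboolP.
- exact: es_one.
- exact: es_sub.
- exact: es_mul.
Qed.
HB.instance Definition _ := GRing.SubChoice_isSubPzRing.Build (voa_end M)
  (fun f : voa_end M => `[< es_set C f >]) es_type es_subring_closed.

Lemma es_valE (x : es_type) : es_set C (es_val x).
Proof. exact/asboolP/es_valP. Qed.

Lemma es_mulC : commutative ( *%R : es_type -> es_type -> es_type).
Proof. by move=> x y; apply: val_inj; apply: (es_comm (es_valE x) (es_valE y)). Qed.
HB.instance Definition _ := GRing.PzRing_hasCommutativeMul.Build es_type es_mulC.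

Lemma es_oner_neq0 : 1 != 0 :> es_type.
Proof.
apply/negP => /eqP/(congr1 es_val) E; have /eqP := es_nonzero C; apply.
exact: E.
Qed.
HB.instance Definition _ := GRing.PzSemiRing_isNonZero.Build es_type es_oner_neq0.

Lemma es_inv_ex : exists inv : es_type -> es_type,
  (forall x, x != 0 -> inv x * x = 1) /\ inv 0 = 0.
Proof.
have /choice[inv invP] : forall x : es_type, exists y, if x == 0 then y = 0 else y * x = 1.
  move=> x; case: eqP => [_|/eqP x0]; first by exists 0.
  have vx0 : es_val x != 0.
    by apply: contra_neq x0 => x0; apply: val_inj.
  have [g Cg gx] := es_inv (es_valE x) vx0.
  by exists (EsElt (introT (asboolP _) Cg)); apply: val_inj.
exists inv; split=> [x x0|]; first by have := invP x; rewrite (negbTE x0).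
by have := invP 0; rewrite eqxx.
Qed.
Definition es_inverse := projT1 (cid es_inv_ex).
Lemma es_mulVf x : x != 0 -> es_inverse x * x = 1.
Proof. by rewrite /es_inverse; case: (cid _) => inv [] /= + _; apply. Qed.
Lemma es_invr0 : es_inverse 0 = 0.
Proof. by rewrite /es_inverse; case: (cid _) => inv []. Qed.
HB.instance Definition _ := GRing.ComNzRing_isField.Build es_type es_mulVf es_invr0.

Definition es_scal (a : F) : es_type := EsElt (introT (asboolP _) (es_scalar C a)).
Lemma es_scal_zmod : zmod_morphism es_scal.
Proof. by move=> a b; apply: val_inj; rewrite /= scalerBl. Qed.
Lemma es_scal_monoid : monoid_morphism es_scal.
Proof.
split=> [|a b]; apply: val_inj => /=; first by rewrite scale1r.
by rewrite end_scaleAl mul1r scalerA.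
Qed.
HB.instance Definition _ := GRing.isZmodMorphism.Build F es_type es_scal es_scal_zmod.
HB.instance Definition _ := GRing.isMonoidMorphism.Build F es_type es_scal es_scal_monoid.

(** A copy of the additive group [M], so that scaling by the subfield can be declared without
    competing with scaling by [F]. *)
Definition es_module_of (D : end_subfield) : Type := M.
Notation es_module := (es_module_of C).
HB.instance Definition _ (D : end_subfield) := GRing.Zmodule.copy (es_module_of D) M.

Definition es_scale (k : es_type) (w : es_module) : es_module := es_val k w.
Lemma es_scaleA a b w : es_scale a (es_scale b w) = es_scale (a * b) w.
Proof. by []. Qed.
Lemma es_scale1 : left_id 1 es_scale. Proof. by []. Qed.
Lemma es_scaleDr : right_distributive es_scale +%R.
Proof. by move=> a u v; apply: linear_funD (end_lin _) u v. Qed.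
Lemma es_scaleDl v : {morph es_scale^~ v : a b / a + b}.
Proof. by []. Qed.
HB.instance Definition _ := GRing.Zmodule_isLmodule.Build es_type es_module
  es_scaleA es_scale1 es_scaleDr es_scaleDl.

Lemma es_moduleZ (k : es_type) (w : es_module) : k *: w = es_val k w.
Proof. by []. Qed.

Lemma comb_span (S : set M) (x : M) : span S x ->
  comb (range es_scal) (S : set es_module) x.
Proof.
move=> [n [c [y [Sy ->]]]]; elim/big_rec: _ => [|i z _ Hz]; first exact: comb0.
have -> : c i *: y i = es_scal (c i) *: (y i : es_module) :> M by [].
by apply: combD => //; exists (c i).
Qed.

Hypothesis irrM : irreducible M.
Hypothesis fgV : strongly_finitely_generated V.

(** [division_ring_fin_gen] applies with base scalars [F]: zero modes are linear over the subfield,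
    whose elements commute with them, and [k w] stays in [M(n0)], so it is an [F]-combination of
    monomials at [w]. *)
Lemma es_finite : exists s : seq es_type, forall k, exists c : 'I_(size s) -> F,
  k = \sum_i es_scal (c i) * s`_i.
Proof.
have [n0 [w [nw w0 bot]]] := bottom_ex irrM.
have [m [g [d [gd gspan]]]] := homogeneous_generators fgV.
have zcomm p (f : voa_end M) x : zword g d p (f x) = f (zword g d p x).
  by elim: p => //= i p ->; rewrite end_mode.
have [|||||||||l lP] := @division_ring_fin_gen es_type es_module (range es_scal) m
  (mono g d) (mono_wt d) w.
- by move=> x x0; exists x^-1; rewrite mulVf ?mulfV.
- by exists 1; rewrite ?rmorph1.
- by exists (-1); rewrite ?rmorphN1.
- exact: w0.
- move=> b k x y; rewrite !es_moduleZ.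
  rewrite /mono (linear_funD (zword_linear _ _ _)).
  by rewrite zcomm.
- exact: mono0.
- exact: mono_wtD.
- move=> b c; exact: comb_span (mono_mul bot gd gspan b c nw).
- move=> k; have kw : adm_gr M n0 (es_val k w) by apply: end_homog.
  have [n /(zmode_mono bot gd gspan nw (leqnn _))/comb_span] := zmode_full irrM nw w0 kw.
  by apply: comb_sub => // _ [a _ ->]; exists a.
exact: (@finite_of_integral _ _ (es_scal : {rmorphism F -> es_type}) l).
Qed.

End EndSubfield.

(** * Finite dimension of the endomorphism ring *)

Section FiniteDim.
Variables (F : fieldType) (V : voa F) (M : admissible_module V).
Implicit Types (f g : voa_end M).
Hypothesis irrM : irreducible M.

Lemma end_oner_neq0 : 1 != 0 :> voa_end M.
Proof.
have [[w w0] _] := irrM; apply/negP => /eqP E.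
by have : (1 : voa_end M) w = 0; [rewrite E|move/eqP; rewrite (negbTE w0)].
Qed.

(** Zorn runs over commuting subsets rather than subfields, so unions of chains are immediate. A
    maximal one contains its centralizer, and this gives closure under all operations, inverses
    included. *)
Lemma maximal_subfield : exists C : end_subfield M, forall f,
  (forall g, es_set C g -> f * g = g * f) -> es_set C f.
Proof.
pose P := [set S : set (voa_end M) | forall f g, S f -> S g -> f * g = g * f].
have [|A [AC Amax]] := @Zorn_bigcup _ P.
  move=> S SP totS f g [X SX Xf] [Y SY Yg].
  have [XY|YX] := totS _ _ SX SY; first by apply: (SP Y) => //; apply: XY.
  by apply: (SP X) => //; apply: YX.
have CA f : (forall g, A g -> f * g = g * f) -> A f.
  move=> fA; apply: contrapT => Af; apply: (Amax (A `|` [set f])).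
    split; first by move=> g Ag; left.
    by move=> /(_ f) Bf; apply/Af/Bf; right.
  move=> g h [Ag|->] [Ah|->] //; [exact: AC|by rewrite fA|exact: fA].
have A1 : A 1 by apply: CA => g _; rewrite mul1r mulr1.
have AB f g : A f -> A g -> A (f - g).
  by move=> Af Ag; apply: CA => h Ah; rewrite mulrBl mulrBr AC // (AC g).
have AM f g : A f -> A g -> A (f * g).
  by move=> Af Ag; apply: CA => h Ah; rewrite -mulrA (AC g) // mulrA (AC f) // mulrA.
have AZ a : A (a *: (1 : voa_end M)).
  by apply: CA => h _; rewrite end_scaleAl end_scaleAr mul1r mulr1.
have AV f : A f -> f != 0 -> exists2 g, A g & g * f = 1.
  move=> Af /(end_division irrM)[g [gf fg]]; exists g => //.
  apply: CA => h Ah; rewrite -[LHS]mulr1 -fg !mulrA; congr (_ * _).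
  by rewrite -(mulrA g h) (AC h) // mulrA gf mul1r.
by exists (EndSubfield A1 AB AM AZ AC end_oner_neq0 AV).
Qed.

Hypothesis fgV : strongly_finitely_generated V.

Lemma end_finite_dim : finite_dim [set: voa_end M].
Proof.
have [C CC] := maximal_subfield.
have [s sP] := es_finite C irrM fgV; set n := size s in sP.
pose l (i : 'I_n) : voa_end M := es_val s`_i.
have lP f : es_set C f -> exists c : 'I_n -> F, f = \sum_i c i *: l i.
  move=> Cf; have [c E] := sP (EsElt (introT (asboolP _) Cf)); exists c.
  have /= -> := congr1 (@es_val _ _ _ C) E.
  rewrite (big_morph (@es_val _ _ _ C) (fun _ _ => erefl) erefl).
  by apply: eq_bigr => i _ /=; rewrite end_scaleAl mul1r.
(* Independence in [D] as a right vector space over [C]; [centralizer_dependent] bounds [r] by [n],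
   the length of a list spanning [C] over [F]. *)
pose indep r := exists e : 'I_r -> voa_end M, forall y : 'I_r -> voa_end M,
  (forall j, es_set C (y j)) -> \sum_j e j * y j = 0 -> forall j, y j = 0.
have not_indep : ~ indep n.+1.
  move=> [e eP]; pose Z := range (fun a : F => a *: (1 : voa_end M)).
  have cZ x z : Z z -> z * x = x * z.
    by move=> [a _ <-]; rewrite end_scaleAl end_scaleAr mul1r mulr1.
  have lZ x : es_set C x -> exists2 c : 'I_n -> voa_end M,
      (forall i, Z (c i)) & x = \sum_i c i * l i.
    move=> /lP[c ->]; exists (fun i => c i *: (1 : voa_end M)).
      by move=> i; exists (c i).
    by apply: eq_bigr => i _; rewrite end_scaleAl mul1r.
  have [y [[j yj] yC ye]] := centralizer_dependent (end_division irrM) e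
    end_oner_neq0 CC (@es_mul _ _ _ C) (es_one C) cZ lZ.
  by rewrite (eP y yC ye j) eqxx in yj.
have [r [[e eP] rP]] : exists r, indep r /\ ~ indep r.+1.
  apply: contrapT => nr; apply: not_indep.
  elim: n.+1 => [|k IHk]; first by exists (fun=> 0) => y _ _ [].
  by apply: contrapT => nk; apply: nr; exists k.
(* For an independent family [e] that cannot be extended, these products span [D] over [F]: an [x]
   outside their span would extend the family. *)
pose L := [seq e j * l i | j <- enum 'I_r, i <- enum 'I_n].
exists L; apply/seteqP; split=> // x _; apply: contrapT => xL; apply: rP.
have subL := span_subspace [set` L].
exists (fun j => if unlift ord_max j is Some k then e k else x) => y yC.
rewrite (bigD1_ord ord_max) //= unlift_none => E.
have {}E : x * y ord_max + \sum_k e k * y (lift ord_max k) = 0.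
  by rewrite -[RHS]E; congr (_ + _); apply: eq_bigr => k _; rewrite liftK.
have [y0|y0] := eqVneq (y ord_max) 0.
  move: E; rewrite y0 mulr0 add0r => /(eP _ (fun k => yC _)) yk j.
  by have [k ->|->] := unliftP ord_max j.
have [z Cz zy] := es_inv (yC ord_max) y0.
case: xL; have -> : x = - \sum_k e k * (y (lift ord_max k) * z).
  rewrite -[LHS]mulr1 -zy (es_comm Cz (yC _)) mulrA.
  move/eqP: E; rewrite addr_eq0 => /eqP->; rewrite mulNr mulr_suml.
  by congr (- _); apply: eq_bigr => k _; rewrite mulrA.
apply: (subN subL); apply: (sub_sum subL) => k _.
have [c ->] := lP _ (es_mul (yC (lift ord_max k)) Cz).
rewrite mulr_sumr; apply: (sub_sum subL) => i _; rewrite end_scaleAr.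
apply: (subZ subL); apply: sub_span => /=; apply: allpairs_f; exact: mem_enum.
Qed.

Lemma end_algebraic f : algebraic_end f.
Proof.
have [s sE] := end_finite_dim; set n := size s.
have coord g : exists c : 'I_n -> F, g = \sum_i c i *: s`_i.
  have : span [set` s] g by rewrite -sE.
  move: g; apply: span_min => [|g /= gs].
    apply/subspaceP; split=> /= [|a g h [c ->] [d ->]].
      by exists (fun=> 0); rewrite big1 // => i _; rewrite scale0r.
    exists (fun i => a * c i + d i); rewrite scaler_sumr -big_split.
    by apply: eq_bigr => i _; rewrite scalerDl scalerA.
  have lt_g : (index g s < n)%N by rewrite index_mem.
  exists (fun i => (i == Ordinal lt_g)%:R).
  rewrite (bigD1 (Ordinal lt_g)) //= eqxx scale1r nth_index // big1 ?addr0 //.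
  by move=> i /negbTE->; rewrite scale0r.
have /choice[c cP] : forall j : nat, exists c : 'I_n -> F, f ^+ j = \sum_i c i *: s`_i.
  by move=> j; apply: coord.
have divF (x : F) : x != 0 -> exists y, y * x = 1 /\ x * y = 1.
  by move=> x0; exists x^-1; rewrite mulVf ?mulfV.
have [y [[j0 yj0] yc]] := underdetermined_system divF
  (fun (j : 'I_n.+1) i => c j i) (oner_neq0 F).
pose p := \poly_(j < n.+1) y (inord j).
have pj (j : 'I_n.+1) : p`_j = y j by rewrite coef_poly ltn_ord inord_val.
exists p; first by apply: contraNneq yj0 => p0; rewrite -pj p0 coef0.
have -> : \sum_(i < size p) p`_i *: f ^+ i = \sum_(i < n.+1) p`_i *: f ^+ i.
  rewrite (big_ord_widen n.+1 (fun i => p`_i *: f ^+ i)) ?size_poly //.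
  rewrite [RHS](bigID (fun i : 'I_n.+1 => i < size p)%N) /=.
  rewrite [X in _ = _ + X]big1 ?addr0 // => i; rewrite -leqNgt => le_i.
  by rewrite nth_default // scale0r.
transitivity (\sum_i (\sum_(j < n.+1) c j i * y j) *: s`_i); last first.
  by rewrite big1 // => i _; rewrite yc scale0r.
transitivity (\sum_(j < n.+1) \sum_i (c j i * y j) *: s`_i); last first.
  by rewrite exchange_big; apply: eq_bigr => i _; rewrite scaler_suml.
apply: eq_bigr => j _; rewrite pj cP scaler_sumr.
by apply: eq_bigr => i _; rewrite scalerA mulrC.
Qed.

(** A linear factor of an annihilating polynomial gives [(f - a) q(f) = 0] in a division ring:
    either [f = a], or [q] annihilates [f] and has smaller degree. *)
Lemma end_closed f : GRing.closed_field_axiom F -> exists a, f = a *: (1 : voa_end M).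
Proof.
move=> closedF.
pose ev (p : {poly F}) : voa_end M := \sum_(i < size p) p`_i *: f ^+ i.
have evE n (p : {poly F}) : (size p <= n)%N -> ev p = \sum_(i < n) p`_i *: f ^+ i.
  move=> le_n; rewrite /ev (big_ord_widen n (fun i => p`_i *: f ^+ i)) //.
  rewrite [RHS](bigID (fun i : 'I_n => i < size p)%N) /=.
  rewrite [X in _ = _ + X]big1 ?addr0 // => i; rewrite -leqNgt => le_i.
  by rewrite nth_default // scale0r.
have ev_XsubC a q : ev (q * ('X - a%:P)) = (f - a *: (1 : voa_end M)) * ev q.
  rewrite mulrBr (@evE (size q).+1); last first.
    rewrite (leq_trans (size_polyD _ _)) // geq_max size_polyN.
    rewrite (leq_trans (size_polyMleq _ _)) ?size_polyX ?addn2 //=.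
    by rewrite mulrC mul_polyC (leq_trans (size_scale_leq _ _)).
  under eq_bigr => i _ do rewrite coefB coefMX coefMC scalerBl.
  rewrite sumrB big_ord_recl /= scale0r add0r mulrBl; congr (_ - _).
    by rewrite /ev mulr_sumr; apply: eq_bigr => i _; rewrite end_scaleAr -exprS.
  rewrite end_scaleAl mul1r (@evE (size q).+1) // scaler_sumr.
  by apply: eq_bigr => i _; rewrite scalerA mulrC.
have root_ex (p : {poly F}) : (1 < size p)%N -> exists a, root p a.
  move=> szp; set n := (size p).-1; have szpE : size p = n.+1 by rewrite prednK // (ltn_trans _ szp).
  have lc0 : lead_coef p != 0 by rewrite lead_coef_eq0 -size_poly_gt0 szpE.
  have [|a aP] := closedF n (fun i => - p`_i / lead_coef p).
    by rewrite -ltnS -szpE.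
  exists a; rewrite /root horner_coef szpE big_ord_recr /= aP.
  rewrite mulr_sumr -big_split big1 //= => i _.
  rewrite [p`_n](_ : _ = lead_coef p); last by rewrite /lead_coef szpE.
  by rewrite !mulNr mulrN mulrA mulrCA mulfV // mulr1 subrr.
have [p p0 pf] := end_algebraic f.
have [n] := ubnP (size p); elim: n p p0 pf => // n IHn p p0 pf lt_n.
have [|a pa] := root_ex p.
  rewrite ltnNge; apply/negP => /size1_polyC pC.
  move: pf p0; rewrite -/(ev p) (@evE 1%N) ?big_ord1 ?expr0; last first.
    by rewrite pC size_polyC leq_b1.
  rewrite pC coefC /= polyC_eq0 => E p0.
  have : (1 : voa_end M) = (p`_0)^-1 *: (p`_0 *: (1 : voa_end M)).
    by rewrite scalerA mulVf // scale1r.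
  by rewrite E scaler0 => /eqP; rewrite (negbTE end_oner_neq0).
have /factor_theorem[q pq] := pa.
have q0 : q != 0 by apply: contraNneq p0 => q0; rewrite pq q0 mul0r.
have : ev p = 0 by []; rewrite pq ev_XsubC => E.
have [qf|qf] := eqVneq (ev q) 0.
  apply: (IHn q) => //; move: lt_n; rewrite pq size_mul ?polyXsubC_eq0 //.
  by rewrite size_XsubC addn2.
have [g [_ qg]] := end_division irrM qf.
exists a; apply/eqP; rewrite -subr_eq0.
have <- : (f - a *: (1 : voa_end M)) * ev q * g = f - a *: (1 : voa_end M).
  by rewrite -mulrA qg mulr1.
by rewrite E mul0r.
Qed.

Lemma end_iso_baseP :
  (forall f, exists a, f = a *: (1 : voa_end M)) <-> end_iso_base M.
Proof.
split=> [scal|[phi [psi psiK phiK]] f]; last first.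
  exists (psi f); rewrite -[LHS]phiK.
  have := linearZ_LR phi (psi f) 1; rewrite rmorph1 => <-.
  by congr (phi _); apply/esym/mulr1.
have scaleI a b : a *: (1 : voa_end M) = b *: (1 : voa_end M) -> a = b.
  move=> /eqP; rewrite -subr_eq0 -scalerBl => /eqP ab; apply/eqP.
  rewrite -subr_eq0; apply/negP => /negP ab0; have := end_oner_neq0.
  by rewrite -[1]scale1r -(mulVf ab0) -scalerA ab scaler0 eqxx.
pose phi : F^o -> voa_end M := fun a => (a : F) *: (1 : voa_end M).
have phiZ : zmod_morphism phi by move=> a b; rewrite /phi scalerBl.
have phiM : monoid_morphism phi.
  split=> [|a b]; rewrite /phi ?scale1r //.
  by rewrite end_scaleAl mul1r scalerA.
have phiL : scalable phi by move=> a b; rewrite /phi scalerA.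
pose phi1 := GRing.isZmodMorphism.Build _ _ phi phiZ.
pose phi2 := GRing.isMonoidMorphism.Build _ _ phi phiM.
pose phi3 := GRing.isScalable.Build _ _ _ _ phi phiL.
pose phiLR : {lrmorphism F^o -> voa_end M} := HB.pack phi phi1 phi2 phi3.
have [psi psiP] := choice scal.
exists phiLR; exists psi => [a|f]; last exact: esym (psiP f).
by apply: scaleI; exact: esym (psiP (phi a)).
Qed.

End FiniteDim.

(** * Commutators with [L(0)] and its eigenvalues *)

Section L0.
Variables (F : fieldType) (V : voa F) (M : admissible_module V).
Notation L0 := (adm_Y (voa_conf V) 1 : M -> M).

Let hM := adm_weak (admP M).

Lemma conf0E (v : V) : voa_Y (voa_conf V) 0 v = voa_Y v (- 2%:Z) (voa_vac V).
Proof.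
have := voa_derivation (voaP V) v (voa_vac V) (-1).
by rewrite (va_creationN1 (voa_va (voaP V))) => ->.
Qed.

(* [L(-1) v = v_(-2) 1], and the Jacobi identity for [v], [1] computes its modes. *)
Lemma mode_derivation (v : V) n (w : M) :
  adm_Y (voa_Y (voa_conf V) 0 v) n w = adm_Y v (n - 1) w *~ (- n).
Proof.
rewrite conf0E.
have coefN2 i : expand_coef (- 2%:Z) i = i.+1.
  by rewrite /expand_coef /= signrMK add1n binSn.
have [N0 J] := wm_jacobi hM v (voa_vac V) w (- 2%:Z) 0 n.
(* The only nonzero mode of the vacuum is -1, so on the left just the index [|n| - 1] survives, in
   the first sum for [n < 0] and in the second for [n > 0]. The length is chosen to include it. *)
have {J} := J (N0 + `|n|).+2 (leqW (leqW (leq_addr _ _))).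
set N := (N0 + _).+2.
have -> : \sum_(i < N) adm_Y (voa_Y v (- 2%:Z + i%:Z) (voa_vac V)) (0 + n - i%:Z) w
    *~ expand_coef (i%:Z - 0 - 1) i = adm_Y (voa_Y v (- 2%:Z) (voa_vac V)) n w.
  rewrite big_ord_recl expand_coefn0 mulr1z big1 ?addr0 => [|i _].
    by congr (adm_Y (voa_Y v _ _) _ _); lia.
  rewrite (_ : _ - 0 - 1 = i%:Z); last by rewrite /= /bump; lia.
  by rewrite /expand_coef /= bin_small ?mulr0 ?mulr0z // /bump; lia.
move=> <-.
have -> : \sum_(i < N) adm_Y v (- 2%:Z + 0 - i%:Z) (adm_Y (voa_vac V) (n + i%:Z) w)
    *~ expand_coef (- 2%:Z) i = if n < 0 then adm_Y v (n - 1) w *~ (- n) else 0.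
  case: ltP => n0; last first.
    rewrite big1 // => i _; rewrite (wm_vacuum hM); case: eqP => [|_]; first by lia.
    by rewrite (linear_fun0 (mode_linr _ _)) mul0rz.
  have ltN : (`|n|.-1 < N)%N by rewrite /N; lia.
  rewrite (bigD1 (Ordinal ltN)) //= big1 ?addr0 => [|i ni].
    rewrite (wm_vacuum hM); case: eqP => [_|]; last by lia.
    by rewrite coefN2; congr (adm_Y v _ _ *~ _); lia.
  rewrite (wm_vacuum hM); case: eqP => [E|_].
    by case/eqP: ni; apply/val_inj => /=; lia.
  by rewrite (linear_fun0 (mode_linr _ _)) mul0rz.
have -> : \sum_(i < N) adm_Y (voa_vac V) (- 2%:Z + n - i%:Z) (adm_Y v (0 + i%:Z) w)
    *~ ((-1) ^+ `|- 2%:Z|%N * expand_coef (- 2%:Z) i)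
    = if 0 < n then adm_Y v (n - 1) w *~ n else 0.
  case: ltP => n0; last first.
    rewrite big1 // => i _; rewrite (wm_vacuum hM); case: eqP => [|_]; first by lia.
    by rewrite mul0rz.
  have ltN : (`|n|.-1 < N)%N by rewrite /N; lia.
  rewrite (bigD1 (Ordinal ltN)) //= big1 ?addr0 => [|i ni].
    rewrite (wm_vacuum hM); case: eqP => [_|]; last by lia.
    by rewrite coefN2; congr (adm_Y v _ _ *~ _); lia.
  rewrite (wm_vacuum hM); case: eqP => [E|_]; last by rewrite mul0rz.
  by case/eqP: ni; apply/val_inj => /=; lia.
case: (ltgtP n 0) => [n0|n0|->].
- by rewrite subr0.
- by rewrite sub0r mulrNz.
- by rewrite subr0 oppr0 mulr0z.
Qed.

(** In the commutator formula only [(L(-1) v)_(n+1)] and [(L(0) v)_n] survive; they contribute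
    [-(n+1)] and [s] times [v_n]. *)
Lemma mode_L0_comm s (v : V) n (w : M) : voa_gr V s v ->
  L0 (adm_Y v n w) = adm_Y v n (L0 w) + adm_Y v n w *~ (s%:Z - n - 1).
Proof.
move=> sv; have [N0 J] := wm_jacobi hM (voa_conf V) v w 0 1 n.
have {J} := J N0.+2 (leqW (leqnSn _)).
rewrite big_ord_recl big1 => [|i _]; last by rewrite expand_coef0n ?mulr0z.
rewrite big_ord_recl big1 => [|i _]; last by rewrite expand_coef0n ?mulr0 ?mulr0z.
rewrite !expand_coefn0 !addr0 mulr1 expr0 !mulr1z !add0r.
rewrite big_ord_recl big_ord_recl big1 => [|i _]; last first.
  rewrite (_ : _ - 1 - 1 = i%:Z); last by rewrite /= /bump; lia.
  by rewrite /expand_coef /= bin_small ?mulr0 ?mulr0z // /bump; lia.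
rewrite expand_coefn0 addr0 mulr1z.
rewrite (_ : expand_coef _ _ = 1) // mulr1z.
rewrite addr0 mode_derivation.
have -> : voa_Y (voa_conf V) (0 + (lift ord0 ord0 : 'I_N0.+2)%:Z) v = v *+ s.
  by rewrite -(voa_L0 (voaP V) sv).
rewrite (linear_funMn (mode_linl _ _)).
rewrite (_ : 1 + n - 1 = n); last by lia.
rewrite addr0 (addrC 1 n).
move=> /eqP; rewrite subr_eq => /eqP->; rewrite [LHS]addrC; congr (_ + _).
rewrite pmulrn -mulrzDr; congr (_ *~ _); lia.
Qed.

Lemma degree_operator (U : lmodType F) (gr : nat -> set U) : direct_sum gr ->
  exists E : U -> U, linear E /\ forall n w, gr n w -> E w = w *+ n.
Proof.
move=> dU; have [pr [lpr prK pr0]] := projections_ex dU.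
have bound w : exists N, forall n, (N <= n)%N -> pr n w = 0.
  have [N [x [grx ->]]] := ds_span dU w; exists N => n le_n.
  rewrite (big_morph (pr n) (linear_funD (lpr n)) (linear_fun0 (lpr n))).
  rewrite big1 // => i _; apply: pr0 (grx i).
  by rewrite gtn_eqF // (leq_trans (ltn_ord i)).
have /choice[N NP] := bound.
pose E w := \sum_(n < N w) pr n w *+ n.
have EE w k : (N w <= k)%N -> E w = \sum_(n < k) pr n w *+ n.
  move=> le_k; rewrite /E (big_ord_widen k (fun n => pr n w *+ n) le_k).
  rewrite [RHS](bigID (fun i : 'I_k => i < N w)%N) /=.
  rewrite [X in _ = _ + X]big1 ?addr0 // => i; rewrite -leqNgt => /NP->.
  by rewrite mul0rn.
exists E; split=> [a x y|n w nw].
  pose k := (N (a *: x + y)%R + N x + N y)%N.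
  rewrite !(@EE _ k) ?scaler_sumr -?big_split /k; try by lia.
  by apply: eq_bigr => n _; rewrite lpr mulrnDl scalerMnr.
rewrite (@EE _ (N w + n.+1)%N) ?leq_addr //.
have lt_n : (n < N w + n.+1)%N by lia.
rewrite (bigD1 (Ordinal lt_n)) //= prK // big1 ?addr0 // => i ni.
by rewrite (pr0 _ _ _ _ nw) ?mul0rn.
Qed.

(** [L(0)] and the degree operator [E] both have commutator [(s - n - 1) v_n] with [v_n], so their
    difference is an endomorphism, hence a scalar. *)
Lemma L0_eigen (irrM : irreducible M) :
  (forall f : voa_end M, exists a, f = a *: (1 : voa_end M)) ->
  exists lambda : F, forall (n : nat) (w : M), adm_gr M n w ->
    L0 w = (lambda + n%:R) *: w.
Proof.
move=> scal; have dM := adm_direct (admP M).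
have [E [lE EP]] := degree_operator dM.
have EI d w : gr_int (adm_gr M) d w -> E w = w *~ d.
  case: d => [d|d] /= dw; first exact: EP dw.
  by rewrite dw (linear_fun0 lE) mul0rz.
pose h w := L0 w - E w.
have lh : linear h.
  move=> a x y; rewrite /h mode_linr lE scalerBr opprD !addrA; congr (_ + _).
  by rewrite addrAC.
have comm u n w : h (adm_Y u n w) = adm_Y u n (h w).
  have [Nu [xu [hxu ->]]] := homog_decomp u.
  have [Nw [xw [hxw ->]]] := ds_span dM w.
  have hsum (I : Type) (r : seq I) (x : I -> M) : h (\sum_(i <- r) x i) = \sum_(i <- r) h (x i).
    exact: (big_morph h (linear_funD lh) (linear_fun0 lh)).
  rewrite !mode_sum hsum; apply: eq_bigr => i _.
  have msum (x : 'I_Nw -> M) : adm_Y (xu i) n (\sum_k x k) = \sum_k adm_Y (xu i) n (x k).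
    exact: (big_morph _ (linear_funD (mode_linr _ _)) (linear_fun0 (mode_linr _ _))).
  rewrite msum !hsum msum; apply: eq_bigr => j _.
  rewrite /h (mode_L0_comm _ _ (hxu i)) (EI _ _ (adm_weight (admP M) n (hxu i) (hxw j))).
  rewrite (EP _ _ (hxw j)) modeB (linear_funMn (mode_linr _ _)) -addrA; congr (_ + _).
  by rewrite -mulrzBr pmulrn -mulrNz; congr (_ *~ _); lia.
have hP : `[< is_voa_end h >] by apply/asboolP.
have [lambda hl] := scal (VOAEnd hP); exists lambda => n w nw.
have hw : h w = lambda *: w by rewrite -[h w]/(VOAEnd hP w) hl.
by rewrite -(subrK (E w) (L0 w)) -/(h w) hw (EP _ _ nw) scalerDl scaler_nat.
Qed.
End L0.

(** * Absolute irreducibility *)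

Section TensorFunctional.
Variables (F K : fieldType) (emb : {rmorphism F -> K}) (M : lmodType F).

Lemma tens_functional (psi : M -> F^o) : linear psi ->
  exists P : tens emb M -> K^o, linear P /\ forall k v, P (tpure emb k v) = k * emb (psi v).
Proof.
move=> lpsi; pose P := @tlift F K emb M K^o (fun v => emb (psi v)).
have semi c u v : emb (psi (c *: u + v)) = emb c *: (emb (psi u) : K^o) + emb (psi v) :> K^o.
  by rewrite lpsi rmorphD rmorphM.
exists P; split; first exact: tlift_linear.
by move=> k v; rewrite /P tlift_pure.
Qed.

Lemma tin_neq0 (v : M) : v != 0 -> tin emb v != 0.
Proof.
move=> v0; have [psi [lpsi psiv]] := functional_ex v0.
have [P [lP PE]] := tens_functional lpsi.
apply: contra_neq (oner_neq0 K) => /(congr1 P).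
by rewrite PE psiv rmorph1 mulr1 (linear_fun0 lP).
Qed.

End TensorFunctional.

Section SplitByEnd.
Variables (F : fieldType) (V : voa F) (M : admissible_module V).
Hypothesis irrM : irreducible M.
Variable C : end_subfield M.
Notation K := (es_type C).
Notation emb := (es_scal C : {rmorphism F -> K}).
Notation MK := (module_base_change emb M).
Let hM := adm_weak (admP M).

Let act : tens emb M -> es_module_of C := @tlift F K emb M (es_module_of C) (fun v : M => v).
Let act_semi (c : F) (u v : M) :
  (c *: u + v : es_module_of C) = emb c *: (u : es_module_of C) + (v : es_module_of C).
Proof. by []. Qed.
Let act_lin : linear act. Proof. exact: tlift_linear act_semi. Qed.
Let act_pure k v : act (tpure emb k v) = es_val k v.
Proof. by rewrite /act tlift_pure. Qed.

(* If [M^K] is irreducible, the kernel of the action map [K (x) M -> M] is zero;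
   it contains [k (x) w - 1 (x) k w]. *)
Lemma end_subfield_scalar : irreducible MK ->
  forall k : K, exists a, k = es_scal C a.
Proof.
move=> [_ irrK] k; pose N : set MK := [set y : tens emb M | act y = 0].
have dM := adm_direct (admP M).
have act_mode (u : V) n (y : tens emb M) :
    act (base_change_op (@adm_Y F V M) (tin emb u) n y) = adm_Y u n (act y : M).
  move: y; apply: (tens_eq_lin (W := es_module_of C)) => [a x y|a x y|v].
  - by rewrite (base_change_op_linr hM) act_lin.
  - rewrite act_lin !es_moduleZ (linear_funD (mode_linr _ _)).
    by rewrite -end_mode.
  - by rewrite (base_change_op_tin emb hM) !act_pure.
have subN : admissible_submodule N.
  split=> [|x n y Ny|y Ny].
  - apply/subspaceP; split=> [|a x y]; first exact: linear_fun0 act_lin.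
    rewrite /N /= => x0 y0; rewrite act_lin x0 y0 scaler0 addr0 //.
  - change (act (base_change_op (@adm_Y F V M) x n y) = 0).
    elim/tens_ind: x => [c x x' IH IH'||u].
    + by rewrite (base_change_op_linl hM) act_lin IH IH' scaler0 addr0.
    + by rewrite (linear_fun0 (base_change_op_linl hM _ _)) (linear_fun0 act_lin).
    + rewrite act_mode (_ : act y = 0) //.
      exact: linear_fun0 (mode_linr _ _).
  have dMK := adm_direct (admP MK).
  have [m [x [grx def_y]]] := ds_span dMK y.
  have actx i : adm_gr M i (act (x i)).
    have subi := ds_subspace dM i.
    apply: (@tspan_sub _ _ emb _ (adm_gr M i) [set z | adm_gr M i (act z)]) (grx i).
      apply/subspaceP; split=> [|a u v Hu Hv] /=.
        by rewrite (linear_fun0 act_lin); apply: sub0 subi.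
      rewrite act_lin; apply: (subD subi) => //.
      by rewrite es_moduleZ; apply: end_homog.
    by move=> v iv /=; rewrite act_pure.
  have : \sum_(i < m) (act (x i) : M) = 0.
    rewrite -[RHS](_ : act y = 0) // def_y.
    by rewrite (big_morph act (linear_funD act_lin) (linear_fun0 act_lin)).
  move=> /(ds_indep dM (x := fun i => act (x i)) actx) x0.
  rewrite def_y; apply: (sub_sum (span_subspace _)) => i _; apply: sub_span.
  split; last by exists i.
  exact: x0.
have [[w w0] _] := irrM.
have N0 : N = [set 0].
  have [//|NT] := irrK _ subN.
  have : N (tin emb w) by rewrite NT.
  rewrite /N /= act_pure => /eqP; rewrite (negbTE w0) //.
have kw : tpure emb k w = tin emb (es_val k w : M).
  apply/eqP; rewrite -subr_eq0; apply/eqP.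
  have : N (tpure emb k w - tin emb (es_val k w : M)).
    rewrite /N /= -scaleN1r addrC act_lin !act_pure.
    by rewrite scaleN1r addNr.
  by rewrite N0.
have [psi [lpsi psiw]] := functional_ex w0.
have [P [lP PE]] := tens_functional emb lpsi.
(* The base change of [psi], applied to [k (x) w = 1 (x) k w], gives [k = psi (k w)], a scalar from
   [F]. *)
exists (psi (es_val k w)); have := congr1 P kw.
by rewrite !PE psiw rmorph1 mulr1 mul1r.
Qed.

End SplitByEnd.

Lemma projections_homog (F : fieldType) (U : lmodType F) (gr : nat -> set U)
    (pr : nat -> U -> U) : direct_sum gr ->
  [/\ forall n, linear (pr n), forall n v, gr n v -> pr n v = v
    & forall n m v, n != m -> gr m v -> pr n v = 0] ->
  forall n v, gr n (pr n v).
Proof.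
move=> dU [lpr prK pr0] n v; have [N [x [grx ->]]] := ds_span dU v.
have subn := ds_subspace dU n.
rewrite (big_morph (pr n) (linear_funD (lpr n)) (linear_fun0 (lpr n))).
apply: (sub_sum subn) => i _; have [<-|ni] := eqVneq (i : nat) n.
  by rewrite prK.
by rewrite (pr0 _ i) 1?eq_sym //; apply: sub0 subn.
Qed.

Section AbsolutelyIrreducible.
Variables (F : fieldType) (V : voa F) (M : admissible_module V).
Hypothesis irrM : irreducible M.
Hypothesis scal : forall f : voa_end M, exists a, f = a *: (1 : voa_end M).
Variables (K : fieldType) (emb : {rmorphism F -> K}).
Notation MK := (module_base_change emb M).
Let hM := adm_weak (admP M).
Let dM := adm_direct (admP M).

(** The submodule of [M^r] generated by the tuple [w] under the diagonal action; zero arises as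
    [-w + w]. *)
Inductive diag_submodule r (w : 'I_r -> M) : ('I_r -> M) -> Prop :=
| diag_gen : diag_submodule w w
| diag_lin a y z : diag_submodule w y -> diag_submodule w z ->
    diag_submodule w (fun i => a *: y i + z i)
| diag_mode u n z : diag_submodule w z -> diag_submodule w (fun i => adm_Y u n (z i)).

Let T r (k : 'I_r -> K) (z : 'I_r -> M) : tens emb M := \sum_i tpure emb (k i) (z i).

Lemma tens_finite_sum (y : tens emb M) : exists r (k : 'I_r -> K) z, y = T k z.
Proof.
pose s := repr y; exists (size s), (fun i => (tnth (in_tuple s) i).1).
exists (fun i => (tnth (in_tuple s) i).2).
by rewrite -[LHS]tmk_repr tmk_sum (big_tnth _ _ s).
Qed.

Let TD r (k : 'I_r -> K) a y z :
  T k (fun i => a *: y i + z i) = emb a *: T k y + T k z.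
Proof.
rewrite /T scaler_sumr -big_split; apply: eq_bigr => i _.
by rewrite tpureDr tpureZr.
Qed.

Let Tmode r (k : 'I_r -> K) u n z :
  base_change_op (@adm_Y F V M) (tin emb u) n (T k z) = T k (fun i => adm_Y u n (z i)).
Proof.
have linr := base_change_op_linr hM (tin emb u) n.
rewrite /T (big_morph _ (linear_funD linr) (linear_fun0 linr)).
by apply: eq_bigr => i _; rewrite (base_change_op_pure emb hM) mul1r.
Qed.

Section Submodule.
Variable N : set MK.
Hypothesis subN : admissible_submodule N.
Let sN : subspace N := sub_subspace subN.

Lemma submodule_component (pr : nat -> M -> M) n r (k : 'I_r -> K) z :
  [/\ forall n, linear (pr n), forall n v, adm_gr M n v -> pr n v = v
    & forall n m v, n != m -> adm_gr M m v -> pr n v = 0] ->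
  N (T k z) -> N (T k (fun i => pr n (z i))).
Proof.
move=> [lpr prK pr0].
pose P := @tlift F K emb M (tens emb M) (fun v => tin emb (pr n v)).
have semi c u v : tin emb (pr n (c *: u + v)) = emb c *: tin emb (pr n u) + tin emb (pr n v).
  by rewrite lpr raddfD /= tinZ.
have lP : linear P by exact: tlift_linear semi.
have -> : T k (fun i => pr n (z i)) = P (T k z).
  rewrite /T (big_morph P (linear_funD lP) (linear_fun0 lP)).
  by apply: eq_bigr => i _; rewrite /P tlift_pure // [LHS]tpure1.
move/(sub_graded subN); move: (T k z).
apply: (span_min (A := [set y | N (P y)])) => [|y [Ny [m my]] /=].
  apply/subspaceP; split=> [|a u v Hu Hv] /=.
    by rewrite (linear_fun0 lP); apply: sub0 sN.
  by rewrite lP; apply: (subD sN) => //; apply: (subZ sN).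
have -> : P y = if n == m then y else 0; last by case: eqP => // _; apply: sub0 sN.
apply: (@tspan_sub _ _ emb _ (adm_gr M m) [set y | P y = if n == m then y else 0]) my.
  apply/subspaceP; split=> [|a u v /= Hu Hv] /=.
    by rewrite (linear_fun0 lP); case: eqP.
  by rewrite lP Hu Hv; case: eqP => // _; rewrite scaler0 addr0.
have PE v : P (tin emb v) = tin emb (pr n v) by rewrite /P tlift_pure // scale1r.
move=> v mv /=; rewrite PE.
have [->|nm] := eqVneq n m; first by rewrite prK.
by rewrite (pr0 n m) // raddf0.
Qed.

Lemma tens_component_eq0 (pr : nat -> M -> M) r (k : 'I_r -> K) z :
  [/\ forall n, linear (pr n), forall n v, adm_gr M n v -> pr n v = v
    & forall n m v, n != m -> adm_gr M m v -> pr n v = 0] ->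
  (forall n, T k (fun i => pr n (z i)) = 0) -> T k z = 0.
Proof.
move=> [lpr prK pr0] T0.
have /choice[b bP] : forall v : M, exists b, v = \sum_(n < b) pr n v /\
    forall n, (b <= n)%N -> pr n v = 0.
  move=> v; have [b [x [grx x0 def_v]]] := decomp_ex dM v.
  have prv n : pr n v = x n.
    rewrite def_v (big_morph (pr n) (linear_funD (lpr n)) (linear_fun0 (lpr n))).
    have [lt_n|le_n] := ltnP n b.
      rewrite (bigD1 (Ordinal lt_n)) //= prK // big1 ?addr0 // => i ni.
      by apply: pr0 (grx i); rewrite eq_sym -val_eqE in ni *.
    rewrite big1 ?x0 // => i _; apply: pr0 (grx i).
    by rewrite gtn_eqF // (leq_trans (ltn_ord i)).
  exists b; split=> [|n le_n]; last by rewrite prv x0.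
  by rewrite {1}def_v; apply: eq_bigr => i _; rewrite prv.
pose B := (\max_i b (z i))%N.
have zE i : z i = \sum_(n < B) pr n (z i).
  have [zi z0] := bP (z i); rewrite {1}zi.
  have leB : (b (z i) <= B)%N by apply: leq_bigmax.
  rewrite (big_ord_widen B (fun n => pr n (z i)) leB).
  rewrite [RHS](bigID (fun n : 'I_B => n < b (z i))%N) /=.
  by rewrite [X in _ = _ + X]big1 ?addr0 // => n; rewrite -leqNgt => /z0.
have -> : T k z = \sum_(n < B) T k (fun i => pr n (z i)).
  rewrite exchange_big; apply: eq_bigr => i _.
  rewrite {1}zE [LHS]tpure1 -/(tin emb _) raddf_sum scaler_sumr.
  by apply: eq_bigr => n _; rewrite [RHS]tpure1.
by rewrite big1.
Qed.

(** In a nonzero tensor of minimal length in [N] the [k i] are independent over [F]. Hence the first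
    coordinate of the diagonal submodule determines the others, which become endomorphisms of [M],
    that is, scalars [a i]; so the tensor is pure. *)
Lemma submodule_full : N <> [set 0] -> N = setT.
Proof.
move=> N0; have [pr prP] := projections_ex dM.
pose Q r := `[< exists (k : 'I_r -> K) z, N (T k z) /\ T k z <> 0 >].
have exQ : exists r, Q r.
  apply: contrapT => nQ; apply: N0; apply/seteqP; split=> [y Ny|_ ->]; last exact: sub0 sN.
  apply: contrapT => y0; apply: nQ; have [r [k [z E]]] := tens_finite_sum y.
  by exists r; apply/asboolP; exists k, z; rewrite -E.
have [r /asboolP[k [z [Nz z0]]] rmin] := ex_minnP exQ.
have short r' (k' : 'I_r' -> K) z' : (r' < r)%N -> N (T k' z') -> T k' z' = 0.
  move=> lt_r Nz'; apply: contrapT => z'0; suff /rmin : Q r' by rewrite leqNgt lt_r.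
  by apply/asboolP; exists k', z'.
(* Passing to a nonzero homogeneous component keeps the length; [homog_span_full] needs a
   homogeneous vector. *)
have [n Tn0] : exists n, T k (fun i => pr n (z i)) <> 0.
  apply: contrapT => nT; apply: z0; apply: (tens_component_eq0 prP) => n.
  by apply: contrapT => Tn; apply: nT; exists n.
pose w i := pr n (z i); have wn i : adm_gr M n (w i) by apply: projections_homog dM prP n _.
have Nw : N (T k w) by apply: submodule_component prP Nz.
have {Tn0} Tw0 : T k w <> 0 by [].
case: r => [|r] in k z Nz z0 rmin short w wn Nw Tw0 *; first by rewrite /T big_ord0 in z0.
have Tlift (k' : 'I_r.+1 -> K) z' j : T k' z' = tpure emb (k' j) (z' j) +
    T (fun i => k' (lift j i)) (fun i => z' (lift j i)).
  by rewrite /T (bigD1_ord j).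
have tpure0 a : tpure emb a (0 : M) = 0 by rewrite [LHS]tpure1 -/(tin emb _) raddf0 scaler0.
have GN z' : diag_submodule w z' -> N (T k z').
  elim=> [//|a x y _ Nx _ Ny|u m x _ Nx].
    by rewrite TD; apply: (subD sN) => //; apply: (subZ sN).
  by rewrite -Tmode; apply: (sub_stable subN).
(* With first entry zero, [T k z'] can be written with fewer terms, so it is 0. A functional equal
   to 1 at a nonzero [z' j] would then make [k j] an [F]-combination of the other [k i], and [T k w]
   could be shortened. *)
have G0 z' : diag_submodule w z' -> z' ord0 = 0 -> forall j, z' j = 0.
  move=> Gz' z'0 j; apply: contrapT => /eqP z'j.
  have : T k z' = 0.
    have := GN _ Gz'; rewrite (Tlift _ _ ord0) z'0 tpure0 add0r => ?.
    exact: short.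
  have [psi [lpsi psij]] := functional_ex z'j.
  have [P [lP PE]] := tens_functional emb lpsi.
  move=> /(congr1 P); rewrite (linear_fun0 lP) (Tlift _ _ j) (linear_funD lP) PE.
  rewrite psij rmorph1 mulr1 /T (big_morph P (linear_funD lP) (linear_fun0 lP)).
  under eq_bigr => i _ do rewrite PE.
  move=> /eqP; rewrite addr_eq0 => /eqP kj; apply: Tw0.
  have E : T k w = T (fun i => k (lift j i))
      (fun i => - psi (z' (lift j i)) *: w j + w (lift j i)).
    rewrite (Tlift _ _ j) /T [in RHS](eq_bigr (fun i =>
        - (k (lift j i) * emb (psi (z' (lift j i)))) *: tin emb (w j)
        + tpure emb (k (lift j i)) (w (lift j i)))).
      by rewrite big_split /= -scaler_suml sumrN -kj -tpure1.
    move=> i _; rewrite tpureDr tpureZr; congr (_ + _).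
    by rewrite tpure1 scalerA rmorphN mulNr mulrC.
  by rewrite E; apply: short => //; rewrite -E.
have w00 : w ord0 != 0.
  apply/eqP => w00; apply: Tw0; rewrite (Tlift _ _ ord0) w00 tpure0 add0r.
  by apply: short => //; move: Nw; rewrite (Tlift _ _ ord0) w00 tpure0 add0r.
have full := homog_span_full irrM (wn ord0) w00.
(* The first coordinate is onto because [w ord0] generates [M]; by [G0] it is also injective, so
   [zf m] is the only tuple over [m] and depends on it linearly and compatibly with the modes. *)
have /choice[zf zfP] : forall m : M, exists z', diag_submodule w z' /\ z' ord0 = m.
  move=> m; have : homog_span (w ord0) m by rewrite full.
  move: m; apply: (span_min (A := [set m | exists z', diag_submodule w z' /\ z' ord0 = m])).
    apply/subspaceP; split=> [|a _ _ [x [Gx <-]] [y [Gy <-]]] /=.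
      exists (fun i => (-1) *: w i + w i); split; last by rewrite scaleN1r addNr.
      by apply: diag_lin; apply: diag_gen.
    by exists (fun i => a *: x i + y i); split=> //; apply: diag_lin.
  move=> _ [s [u [m [_ ->]]]] /=; exists (fun i => adm_Y u m (w i)); split=> //.
  exact/diag_mode/diag_gen.
have zf_uniq m z' : diag_submodule w z' -> z' ord0 = m -> forall i, zf m i = z' i.
  move=> Gz' z'm i; have [Gm m0] := zfP m.
  have := G0 _ (diag_lin (-1) Gz' Gm).
  rewrite z'm m0 scaleN1r addNr => /(_ erefl i) /eqP.
  by rewrite scaleN1r addrC subr_eq0 => /eqP.
have /choice[a aP] : forall i, exists a : F, forall m, zf m i = a *: m.
  move=> i; have hP : `[< is_voa_end (fun m => zf m i) >].
    apply/asboolP; split=> [a x y|u n' x].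
      have [Gx x0] := zfP x; have [Gy y0] := zfP y.
      by rewrite (zf_uniq _ _ (diag_lin a Gx Gy)) // x0 y0.
    have [Gx x0] := zfP x.
    by rewrite (zf_uniq _ _ (diag_mode u n' Gx)) // x0.
  have [a ha] := scal (VOAEnd hP); exists a => m.
  by rewrite -[LHS]/(VOAEnd hP m) ha.
have wE i : w i = a i *: w ord0.
  by rewrite -aP (zf_uniq _ _ (diag_gen w)).
pose c := \sum_i k i * emb (a i).
have TE : T k w = c *: tin emb (w ord0).
  rewrite /T /c scaler_suml; apply: eq_bigr => i _.
  by rewrite wE tpureZr tpure1 scalerA mulrC.
have c0 : c != 0 by apply/eqP => c0; apply: Tw0; rewrite TE c0 scale0r.
have Nw0 : N (tin emb (w ord0)).
  by rewrite -[tin _ _]scale1r -(mulVf c0) -scalerA -TE; apply: (subZ sN).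
have Ntin m : N (tin emb m).
  have : homog_span (w ord0) m by rewrite full.
  move: m; apply: (span_min (A := [set m | N (tin emb m)])).
    apply/subspaceP; split=> [|b x y Nx Ny] /=; first by rewrite raddf0; apply: sub0 sN.
    by rewrite raddfD /= tinZ; apply: (subD sN) => //; apply: (subZ sN).
  move=> _ [s [u [m [_ ->]]]] /=.
  by rewrite -(base_change_op_tin emb hM); apply: (sub_stable subN).
apply/seteqP; split=> // y _; elim/tens_ind: y => [b x y Nx Ny||v].
- by apply: (subD sN) => //; apply: (subZ sN).
- exact: sub0 sN.
- exact: Ntin.
Qed.

End Submodule.

Lemma base_change_irreducible : irreducible MK.
Proof.
split=> [|N subN].
  by have [[w w0] _] := irrM; exists (tin emb w); apply: tin_neq0.
by have [->|/(submodule_full subN)->] := pselect (N = [set 0]); [left|right].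
Qed.

End AbsolutelyIrreducible.

Theorem theorem1p1 (F : fieldType) (charF : 2%N \notin [pchar F])
    (V : voa F) (fgV : strongly_finitely_generated V)
    (M : admissible_module V) (irrM : irreducible M) :
  [/\ (forall f : voa_end M, algebraic_end f) /\ finite_dim [set: voa_end M],
      GRing.closed_field_axiom F ->
        end_iso_base M /\
        exists lambda : F, forall (n : nat) (w : M), adm_gr M n w ->
          adm_Y (voa_conf V) 1 w = (lambda + n%:R) *: w
    & absolutely_irreducible M <-> end_iso_base M].
Proof.
split; first by split; [apply: end_algebraic|apply: end_finite_dim].
- move=> closedF; have scal f := end_closed irrM fgV f closedF.
  by split; [apply/(end_iso_baseP irrM)|apply: L0_eigen irrM scal].
split=> [[_ absM]|/(end_iso_baseP irrM) scal]; last first.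
  by split=> // K emb; apply: base_change_irreducible irrM scal K emb.
(* The maximal subfield is itself the extension to test. It reduces to scalars, with which every [f]
   commutes, so [f] lies in it. *)
apply/(end_iso_baseP irrM) => f; have [C CC] := maximal_subfield irrM.
have scalC g : es_set C g -> exists a, g = a *: (1 : voa_end M).
  move=> Cg; have [a E] := end_subfield_scalar irrM
    (absM (es_type C) (es_scal C)) (EsElt (introT (asboolP _) Cg)).
  by exists a; rewrite -[g]/(es_val (EsElt (introT (asboolP _) Cg))) E.
apply/scalC/CC => g /scalC[a ->].
by rewrite end_scaleAl end_scaleAr mul1r mulr1.
Qed.
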